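(* Let $P$ be a monic polynomial of degree $n\ge2$ and let $$T(P)=\max_{P'(\zeta)=0}\ln|P(\zeta)|$$ be the largest singular value. Let $\varphi$ be the analytic function on $\{|\zeta|>e^{T(P)/n}\}$ with $P(\varphi(\zeta))=\zeta^n$ and $\varphi(\zeta)\sim\zeta$ as $\zeta\to\infty$, and let $c_k$ be the $k$-th Laurent coefficient (the coefficient of $\zeta^k$) of $\sqrt{\varphi'(\zeta)}$ near infinity. Then for all $t\ge T(P)$ the following representation holds: $$|E_P(t)|=2\pi e^{t/n}\Bigl(1+\sum_{k=2}^{+\infty}|c_{-k}|^2e^{-2kt/n}\Bigr),$$ and $$\sum_{k\ge2}|c_{-k}|^2e^{-2kT(P)/n}<+\infty .$$
   Context: For a polynomial $P$ and real $t$, $E_P(t)=\{z\in\mathbb{C}:\ln|P(z)|=t\}$ and $|E_P(t)|$ denotes its length. $\varphi$ is the inverse of the univalent branch $P^{1/n}(z)\sim z$ ($z\to\infty$) defined on $\{z:|P(z)|>e^{T(P)}\}$; $\varphi'\neq0$ on $\{|\zeta|>e^{T(P)/n}\}$, $\varphi'(\zeta)\to1$ as $\zeta\to\infty$, and the branch of $\sqrt{\varphi'}$ is the one tending to $1$ at infinity. In the trivial case $P(z)=(z-a)^n$ one has $T(P)=-\infty$; then $t$ ranges over all real numbers, all $c_{-k}$ with $k\ge 2$ vanish, and the last sum is read as $0$. *)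

(* Defs.v *)
From HB Require Import structures.
From mathcomp Require Import all_boot all_order all_algebra.
From mathcomp Require Import complex.
From mathcomp Require Import all_classical all_reals all_analysis.

Set Implicit Arguments.
Unset Strict Implicit.
Unset Printing Implicit Defensive.

Import Order.TTheory GRing.Theory Num.Theory.
Import numFieldNormedType.Exports.
Import ComplexField.Normc.

Local Open Scope classical_set_scope.
Local Open Scope ring_scope.

(* Topology and norm of the numFieldType R[i], transferred from R[i]^o: on this
   type [derivable f z 1] and [f^`()] are complex differentiability and the
   complex derivative. *)
HB.instance Definition _ (R : rcfType) := NormedModule.copy R[i] R[i]^o.

Section Defs.
Variable R : realType.
Local Notation C := R[i].

(* The filter of neighbourhoods of the point at infinity of the plane. *)
Definition cinfty : set_system C :=
  [set A | exists M : R, forall z : C, M < normc z -> A z].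

Global Instance cinfty_filter : ProperFilter cinfty.
Proof.
apply: Build_ProperFilter_ex.
  move=> A [M HA]; exists ((`|M| + 1)%:C)%C; apply: HA.
  rewrite /normc /= expr0n /= addr0 sqrtr_sqr ger0_norm ?addr_ge0//.
  by rewrite (le_lt_trans (ler_norm M))// ltrDl.
split.
- by exists 0.
- move=> A B [M HA] [N HB]; exists (Num.max M N) => z.
  by rewrite gt_max => /andP[/HA ? /HB ?].
- by move=> A B AB [M HA]; exists M => z /HA /AB.
Qed.

Definition holomorphic_on (D : set C) (f : C -> C) : Prop :=
  forall z, D z -> derivable f z 1.

(* [c k] is the coefficient of z ^ k, for every k : int, in the Laurent
   expansion of f in a punctured neighbourhood of infinity. *)
Definition laurent_coefs_at_infty (f : C -> C) (c : int -> C) : Prop :=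
  \forall z \near cinfty, exists a b : C,
    [/\ series (fun k : nat => c k%:Z * z ^+ k) @ \oo --> a,
        series (fun k : nat => c (- k.+1%:Z) * z ^- k.+1) @ \oo --> b
      & f z = a + b].

Local Open Scope ereal_scope.

(* 0 is added to the set of distances so that the empty set has diameter 0,
   since ereal_sup set0 = -oo. *)
Definition ediam (A : set C) : \bar R :=
  ereal_sup ([set 0] `|` [set (normc (x - y))%:E | x in A & y in A]).

Definition hausdorff1_pre (d : R) (A : set C) : \bar R :=
  ereal_inf [set \sum_(0 <= k <oo) ediam (U k) |
    U in [set U : (set C)^nat |
           A `<=` \bigcup_k U k /\ forall k, ediam (U k) <= d%:E]].

(* One-dimensional Hausdorff (outer) measure, normalised so that a rectifiable
   simple arc has measure its length. It is used as the length of level sets,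
   which are not simple curves when they contain critical points. *)
Definition hausdorff1 (A : set C) : \bar R :=
  ereal_sup [set hausdorff1_pre d A | d in [set d : R | (0 < d)%R]].

(* lne is the logarithm with lne 0 = -oo, so that ln|P| is -oo at the zeros
   of P. *)
Definition lnabs (P : {poly C}) (z : C) : \bar R := lne (normc P.[z])%:E.

(* The supremum is a maximum, see max_singularP below. *)
Definition max_singular (P : {poly C}) : \bar R :=
  ereal_sup [set lnabs P z | z in [set z | root P^`() z]].

Definition level_set (P : {poly C}) (t : R) : set C :=
  [set z | lnabs P z = t%:E].

(* The set |z| > e^(T/n); if T = -oo this is the punctured plane, since
   expeR -oo = 0. *)
Definition exterior (n : nat) (T : \bar R) : set C :=
  [set z | expeR (n%:R^-1%:E * T) < (normc z)%:E].

Lemma seq_max_ex (T : eqType) (f : T -> \bar R) (s : seq T) : s != [::] ->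
  exists2 x, x \in s & forall y, y \in s -> f y <= f x.
Proof.
elim: s => // a [|b s] IH _.
  by exists a; rewrite ?mem_head// => y; rewrite inE => /eqP ->.
have [x xs xmax] := IH isT.
have [fax|/ltW fxa] := leP (f a) (f x).
  exists x; first by rewrite inE xs orbT.
  by move=> y; rewrite inE => /predU1P[->//|/xmax].
exists a; rewrite ?mem_head// => y; rewrite inE => /predU1P[->//|/xmax].
by move/le_trans; apply.
Qed.

Lemma max_singularP (P : {poly C}) : (2 < size P)%N ->
  exists2 z, root P^`() z & max_singular P = lnabs P z.
Proof.
move=> sP.
have sP' : (1 < size P^`())%N.
  case E : (size P) sP => [|[|[|m]]]// _.
  have : P^`()`_m.+1 != 0%R.
    rewrite coef_deriv mulrn_eq0 /= -[m.+2]/(m.+3.-1) -E.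
    by rewrite -/(lead_coef P) lead_coef_eq0 -size_poly_eq0 E.
  rewrite ltnNge; apply: contraNN => sP'.
  by rewrite nth_default// (leq_trans sP').
have P'0 : P^`() != 0%R by rewrite -size_poly_eq0; case: size sP'.
have [rs rsE] := closed_field_poly_normal P^`().
have memr z : root P^`() z = (z \in rs).
  by rewrite rsE rootZ ?lead_coef_eq0// root_prod_XsubC.
have rs0 : rs != [::].
  apply/eqP => rs0; move: sP'; rewrite rsE rs0 big_nil alg_polyC size_polyC.
  by case: (_ != _).
have [z zrs zmax] := seq_max_ex (lnabs P) rs0.
exists z; rewrite ?memr//; apply/eqP; rewrite eq_le; apply/andP; split.
  by apply: ge_ereal_sup => _ [y /= yr <-]; apply: zmax; rewrite -memr.
by apply: ereal_sup_ubound; exists z => //=; rewrite memr.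
Qed.

End Defs.

(* Main.v *)
Require Import Defs.
From HB Require Import structures.
From mathcomp Require Import all_boot all_order all_algebra.
From mathcomp Require Import complex.
From mathcomp Require Import all_classical all_reals all_analysis.
From mathcomp Require Import ring lra zify.

Set Implicit Arguments.
Unset Strict Implicit.
Unset Printing Implicit Defensive.

Import Order.TTheory GRing.Theory Num.Theory.
Import numFieldNormedType.Exports.
Import ComplexField.Normc.

Local Open Scope classical_set_scope.
Local Open Scope ring_scope.

(** The proof uses no integrals: a mean over a circle is a mean over N-th roots
    of unity for large N, and length is the Hausdorff measure itself. Let r0 be
    e^(T/n), so that phi lives on |z| > r0, and E_r the level set |P| = r^n, where
    r = e^(t/n).

    Above the critical level, the derivative of P does not vanish on the values
    of phi, so that phi and the root s of phi' are differentiable in a strict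
    sense that is uniform on compact sets. Two consequences of this replace
    Cauchy's theorem: the means of w F'(w) over a circle tend to 0, since the
    increments of F telescope (mean_deriv_eq0), and so the limit of the means of F
    does not depend on the circle (mean_radial). Hence the Laurent coefficients
    of s are limits of means on every circle |z| = r > r0 (mean_laurent), the
    Laurent series converges to s there (laurent_series_cvg, by a telescoping
    difference quotient and Bessel's inequality), and the means of |s|^2 tend to
    the sum of the |c_(-k)|^2 r^(-2k) (mean_sqr_normc). As s tends to 1 at
    infinity, c_k = 0 for k > 0 and c_0 = 1; as s^2 is a derivative, c_(-1) = 0.

    If phi takes the same value at z and at u z with u^n = 1, it does so along the
    ray from z to infinity, where phi(z) ~ z gives u = 1. So phi is injective
    (phi_inj), and counting roots of P - v shows that it maps the circle |z| = r
    onto E_r (phi_surj). Comparing short arcs with their images under affine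
    maps, the length of E_r is 2 pi r times the limit of the means of
    |phi'| = |s|^2 (H1_circle_image), which is the formula for r > r0.

    At the critical level r = r0 > 0 the curve may have singular points. Around
    the critical points of P, at distance at most rho, every level set has length
    at most K rho with one constant K (H1_near_critical, by dyadic shells, on
    which P is almost affine at the scale of the shell). Farther away, moving x
    to the nearby solution y of P(y) = (l2 / l1) P(x) compares the lengths of two
    nearby level sets up to a factor 1 + e (level_transfer). Thus the length is
    continuous from the right at r0, and the series is as well by monotone
    convergence (length_critical). The length being finite, so is the last sum.
    If r0 = 0, the lengths stay bounded as r tends to 0, which forces c_(-k) = 0
    for all k >= 1 (coef_eq0). *)

(** * Hausdorff length *)

Section HausdorffLength.
Variable R : realType.
Local Notation C := R[i].
Local Notation pre := (@hausdorff1_pre R).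
Local Notation H1 := (@hausdorff1 R).
Implicit Types (A B : set C) (U : (set C)^nat) (d e : R).

Lemma normc_ge0 (z : C) : (0 <= normc z)%R.
Proof. by case: z => a b; rewrite /normc sqrtr_ge0. Qed.

Lemma normcB (x y : C) : normc (x - y) = normc (y - x).
Proof. by rewrite -normcN opprB. Qed.

Lemma le_normcB_trans (x y z : C) :
  (normc (x - z) <= normc (x - y) + normc (y - z))%R.
Proof. by rewrite (le_trans _ (le_normcD _ _))// addrA subrK. Qed.

Local Open Scope ereal_scope.

Lemma le_add_ereal_inf (S1 S2 : set \bar R) (m : \bar R) :
  (forall x, S1 x -> 0 <= x) -> (forall x, S2 x -> 0 <= x) ->
  (forall x y, S1 x -> S2 y -> m <= x + y) ->
  m <= ereal_inf S1 + ereal_inf S2.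
Proof.
move=> S10 S20 h.
have i1 : 0 <= ereal_inf S1 by apply: le_ereal_inf_tmp => x /S10.
have i2 : 0 <= ereal_inf S2 by apply: le_ereal_inf_tmp => x /S20.
have [->|n1] := eqVneq (ereal_inf S1) +oo; first by rewrite addye ?leey// gt_eqF// (lt_le_trans _ i2) ?ltNy0.
have [->|n2] := eqVneq (ereal_inf S2) +oo; first by rewrite addey ?leey// gt_eqF// (lt_le_trans _ i1) ?ltNy0.
have f1 : ereal_inf S1 \is a fin_num by rewrite ge0_fin_numE// ltey.
have f2 : ereal_inf S2 \is a fin_num by rewrite ge0_fin_numE// ltey.
apply/lee_addgt0Pr => e e0.
have e2 : (0 < e / 2)%R by rewrite divr_gt0.
have [x Sx xlt] := lb_ereal_inf_adherent e2 f1.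
have [y Sy ylt] := lb_ereal_inf_adherent e2 f2.
apply: (le_trans (h _ _ Sx Sy)).
rewrite [e]splitr EFinD addeACA; exact: leeD (ltW xlt) (ltW ylt).
Qed.

Lemma add_ereal_sup_le (S1 S2 : set \bar R) (m : \bar R) :
  S1 !=set0 -> S2 !=set0 ->
  (forall x, S1 x -> 0 <= x) -> (forall x, S2 x -> 0 <= x) ->
  (forall x y, S1 x -> S2 y -> x + y <= m) ->
  ereal_sup S1 + ereal_sup S2 <= m.
Proof.
move=> [x1 S1x1] [x2 S2x2] S10 S20 h.
have m0 : 0 <= m.
  apply: le_trans (h _ _ S1x1 S2x2); apply: adde_ge0; [exact: S10|exact: S20].
have [->|mfin] := eqVneq m +oo; first exact: leey.
have lem x y : 0 <= x -> 0 <= y -> x + y <= m -> x \is a fin_num.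
  move=> x0 y0 xym; rewrite ge0_fin_numE// (@le_lt_trans _ _ m) ?ltey//.
  by apply: le_trans xym; rewrite leeDl.
have s1 y : S2 y -> ereal_sup S1 + y <= m.
  move=> Sy; rewrite -leeBrDr; last first.
    by apply: (lem _ _ (S20 _ Sy) (S10 _ S1x1)); rewrite addeC; apply: h.
  apply: ge_ereal_sup => x Sx; rewrite leeBrDr; first exact: h.
  by apply: (lem _ _ (S20 _ Sy) (S10 _ S1x1)); rewrite addeC; apply: h.
have p1 : 0 <= ereal_sup S1 by apply: (le_trans (S10 _ S1x1)); apply: ereal_sup_ubound.
have f1 : ereal_sup S1 \is a fin_num by apply: (lem _ x2) => //; [exact: S20|exact: s1].
by rewrite -leeBrDl//; apply: ge_ereal_sup => y Sy; rewrite leeBrDl//; apply: s1.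
Qed.

Lemma ediam_ge0 A : 0 <= ediam A.
Proof. by apply: ereal_sup_ubound; left. Qed.

Lemma ediam_le A e : (0 <= e)%R ->
  (forall x y, A x -> A y -> (normc (x - y) <= e)%R) -> ediam A <= e%:E.
Proof.
move=> e0 h; apply: ge_ereal_sup => _ [->|[x Ax [y Ay <-]]]; rewrite lee_fin//.
exact: h.
Qed.

Lemma le_ediam A x y : A x -> A y -> (normc (x - y))%:E <= ediam A.
Proof. by move=> Ax Ay; apply: ereal_sup_ubound; right; exists x => //; exists y. Qed.

Lemma ediamS A B : A `<=` B -> ediam A <= ediam B.
Proof.
move=> AB; apply: ge_ereal_sup => _ [->|[x Ax [y Ay <-]]]; first exact: ediam_ge0.
by apply: le_ediam; apply: AB.
Qed.

Lemma ediam0 : ediam (set0 : set C) = 0.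
Proof. by apply/eqP; rewrite eq_le ediam_ge0 andbT; apply: ediam_le. Qed.

Lemma pre_ge0 d A : 0 <= pre d A.
Proof.
by apply: le_ereal_inf_tmp => _ [U _ <-]; apply: nneseries_ge0 => *; apply: ediam_ge0.
Qed.

Lemma H1_ge0 A : 0 <= H1 A.
Proof.
apply: le_ereal_sup_tmp; exists (pre 1 A); last exact: pre_ge0.
by exists 1%R => //=.
Qed.

Lemma pre_le_H1 d A : (0 < d)%R -> pre d A <= H1 A.
Proof. by move=> d0; apply: ereal_sup_ubound; exists d. Qed.

Lemma H1_le A (m : \bar R) : (forall d, (0 < d)%R -> pre d A <= m) -> H1 A <= m.
Proof. by move=> h; apply: ge_ereal_sup => _ [d /= d0 <-]; apply: h. Qed.

Lemma pre_le d A U : A `<=` \bigcup_k U k -> (forall k, ediam (U k) <= d%:E) ->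
  pre d A <= \sum_(0 <= k <oo) ediam (U k).
Proof. by move=> AU Ud; apply: ereal_inf_lbound; exists U. Qed.

Lemma pre_mono d e A B : A `<=` B -> (e <= d)%R -> pre d A <= pre e B.
Proof.
move=> AB ed; apply: ereal_inf_le_tmp => _ [U [BU Ud] <-]; exists U => //; split.
  exact: subset_trans BU.
by move=> k; apply: (le_trans (Ud k)); rewrite lee_fin.
Qed.

Lemma H1_mono A B : A `<=` B -> H1 A <= H1 B.
Proof.
by move=> AB; apply: H1_le => d d0; apply: le_trans (pre_le_H1 B d0); apply: pre_mono.
Qed.

(** Alternating between a cover of A and a cover of B gives a cover of the
    union. *)
Lemma pre_setU d A B : pre d (A `|` B) <= pre d A + pre d B.
Proof.
apply: le_add_ereal_inf => [_ [U _ <-]|_ [U _ <-]|_ _ [U [AU Ud] <-] [V [BV Vd] <-]].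
- by apply: nneseries_ge0 => *; apply: ediam_ge0.
- by apply: nneseries_ge0 => *; apply: ediam_ge0.
pose W k := if odd k then V k./2 else U k./2.
have Wd k : ediam (W k) <= d%:E by rewrite /W; case: odd.
have ABW : A `|` B `<=` \bigcup_k W k.
  move=> x [/AU|/BV] [k _ kx].
    by exists k.*2 => //; rewrite /W odd_double doubleK.
  by exists k.*2.+1 => //; rewrite /W /= odd_double /= uphalf_double.
apply: le_trans (pre_le ABW Wd) _.
have g0 X k : 0 <= ediam (X k : set C) by apply: ediam_ge0.
apply: lime_le; first by apply: is_cvg_nneseries => *; apply: g0.
apply: nearW => n.
have -> : \sum_(0 <= k <oo) ediam (U k) + \sum_(0 <= k <oo) ediam (V k) =
  \sum_(0 <= k <oo) (ediam (U k) + ediam (V k)).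
  by rewrite nneseriesD.
apply: (@le_trans _ _ (\sum_(0 <= k < n.*2) ediam (W k))).
  by apply: lee_sum_nneg_natr => //; rewrite -addnn leq_addr.
suff -> : \sum_(0 <= k < n.*2) ediam (W k) =
          \sum_(0 <= k < n) (ediam (U k) + ediam (V k)).
  by apply: nneseries_lim_ge => *; rewrite adde_ge0.
elim: n => [|n IH]; first by rewrite !big_geq.
rewrite doubleS !big_nat_recr//= IH -addeA /W /= odd_double /= uphalf_double.
by rewrite doubleK.
Qed.

Lemma H1_setU A B : H1 (A `|` B) <= H1 A + H1 B.
Proof.
apply: H1_le => d d0; apply: le_trans (pre_setU _ _ _) _.
by apply: leeD; apply: pre_le_H1.
Qed.

Lemma pre_small d A e : (0 <= e <= d)%R ->
  (forall x y, A x -> A y -> (normc (x - y) <= e)%R) -> pre d A <= e%:E.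
Proof.
move=> /andP[e0 ed] Ae; pose U k : set C := if k is 0%N then A else set0.
have Ae' := ediam_le e0 Ae.
apply: (le_trans (@pre_le d A U _ _)).
- by move=> x Ax; exists 0%N.
- case=> [|k] /=; first by apply: (le_trans Ae'); rewrite lee_fin.
  by rewrite ediam0 lee_fin (le_trans e0).
rewrite nneseries_recl//= ?eseries0 ?adde0//; last by move=> *; apply: ediam_ge0.
by case=> // k _ _; rewrite /= ediam0.
Qed.

Lemma pre0 d : (0 <= d)%R -> pre d set0 = 0.
Proof.
move=> d0; apply/eqP; rewrite eq_le pre_ge0 andbT.
by apply: (@pre_small d set0 0) => //; rewrite lexx.
Qed.

Lemma H1_set0 : H1 set0 = 0.
Proof.
by apply/eqP; rewrite eq_le H1_ge0 andbT; apply: H1_le => d d0; rewrite pre0// ltW.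
Qed.

Lemma H1_bigU (I : eqType) (r : seq I) (A : I -> set C) :
  H1 [set x | exists2 i, i \in r & A i x] <= \sum_(i <- r) H1 (A i).
Proof.
elim: r => [|i r IH].
  by rewrite big_nil -H1_set0; apply: H1_mono => x; case=> i; rewrite in_nil.
rewrite big_cons; apply: le_trans (leeD (lexx _) IH).
apply: le_trans (H1_mono _) (H1_setU _ _) => x [j].
by rewrite inE => /predU1P[->|jr] Ax; [left|right; exists j].
Qed.

Lemma H1_cover (I : eqType) (r : seq I) (B : set C) (A : I -> set C) (m : R) :
  (forall x, B x -> exists2 i, i \in r & A i x) ->
  (forall i, i \in r -> H1 (A i) <= m%:E) -> H1 B <= ((size r)%:R * m)%:E.
Proof.
move=> BA Am; apply: le_trans (H1_mono _) (le_trans (H1_bigU r A) _).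
  exact: BA.
elim: r Am {BA} => [|i r IH] Am; first by rewrite big_nil mul0r.
rewrite big_cons [size _]/= -natr1 mulrDl mul1r addrC EFinD leeD ?Am ?mem_head//.
by apply: IH => j jr; apply: Am; rewrite inE jr orbT.
Qed.

(** Pulling a cover of B back through f costs a factor L on diameters; only
    the behaviour of f at small scales matters. With a parametrisation or a
    local inverse of it as f, this gives all the comparisons of lengths below. *)
Lemma H1_expand (f : C -> C) A B (L d0 : R) : (0 < L)%R -> (0 < d0)%R ->
  (forall x, A x -> B (f x)) ->
  (forall x y, A x -> A y -> (normc (f x - f y) <= d0)%R ->
    (normc (x - y) <= L * normc (f x - f y))%R) ->
  H1 A <= L%:E * H1 B.
Proof.
move=> L0 d00 AB fL; apply: H1_le => d dgt0.
pose d' := Num.min (d / L)%R d0.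
have d'0 : (0 < d')%R by rewrite /d' lt_min divr_gt0.
have L0' : 0 <= L%:E by rewrite lee_fin ltW.
apply: (@le_trans _ _ (L%:E * pre d' B)).
2: by apply: lee_wpmul2l => //; apply: pre_le_H1.
rewrite -lee_pdivrMl//; apply: le_ereal_inf_tmp => _ [U [BU Ud] <-].
rewrite lee_pdivrMl// -nneseriesZl; last by move=> *; apply: ediam_ge0.
pose V k := A `&` f @^-1` (U k).
have VU k : ediam (V k) <= L%:E * ediam (U k).
  apply: ge_ereal_sup => _ [->|[x [Ax Ux] [y [Ay Uy] <-]]].
    by rewrite mule_ge0 ?ediam_ge0// lee_fin ltW.
  have xy : (normc (f x - f y))%:E <= ediam (U k) by apply: le_ediam.
  apply: (@le_trans _ _ (L%:E * (normc (f x - f y))%:E)); last first.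
    exact: lee_wpmul2l.
  rewrite -EFinM lee_fin fL//; rewrite -lee_fin; apply: (le_trans xy).
  by apply: (le_trans (Ud k)); rewrite lee_fin /d' ge_min lexx orbT.
apply: (@le_trans _ _ (\sum_(0 <= k <oo) ediam (V k))).
  apply: pre_le => [x Ax|k].
    by have [k _ kx] := BU _ (AB _ Ax); exists k.
  apply: (le_trans (VU k)); rewrite -lee_pdivlMl//; apply: (le_trans (Ud k)).
  by rewrite -EFinM lee_fin /d' ge_min mulrC lexx.
by apply: lee_nneseries => *; [apply: ediam_ge0|apply: VU].
Qed.

(** A set of diameter less than the gap between A and B meets only one of
    them. *)
Lemma H1_separated A B d0 : (0 < d0)%R ->
  (forall x y, A x -> B y -> (d0 <= normc (x - y))%R) ->
  H1 A + H1 B <= H1 (A `|` B).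
Proof.
move=> d00 sep; apply: add_ereal_sup_le.
- by exists (pre 1 A); exists 1%R => //=.
- by exists (pre 1 B); exists 1%R => //=.
- by move=> _ [d _ <-]; apply: pre_ge0.
- by move=> _ [d _ <-]; apply: pre_ge0.
move=> _ _ [d1 /= d10 <-] [d2 /= d20 <-].
pose d := Num.min (d0 / 2)%R (Num.min d1 d2).
have dgt0 : (0 < d)%R by rewrite /d !lt_min d10 d20 divr_gt0.
apply: le_trans (pre_le_H1 _ dgt0); apply: (@le_trans _ _ (pre d A + pre d B)).
  by apply: leeD; apply: pre_mono => //; rewrite /d !ge_min lexx ?orbT.
apply: le_ereal_inf_tmp => _ [U [ABU Ud] <-].
pose V (X : set C) k := [set x | U k x /\ X `&` U k !=set0].
have VU X k : ediam (V X k) <= ediam (U k) by apply: ediamS => x [].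
have preV X : X `<=` A `|` B -> pre d X <= \sum_(0 <= k <oo) ediam (V X k).
  move=> XAB; apply: pre_le => [x Xx|k]; last exact: le_trans (Ud k).
  by have [k _ kx] := ABU _ (XAB _ Xx); exists k => //; split => //; exists x.
apply: (@le_trans _ _ (\sum_(0 <= k <oo) ediam (V A k) +
                       \sum_(0 <= k <oo) ediam (V B k))).
  by apply: leeD; apply: preV => x; [left|right].
rewrite -nneseriesD; try by move=> *; apply: ediam_ge0.
apply: lee_nneseries => [k _ _|k _]; first by rewrite adde_ge0 ?ediam_ge0.
have V0 X : ~ (X `&` U k !=set0) -> ediam (V X k) = 0.
  by move=> nX; rewrite -ediam0; congr ediam; rewrite -subset0 => x [].
have [[x [Ax Ux]]|nA] := pselect (A `&` U k !=set0); last by rewrite (V0 A)// add0e.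
have [[y [By Uy]]|nB] := pselect (B `&` U k !=set0); last by rewrite (V0 B)// adde0.
have := le_trans (le_ediam Ux Uy) (Ud k); rewrite lee_fin => xyd.
have := le_trans (sep _ _ Ax By) xyd; rewrite /d le_min => /andP[+ _].
by rewrite ler_pdivlMr// ger_pMr// lern1.
Qed.

Lemma H1_bigU_separated (A : nat -> set C) d0 N : (0 < d0)%R ->
  (forall i j x y, (i < N)%N -> (j < N)%N -> i != j -> A i x -> A j y ->
    (d0 <= normc (x - y))%R) ->
  \sum_(i < N) H1 (A i) <= H1 (\bigcup_(i in [set i | (i < N)%N]) A i).
Proof.
move=> d00; elim: N => [|N IH] sep; first by rewrite big_ord0 H1_ge0.
rewrite big_ord_recr /=.
apply: (@le_trans _ _ (H1 (\bigcup_(i in [set i | (i < N)%N]) A i) + H1 (A N))).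
  apply: leeD => //; apply: IH => i j x y iN jN; apply: sep; exact: ltnW.
apply: le_trans (H1_separated d00 _) (H1_mono _).
  move=> x y [i /= iN Ax] Ay; apply: (sep i N) => //; last by rewrite ltn_eqF.
  exact: ltnW.
by move=> x [[i /= iN Ax]|Ax]; [exists i => //=; apply: ltnW|exists N => /=].
Qed.

(** ** Segments and circles *)

(** The convex hull of the part of a covering set on the real axis is an
    interval no longer than the diameter, so the bound follows from the
    countable subadditivity of Lebesgue measure. *)
Lemma H1_real_segment_ge (a b : R) : (a <= b)%R ->
  (b - a)%:E <= H1 [set x%:C%C | x in `[a, b]].
Proof.
move=> ab; apply: le_trans (pre_le_H1 _ (@ltr01 _)).
apply: le_ereal_inf_tmp => _ [U [AU Ud] <-].
pose S k := [set x | x \in `[a, b] /\ U k x%:C%C] : set R.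
pose V k := [set x | S k !=set0 /\ x \in `[inf (S k), sup (S k)]] : set R.
have VE k : S k !=set0 -> V k = `[inf (S k), sup (S k)]%classic.
  by move=> Sk; apply/seteqP; split => x /=; [case|].
have V0 k : ~ (S k !=set0) -> V k = set0.
  by move=> Sk; rewrite -subset0 => x [].
have Sdist k x y : S k x -> S k y -> (x - y)%:E <= ediam (U k).
  move=> [_ Ux] [_ Uy]; apply: le_trans (le_ediam Ux Uy); rewrite lee_fin.
  by rewrite -rmorphB /normc /= expr0n addr0 sqrtr_sqr ler_norm.
have Sub k : has_ubound (S k) by exists b => x [/itvP xab _]; rewrite xab.
have Slb k : has_lbound (S k) by exists a => x [/itvP xab _]; rewrite xab.
have Vmeas k : measurable (V k).
  by have [/VE ->|/V0 ->] := pselect (S k !=set0); [exact: measurable_itv|exact: measurable0].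
have abV : `[a, b]%classic `<=` \bigcup_k V k.
  move=> x xab; have [|k _ Ux] := AU x%:C%C; first by exists x.
  exists k => //; have Sx : S k x by [].
  by split; [exists x|rewrite in_itv /= ge_inf// ub_le_sup].
have : lebesgue_measure (`[a, b]%classic : set R) <=
       \sum_(0 <= k <oo) lebesgue_measure (V k : set R).
  exact: measure_sigma_subadditive.
rewrite lebesgue_measure_itv /= lte_fin -EFinB.
have [altb le_ab|ba _] := ltP a b; last first.
  rewrite (_ : (b - a)%R = 0%R); last by apply/eqP; rewrite subr_eq0 eq_le ba ab.
  by apply: nneseries_ge0 => *; apply: ediam_ge0.
apply: (le_trans le_ab); apply: lee_nneseries => // k _.
have [[x Sx]|/V0 ->] := pselect (S k !=set0); last by rewrite measure0 ediam_ge0.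
rewrite VE; last by exists x.
rewrite lebesgue_measure_itv /=; case: ifPn => _; last exact: ediam_ge0.
have Ufin : ediam (U k) \is a fin_num.
  by rewrite ge0_fin_numE ?ediam_ge0// (le_lt_trans (Ud k)) ?ltry.
rewrite -EFinB -(fineK Ufin) lee_fin lerBlDl.
apply: sup_le_ub; first by exists x.
move=> y Sy; rewrite addrC -lerBlDl; apply: lb_le_inf; first by exists x.
move=> z Sz; rewrite lerBlDl addrC -lerBlDl -lee_fin fineK//; exact: Sdist.
Qed.

Local Close Scope ereal_scope.

(** Cut the segment into equal pieces shorter than the scale d. *)
Lemma H1_real_segment_le (a l : R) A : (0 <= l)%R ->
  (forall z, A z -> exists2 x, x \in `[a, a + l] & z = x%:C%C) -> (H1 A <= l%:E)%E.
Proof.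
move=> l0 Aseg; apply: H1_le => d d0.
have [N Nl] : exists N, (l / d <= N.+1%:R)%R.
  have := archi_boundP (divr_ge0 l0 (ltW d0)); move: (Num.bound _) => N Nl.
  by exists N; apply: (le_trans (ltW Nl)); rewrite ler_nat.
pose dl := (l / N.+1%:R)%R.
have dl0 : (0 <= dl)%R by rewrite divr_ge0.
have dld : (dl <= d)%R by rewrite ler_pdivrMr// -ler_pdivrMl// mulrC.
have lE : l = (N.+1%:R * dl)%R by rewrite mulrC divfK.
pose seg (u v : R) : set C := [set z | exists2 x, x \in `[u, v] & z = x%:C%C].
pose pt (k : nat) := a + k%:R * dl.
suff h M : (pre d (seg a (pt M)) <= (M%:R * dl)%:E)%E.
  rewrite lE; apply: le_trans _ (h N.+1); apply: pre_mono => // z /Aseg.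
  by rewrite /pt -lE.
have segd u v : v = u + dl -> (pre d (seg u v) <= dl%:E)%E.
  move=> ->; apply: pre_small; first by rewrite dl0.
  move=> x y [x' + ->] [y' + ->]; rewrite !in_itv /= => /andP[x1 x2] /andP[y1 y2].
  rewrite subrr expr0n addr0 sqrtr_sqr ler_norml; lra.
elim: M => [|M IH].
  rewrite /pt !mul0r addr0; apply: pre_small; first by rewrite lexx ltW.
  move=> x y [u + ->] [v + ->]; rewrite !in_itv/= -!eq_le.
  by move=> /eqP <- /eqP <-; rewrite !subrr expr0n /= addr0 sqrtr0.
apply: (@le_trans _ _ (pre d (seg a (pt M) `|` seg (pt M) (pt M.+1)))).
  apply: pre_mono => // z [x xin ->].
  have [xm|/ltW xm] := leP x (pt M); [left|right]; exists x => //.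
    by move: xin; rewrite !in_itv /= xm => /andP[->].
  by move: xin; rewrite !in_itv /= xm => /andP[_ ->].
apply: (le_trans (pre_setU _ _ _)).
rewrite [X in (_ <= X%:E)%E](_ : _ = M%:R * dl + dl); last first.
  by rewrite -natr1 mulrDl mul1r.
rewrite EFinD; apply: leeD => //; apply: segd.
by rewrite /pt -natr1 mulrDl mul1r addrA.
Qed.

End HausdorffLength.

(** * Topology of the complex plane and strict differentiability *)

Section ComplexPlane.
Variable R : realType.
Local Notation C := R[i].
Local Notation H1 := (@hausdorff1 R).
Local Notation Re := complex.Re.
Local Notation Im := complex.Im.

Lemma norm_normc (z : C) : `|z| = (normc z)%:C%C.
Proof. by case: z. Qed.

Lemma normc_real (x : R) : normc x%:C%C = `|x|.
Proof. by rewrite /normc /= expr0n addr0 sqrtr_sqr. Qed.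

Lemma normcX (z : C) n : normc (z ^+ n) = normc z ^+ n.
Proof. by elim: n => [|n IH]; rewrite ?expr0 ?normc1// !exprS normcM IH. Qed.

Lemma normc_eq0 (z : C) : (normc z == 0) = (z == 0).
Proof. by apply/eqP/eqP => [/eq0_normc|->] //; rewrite normc0. Qed.

Lemma normc_gt0 (z : C) : (0 < normc z) = (z != 0).
Proof. by rewrite lt_def normc_ge0 andbT normc_eq0. Qed.

Lemma ler_dist_normc (x y : C) : `|normc x - normc y| <= normc (x - y).
Proof.
rewrite ler_norml; have := le_normcD (x - y) y; have := le_normcD (y - x) x.
by rewrite !subrK (normcB y x) => ? ?; apply/andP; split; lra.
Qed.

Lemma ler_sub_normc (x y : C) : normc x - normc y <= normc (x - y).
Proof. exact: le_trans (ler_norm _) (ler_dist_normc _ _). Qed.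

Lemma ler_normc_sum (I : Type) (r : seq I) (P : pred I) (F : I -> C) :
  normc (\sum_(i <- r | P i) F i) <= \sum_(i <- r | P i) normc (F i).
Proof.
elim/big_rec2: _ => [|i y x _ IH]; first by rewrite normc0.
by rewrite (le_trans (le_normcD _ _))// lerD2l.
Qed.

Lemma sqr_normc_def (z : C) : normc z ^+ 2 = Re z ^+ 2 + Im z ^+ 2.
Proof. by case: z => a b /=; rewrite sqr_sqrtr// addr_ge0// sqr_ge0. Qed.

Lemma normc_le_ReIm (z : C) : normc z <= `|Re z| + `|Im z|.
Proof.
rewrite -(@ler_pXn2r _ 2)// ?nnegrE ?normc_ge0 ?addr_ge0// sqr_normc_def.
rewrite sqrrD !real_normK ?num_real// addrAC lerDl.
by rewrite mulrn_wge0// mulr_ge0.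
Qed.

Lemma Re_le_normc (z : C) : `|Re z| <= normc z.
Proof.
by rewrite -(@ler_pXn2r _ 2)// ?nnegrE ?normc_ge0// sqr_normc_def real_normK ?num_real// lerDl sqr_ge0.
Qed.

Lemma Im_le_normc (z : C) : `|Im z| <= normc z.
Proof.
by rewrite -(@ler_pXn2r _ 2)// ?nnegrE ?normc_ge0// sqr_normc_def real_normK ?num_real// lerDr sqr_ge0.
Qed.

Lemma ReB (x y : C) : Re (x - y) = Re x - Re y.
Proof. by case: x y => ? ? [? ?]. Qed.

Lemma ImB (x y : C) : Im (x - y) = Im x - Im y.
Proof. by case: x y => ? ? [? ?]. Qed.

(** Over the real axis, the arc |Re| <= Im of a circle is a graph of slope at
    most 1. *)
Lemma quarter_circle_proj (r : R) (x y : C) : normc x = r -> normc y = r ->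
  `|Re x| <= Im x -> `|Re y| <= Im y ->
  normc (x - y) <= 2 * `|Re x - Re y|.
Proof.
move=> xr yr xq yq.
have : normc x ^+ 2 = normc y ^+ 2 by rewrite xr yr.
rewrite !sqr_normc_def => E.
apply: le_trans (normc_le_ReIm _) _; rewrite ReB ImB mulr2n mulrDl mul1r lerD2l.
rewrite ler_norml in xq; rewrite ler_norml in yq; move: xq yq; set a := Re x in E *; set b := Im x in E *.
set c := Re y in E *; set d := Im y in E * => /andP[x1 x2] /andP[y1 y2].
have [bd0|bd0] := eqVneq (b + d) 0.
  have [-> ->] : b = 0 /\ d = 0 by split; lra.
  by rewrite subrr normr0.
have bd : 0 < b + d by rewrite lt_neqAle eq_sym bd0 /=; lra.
rewrite -(ler_pM2r bd) -{1}(gtr0_norm bd) -normrM.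
have -> : (b - d) * (b + d) = (c - a) * (c + a).
  have : b ^+ 2 - d ^+ 2 = c ^+ 2 - a ^+ 2 by lra.
  by rewrite !subr_sqr.
rewrite normrM distrC ler_wpM2l// ler_norml; lra.
Qed.

(** Four rotated copies of the arc |Re| <= Im cover the circle, and the part
    of each copy in the ball projects to a real segment of length 2 sg. The
    bound does not depend on the radius of the circle. *)
Lemma H1_circle_ball (r sg : R) (v0 : C) : 0 <= sg ->
  (H1 [set v | normc v = r /\ (normc (v - v0) <= sg)%R] <= (16 * sg)%:E)%E.
Proof.
move=> sg0.
pose A (w : C) := [set v | [/\ normc v = r, normc (v - v0) <= sg &
  `|Re (w * v)| <= Im (w * v)]].
pose i : C := 'i%C; have ni : normc i = 1 by rewrite /i /normc expr0n expr1n add0r sqrtr1.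
have Hw w : normc w = 1 -> (H1 (A w) <= (4 * sg)%:E)%E.
  move=> w1; pose f v : C := (Re (w * v))%:C%C.
  pose B := [set z : C | exists2 x, x \in `[Re (w * v0) - sg, Re (w * v0) - sg + 2 * sg] & z = x%:C%C].
  apply: (@le_trans _ _ (2%:E * H1 B)%E).
    apply: (@H1_expand _ f _ _ _ 1) => // [v [_ vs _]|x y [xr _ xq] [yr _ yq] _].
      exists (Re (w * v)) => //; rewrite in_itv /=.
      have := le_trans (Re_le_normc (w * (v - v0))) _.
      move=> /(_ sg); rewrite normcM w1 mul1r mulrBr ReB => /(_ vs).
      rewrite ler_norml; lra.
    have -> : normc (x - y) = normc (w * x - w * y) by rewrite -mulrBr normcM w1 mul1r.
    rewrite /f -rmorphB normc_real.
    by apply: (@quarter_circle_proj r); rewrite ?normcM ?w1 ?mul1r.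
  have -> : (4 * sg)%:E = (2%:E * (2 * sg)%:E)%E by rewrite -EFinM; congr EFin; ring.
  rewrite lee_pmul2l//; apply: (@H1_real_segment_le _ (Re (w * v0) - sg)) => //.
  by rewrite mulr_ge0.
pose W : seq C := [:: 1; i; -1; - i].
have -> : 16 * sg = (size W)%:R * (4 * sg) by rewrite /=; ring.
apply: (H1_cover (A := A)) => [[a b] [vr vs]|w]; last first.
  rewrite !inE => /or4P[] /eqP ->; apply: Hw; by rewrite ?normcN ?normc1 ?ni.
have h w : w \in W -> `|Re (w * (a +i* b)%C)| <= Im (w * (a +i* b)%C) ->
   exists2 i, i \in W & A i (a +i* b)%C by move=> wW hw; exists w.
have [b0|b0] := lerP 0 b; have [a0|a0] := lerP 0 a.
- have [ab|/ltW ab] := lerP a b.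
    by apply: (h 1); rewrite ?inE ?eqxx ?orbT// mul1r /= ger0_norm.
  by apply: (h i); rewrite ?inE ?eqxx ?orbT//= !(mul0r, mul1r, add0r, addr0, sub0r) normrN ger0_norm.
- have [ab|/ltW ab] := lerP (- a) b.
    by apply: (h 1); rewrite ?inE ?eqxx ?orbT// mul1r /= ltr0_norm.
  by apply: (h (- i)); rewrite ?inE ?eqxx ?orbT//= !(mul0r, mul1r, mulN1r, mulNr, oppr0, add0r, addr0, sub0r, opprK) ger0_norm.
- have [ab|/ltW ab] := lerP a (- b).
    by apply: (h (-1)); rewrite ?inE ?eqxx ?orbT// mulN1r /= normrN ger0_norm.
  by apply: (h i); rewrite ?inE ?eqxx ?orbT//= !(mul0r, mul1r, add0r, addr0, sub0r) normrN ltr0_norm.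
- have [ab|/ltW ab] := lerP (- a) (- b).
    by apply: (h (-1)); rewrite ?inE ?eqxx ?orbT// mulN1r /= normrN ltr0_norm.
  by apply: (h (- i)); rewrite ?inE ?eqxx ?orbT//= !(mul0r, mul1r, mulN1r, mulNr, oppr0, add0r, addr0, sub0r, opprK) ltr0_norm.
Qed.

(** ** Convergence and compactness in terms of the real-valued modulus *)

Lemma cvg_normcP (T : Type) (F : set_system T) {FF : Filter F} (f : T -> C) (l : C) :
  f x @[x --> F] --> l <->
  forall e : R, 0 < e -> \forall x \near F, normc (f x - l) <= e.
Proof.
split=> [/cvgrPdistC_le h e e0|h].
  have e0' : 0 < e%:C%C by rewrite ltcR.
  by apply: filterS (h _ e0') => x; rewrite norm_normc lecR.
apply/cvgrPdistC_le => e e0; have [a ae] : exists a : R, e = a%:C%C.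
  by apply/complex_realP; apply: gtr0_real.
move: e0; rewrite ae ltcR => e0; apply: filterS (h _ e0) => x.
by rewrite norm_normc lecR.
Qed.

Lemma nbhs_normcP (z : C) (A : set C) :
  nbhs z A <-> exists2 e : R, 0 < e & forall x, normc (x - z) < e -> A x.
Proof.
split=> [/nbhs_ballP[e /= e0 eA]|[e e0 eA]].
  have [a ae] : exists a : R, e = a%:C%C by apply/complex_realP; apply: gtr0_real.
  move: e0 eA; rewrite ae ltcR => e0 eA; exists a => // x xz; apply: eA.
  by rewrite -ball_normE /= norm_normc ltcR normcB.
apply/nbhs_ballP; exists e%:C%C; first by rewrite /= ltcR.
by move=> x; rewrite -ball_normE /= norm_normc ltcR normcB => /eA.
Qed.

Lemma continuous_normc : continuous (@normc R : C -> R).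
Proof.
move=> z; apply: (iffRL (@cvgrPdistC_le _ _ _ (nbhs z) _ (@normc R) _)) => e e0.
apply/nbhs_normcP; exists e => // x xz.
exact: le_trans (ler_dist_normc _ _) (ltW xz).
Qed.

Lemma compact_disc (B : R) : compact [set z : C | normc z <= B].
Proof.
pose f (p : R * R) : C := (p.1 +i* p.2)%C.
have fc : continuous f.
  move=> p; apply/cvg_normcP => e e0.
  have e2 : 0 < e / 2 by rewrite divr_gt0.
  have h1 : \forall q \near p, `|q.1 - p.1| <= e / 2.
    by have /cvgrPdistC_le := @cvg_fst _ _ (nbhs p.1) (nbhs p.2) (nbhs_filter _); apply.
  have h2 : \forall q \near p, `|q.2 - p.2| <= e / 2.
    by have /cvgrPdistC_le := @cvg_snd _ _ (nbhs p.1) (nbhs p.2) (nbhs_filter _); apply.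
  apply: filterS2 h1 h2 => q q1 q2.
  by rewrite (le_trans (normc_le_ReIm _))//= [e]splitr lerD.
apply: (@subclosed_compact _ _ (f @` (`[- B, B] `*` `[- B, B]))).
- apply: (@preimage_closed _ _ (@normc R : C -> R) [set x | x <= B]); last exact: closed_le.
  by move=> z _; apply: continuous_normc.
- apply: continuous_compact; first exact: continuous_subspaceT.
  by apply: compact_setX; apply: segment_compact.
- move=> z zB; exists (Re z, Im z); last by case: z {zB}.
  have := le_trans (Re_le_normc z) zB; have := le_trans (Im_le_normc z) zB.
  by rewrite !ler_norml /= !in_itv /=.
Qed.

Lemma compact_le_normc (K : set C) (B : R) : closed K ->
  (forall z, K z -> normc z <= B) -> compact K.
Proof. by move=> cK KB; apply: subclosed_compact cK (@compact_disc B) _. Qed.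

(** A property that holds near every point of a compact set, at all small
    scales, holds at a common scale. *)
Lemma compact_uniform_scale (K : set C) (Q : R -> C -> Prop) : compact K ->
  (forall z, K z -> exists2 d : R, 0 < d &
     forall e w, 0 < e -> e < d -> normc (w - z) < d -> Q e w) ->
  exists2 d : R, 0 < d & forall z, K z -> Q d z.
Proof.
move=> /compact_near_coveringP cK h.
have : \forall e \near (0 : R)^'+, K `<=` Q e.
  apply: cK => z /h[d d0 dQ].
  exists ([set w | normc (w - z) < d], [set e | 0 < e /\ e < d]).
    split; first by apply/nbhs_normcP; exists d.
    by near=> e; split; near: e; [exact: nbhs_right_gt|exact: nbhs_right_lt].
  by move=> [w e] /= [wz [e0 ed]]; apply: dQ.
move=> H; have : \forall e \near (0 : R)^'+, 0 < e /\ K `<=` Q e.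
  by apply: filterI => //; exact: nbhs_right_gt.
by move=> /filter_ex[e [e0 eK]]; exists e.
Unshelve. all: by end_near.
Qed.

End ComplexPlane.

Section StrictDerivative.
Variable R : realType.
Local Notation C := R[i].
Implicit Types (f g : C -> C) (z l : C).

Definition offdiag (z : C) : set_system (C * C) :=
  within [set p | p.1 != p.2] (nbhs (z, z)).

(** The derivative as a limit of difference quotients at two moving points.
    It holds for every complex differentiable function met here, and a pointwise
    assumption already gives uniform estimates on compact sets, where the usual
    derivative would require Cauchy's integral formula. *)
Definition strict_deriv f z l :=
  (f p.1 - f p.2) / (p.1 - p.2) @[p --> offdiag z] --> l.

Global Instance offdiag_filter z : ProperFilter (offdiag z).
Proof.
apply: within_nbhs_proper => A /= [[U V] /= [/nbhs_normcP[e e0 eU] /nbhs_normcP[d d0 dV]] UVA].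
exists (z + (e / 2)%:C%C, z); split => /=.
  by rewrite -subr_eq0 addrC addKr; apply/eqP => -[]; lra.
apply: UVA; split => /=; last by apply: dV; rewrite subrr normc0.
by apply: eU; rewrite addrC addKr normc_real ger0_norm; lra.
Qed.

Lemma offdiag_normcP z (A : set (C * C)) :
  offdiag z A <-> exists2 d : R, 0 < d & forall x y, normc (x - z) < d ->
    normc (y - z) < d -> x != y -> A (x, y).
Proof.
split=> [[[U V] /= [/nbhs_normcP[e e0 eU] /nbhs_normcP[d d0 dV]] UVA]|[d d0 dA]].
  exists (Num.min e d); first by rewrite lt_min e0.
  move=> x y; rewrite !lt_min => /andP[xe _] /andP[_ yd] xy.
  by apply: (UVA (x, y)) => //; split; [apply: eU|apply: dV].
exists ([set x | normc (x - z) < d], [set x | normc (x - z) < d]).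
  by split; apply/nbhs_normcP; exists d.
by move=> [x y] [/= xd yd] xy; apply: dA.
Qed.

Lemma offdiag_near1 z (A : set C) : nbhs z A -> \forall p \near offdiag z, A p.1.
Proof.
by move=> /nbhs_normcP[e e0 eA]; apply/offdiag_normcP; exists e => // x y /eA.
Qed.

Lemma offdiag_near2 z (A : set C) : nbhs z A -> \forall p \near offdiag z, A p.2.
Proof.
by move=> /nbhs_normcP[e e0 eA]; apply/offdiag_normcP; exists e => // x y _ /eA.
Qed.

Lemma offdiag_neq z : \forall p \near offdiag z, p.1 - p.2 != 0.
Proof.
by apply/offdiag_normcP; exists 1 => // x y _ _; rewrite subr_eq0.
Qed.

Lemma cvg_offdiag1 f z : {for z, continuous f} -> f p.1 @[p --> offdiag z] --> f z.
Proof. by move=> fz A /fz /offdiag_near1. Qed.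

Lemma cvg_offdiag2 f z : {for z, continuous f} -> f p.2 @[p --> offdiag z] --> f z.
Proof. by move=> fz A /fz /offdiag_near2. Qed.

Lemma near_eq_cvgC (T : Type) (F : set_system T) {FF : Filter F} (f g : T -> C) l :
  (\forall x \near F, f x = g x) -> f x @[x --> F] --> l -> g x @[x --> F] --> l.
Proof. by move=> fg; apply: cvg_trans; apply: near_eq_cvg. Qed.

Lemma strict_derivP f z l : strict_deriv f z l <->
  forall e : R, 0 < e -> exists2 d : R, 0 < d & forall x y,
    normc (x - z) < d -> normc (y - z) < d ->
    normc (f x - f y - l * (x - y)) <= e * normc (x - y).
Proof.
split=> [/cvg_normcP h e e0|h].
  have /offdiag_normcP[d d0 dh] := h _ e0; exists d => // x y xd yd.
  have [->|xy] := eqVneq x y; first by rewrite !subrr mulr0 subr0 normc0 mulr0.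
  have xy0 : x - y != 0 by rewrite subr_eq0.
  have := dh _ _ xd yd xy; rewrite /= -(ler_pM2r (_ : 0 < normc (x - y))) ?normc_gt0//.
  by rewrite -normcM mulrBl divfK.
apply/cvg_normcP => e e0; have [d d0 dh] := h _ e0; apply/offdiag_normcP.
exists d => // x y xd yd xy; have xy0 : x - y != 0 by rewrite subr_eq0.
rewrite /= -(ler_pM2r (_ : 0 < normc (x - y))) ?normc_gt0//.
by rewrite -normcM mulrBl divfK//; apply: dh.
Qed.

Lemma continuous_normcP f z : {for z, continuous f} <->
  forall e : R, 0 < e -> exists2 d : R, 0 < d & forall x,
    normc (x - z) < d -> normc (f x - f z) <= e.
Proof.
have E := @cvg_normcP R C (nbhs z) _ f (f z).
split=> [/E h e /h /nbhs_normcP //|h]; apply/E => e /h [d d0 dh].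
by apply/nbhs_normcP; exists d.
Qed.

Lemma strict_deriv_continuous f z l : strict_deriv f z l -> {for z, continuous f}.
Proof.
move=> /strict_derivP /(_ 1 ltr01)[d d0 fl]; apply/continuous_normcP => e e0.
pose k : R := 1 + normc l; have k0 : 0 < k by rewrite ltr_wpDr ?normc_ge0.
exists (Num.min d (e / k)); first by rewrite lt_min d0 divr_gt0.
move=> x; rewrite lt_min => /andP[xd]; rewrite ltr_pdivlMr// => xe.
have := fl x z xd; rewrite subrr normc0 mul1r => /(_ d0) h.
rewrite -[f x - f z](subrK (l * (x - z))); apply: le_trans (le_normcD _ _) _.
rewrite normcM; apply: le_trans (ltW xe).
have -> : normc (x - z) * k = normc (x - z) + normc l * normc (x - z) by rewrite /k; ring.
by rewrite lerD2r.
Qed.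

Lemma strict_deriv_derive1 f z l : strict_deriv f z l -> (f^`())%classic z = l.
Proof.
move=> fl; rewrite derive1E /derive; apply/cvg_lim; first exact: norm_hausdorff.
apply/cvg_normcP => e e0; have /strict_derivP /(_ e e0) [d d0 dh] := fl.
exists d%:C%C; first by rewrite /= ltcR.
move=> h /=; rewrite sub0r normrN norm_normc ltcR => hd h0.
have := dh (h + z) z; rewrite addrK subrr normc0 => /(_ hd d0).
rewrite -(ler_pM2l (_ : 0 < (normc h)^-1)) ?invr_gt0 ?normc_gt0//.
rewrite -normcV -normcM mulrBr [X in _ - X]mulrC mulfK// mulrCA -normcM mulVf//.
by rewrite normc1 mulr1 /GRing.scale /= mulr1.
Qed.

Lemma strict_deriv_cst (c : C) z : strict_deriv (fun=> c) z 0.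
Proof.
apply/strict_derivP => e e0; exists 1 => // x y _ _.
by rewrite subrr mul0r subr0 normc0 mulr_ge0 ?normc_ge0 ?ltW.
Qed.

Lemma strict_deriv_id z : strict_deriv id z 1.
Proof.
apply/strict_derivP => e e0; exists 1 => // x y _ _.
by rewrite mul1r subrr normc0 mulr_ge0 ?normc_ge0 ?ltW.
Qed.

Lemma strict_derivB f g z l m : strict_deriv f z l -> strict_deriv g z m ->
  strict_deriv (fun x => f x - g x) z (l - m).
Proof.
move=> fl gm; apply: near_eq_cvgC (cvgB fl gm).
by apply: nearW => p /=; rewrite -mulrBl; congr (_ / _); ring.
Qed.

Lemma strict_derivM f g z l m : strict_deriv f z l -> strict_deriv g z m ->
  strict_deriv (fun x => f x * g x) z (l * g z + f z * m).
Proof.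
move=> fl gm.
have gc := cvg_offdiag1 (strict_deriv_continuous gm).
have fc := cvg_offdiag2 (strict_deriv_continuous fl).
apply: near_eq_cvgC (cvgD (cvgM fl gc) (cvgM fc gm)).
by apply: nearW => p /=; ring.
Qed.

Lemma strict_derivV f z l : f z != 0 -> strict_deriv f z l ->
  strict_deriv (fun x => (f x)^-1) z (- l / f z ^+ 2).
Proof.
move=> fz fl; have fcz := strict_deriv_continuous fl.
have c1 := cvg_offdiag1 fcz; have c2 := cvg_offdiag2 fcz.
have n0 : \forall x \near z, f x != 0.
  have /continuous_normcP/(_ (normc (f z) / 2)) := fcz.
  rewrite divr_gt0 ?normc_gt0// => /(_ isT) /nbhs_normcP; apply: filterS => x.
  apply: contraTneq => ->; rewrite sub0r normcN -ltNge ltr_pdivrMr// mulr_natr mulr2n.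
  by rewrite ltrDl normc_gt0.
have ff0 : f z * f z != 0 by rewrite mulf_neq0.
apply: near_eq_cvgC (cvgM (cvgN fl) (cvgV ff0 (cvgM c1 c2))) => /=.
apply: filterS3 (offdiag_near1 n0) (offdiag_near2 n0) (offdiag_neq z) => p f1 f2 p12.
have -> : forall h : C * C -> C, (- h) p = - h p by [].
by field; rewrite f1 f2 p12.
Qed.

Lemma strict_derivX f z l n : strict_deriv f z l ->
  strict_deriv (fun x => f x ^+ n) z (f z ^+ n.-1 * l *+ n).
Proof.
move=> fl; elim: n => [|n IH]; first exact: strict_deriv_cst.
rewrite (_ : _ *+ _ = l * f z ^+ n + f z * (f z ^+ n.-1 * l *+ n)).
  have -> : (fun x => f x ^+ n.+1) = (fun x => f x * f x ^+ n).
    by apply/funext => x; rewrite exprS.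
  exact: strict_derivM.
rewrite mulrS [l * _]mulrC; congr (_ + _); case: n {IH} => [|n]; first by rewrite !mulr0n mulr0.
by rewrite mulrnAr mulrA -exprS.
Qed.

(** The quotient (P(a) - P(b)) / (a - b) is itself a polynomial. *)
Lemma poly_divided_difference (P : {poly C}) : exists Q : C -> C -> C,
  [/\ forall a b, P.[a] - P.[b] = Q a b * (a - b),
      forall a, Q a a = P^`().[a]
    & forall T (F : set_system T) (f g : T -> C) a b, Filter F ->
        f x @[x --> F] --> a -> g x @[x --> F] --> b ->
        Q (f x) (g x) @[x --> F] --> Q a b].
Proof.
have hc (P' : {poly C}) T (F : set_system T) (f : T -> C) a : Filter F ->
    f x @[x --> F] --> a -> P'.[f x] @[x --> F] --> P'.[a].
  move=> FF fa; elim/poly_ind: P' => [|p c IH].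
    by rewrite horner0; under eq_fun do rewrite horner0; apply: cvg_cst.
  rewrite hornerMXaddC; under eq_fun do rewrite hornerMXaddC.
  exact: (cvgD (cvgM IH fa) (cvg_cst c)).
elim/poly_ind: P => [|p c [Q [Q1 Q2 Q3]]].
  exists (fun _ _ => 0); split => [a b|a|T F f g a b FF _ _].
  - by rewrite !horner0 mul0r subrr.
  - by rewrite deriv0 horner0.
  - exact: cvg_cst.
exists (fun a b => p.[a] + Q a b * b); split => [a b|a|T F f g a b FF fa gb].
- rewrite !hornerMXaddC mulrDl mulrAC -Q1; ring.
- by rewrite Q2 derivMXaddC hornerD hornerM hornerX.
- exact: (cvgD (hc _ _ _ _ _ _ fa) (cvgM (Q3 _ _ _ _ _ _ FF fa gb) gb)).
Qed.

Lemma strict_deriv_horner (P : {poly C}) z :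
  strict_deriv (horner P) z P^`().[z].
Proof.
have [Q [Q1 Q2 Q3]] := poly_divided_difference P.
have idc : {for z, continuous (@id C)} by exact: cvg_id.
have := Q3 _ _ _ _ _ _ (offdiag_filter z) (cvg_offdiag1 idc) (cvg_offdiag2 idc).
rewrite Q2; apply: near_eq_cvgC; apply: filterS (offdiag_neq z) => p p12.
by rewrite Q1 mulfK.
Qed.

Lemma strict_deriv_poly_comp (P : {poly C}) f z l : strict_deriv f z l ->
  strict_deriv (fun x => P.[f x]) z (P^`().[f z] * l).
Proof.
move=> fl; have [Q [Q1 Q2 Q3]] := poly_divided_difference P.
have fc := strict_deriv_continuous fl.
have := Q3 _ _ _ _ _ _ (offdiag_filter z) (cvg_offdiag1 fc) (cvg_offdiag2 fc).
rewrite Q2 => h; apply: near_eq_cvgC (cvgM h fl).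
by apply: nearW => p /=; rewrite Q1 mulrA.
Qed.

(** A continuous solution f of P(f(x)) = g(x) inherits strict
    differentiability from g, away from the critical points of P. *)
Lemma strict_deriv_implicit (P : {poly C}) f g z m : {for z, continuous f} ->
  (\forall x \near z, P.[f x] = g x) -> P^`().[f z] != 0 ->
  strict_deriv g z m -> strict_deriv f z (m / P^`().[f z]).
Proof.
move=> fc Pf P'0 gm; have [Q [Q1 Q2 Q3]] := poly_divided_difference P.
have := Q3 _ _ _ _ _ _ (offdiag_filter z) (cvg_offdiag1 fc) (cvg_offdiag2 fc).
rewrite Q2 => h.
have Qn0 : \forall p \near offdiag z, Q (f p.1) (f p.2) != 0.
  have /cvg_normcP/(_ (normc P^`().[f z] / 2)) := h.
  rewrite divr_gt0 ?normc_gt0// => /(_ isT); apply: filterS => p.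
  apply: contraTneq => ->; rewrite sub0r normcN -ltNge ltr_pdivrMr// mulr_natr mulr2n.
  by rewrite ltrDl normc_gt0.
apply: near_eq_cvgC (cvgM gm (cvgV P'0 h)).
have Pf2 : \forall p \near offdiag z, P.[f p.1] = g p.1 /\ P.[f p.2] = g p.2.
  by apply: filterS2 (offdiag_near1 Pf) (offdiag_near2 Pf) => p.
apply: filterS3 Pf2 Qn0 (offdiag_neq z) => p /= [<- <-] q0 p12.
by rewrite Q1; field; rewrite q0 p12.
Qed.

(** The derivative at w is close to the derivative at z when w is, because
    both linear approximations apply to one short step from w. *)
Lemma strict_deriv_uniform (K : set C) f (f' : C -> C) : compact K ->
  (forall z, K z -> strict_deriv f z (f' z)) ->
  forall e : R, 0 < e -> exists2 d : R, 0 < d & forall z x y, K z ->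
    normc (x - z) < d -> normc (y - z) < d ->
    normc (f x - f y - f' z * (x - y)) <= e * normc (x - y).
Proof.
move=> cK fK e e0; have e3 : 0 < e / 3 by rewrite divr_gt0.
pose Q (d : R) (z : C) := K z -> forall x y, normc (x - z) < d -> normc (y - z) < d ->
  normc (f x - f y - f' z * (x - y)) <= e * normc (x - y).
have [|d d0 dQ] := @compact_uniform_scale R K Q cK; last first.
  by exists d => // z x y Kz; apply: dQ.
move=> z Kz; have /strict_derivP /(_ _ e3) [d d0 dh] := fK _ Kz.
exists (d / 2) => [|r w r0 rd wz Kw]; first by rewrite divr_gt0.
have inB x : normc (x - w) < d / 2 -> normc (x - z) < d.
  by move=> xw; apply: le_lt_trans (le_normcB_trans _ w _) _; lra.
have ff' : normc (f' w - f' z) <= e / 3 + e / 3.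
  have /strict_derivP /(_ _ e3) [d' d'0 dh'] := fK _ Kw.
  pose t := Num.min (d / 2) d' / 2.
  have t0 : 0 < t by rewrite divr_gt0// lt_min divr_gt0.
  have [td td'] : t < d / 2 /\ t < d'.
    have : Num.min (d / 2) d' <= d / 2 by rewrite ge_min lexx.
    have : Num.min (d / 2) d' <= d' by rewrite ge_min lexx orbT.
    by rewrite /t in t0 *; split; lra.
  pose x := w + t%:C%C.
  have xwE : x - w = t%:C%C by rewrite /x addrC addKr.
  have nt : normc (x - w) = t by rewrite xwE normc_real gtr0_norm.
  have h1 : normc (f x - f w - f' z * (x - w)) <= e / 3 * normc (x - w).
    by apply: dh; apply: inB; rewrite ?nt ?subrr ?normc0// divr_gt0.
  have h2 : normc (f x - f w - f' w * (x - w)) <= e / 3 * normc (x - w).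
    by apply: dh'; rewrite ?nt ?subrr ?normc0.
  rewrite -(ler_pM2r t0) mulrDl -{1}nt -normcM.
  have -> : (f' w - f' z) * (x - w) =
    (f x - f w - f' z * (x - w)) - (f x - f w - f' w * (x - w)) by ring.
  by apply: le_trans (le_normcD _ _) _; rewrite normcN -nt lerD.
move=> x y xw yw.
rewrite (_ : f x - f y - f' w * (x - y) = (f x - f y - f' z * (x - y)) - (f' w - f' z) * (x - y)); last by ring.
apply: le_trans (le_normcD _ _) _; rewrite normcN normcM.
have -> : e * normc (x - y) = e / 3 * normc (x - y) + (e / 3 + e / 3) * normc (x - y) by field.
apply: lerD; last by rewrite ler_wpM2r ?normc_ge0.
by apply: dh; apply: inB; apply: lt_trans rd.
Qed.

End StrictDerivative.

(** * Averages over roots of unity *)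

Section RootsOfUnity.
Variable R : realType.
Local Notation C := R[i].
Local Notation Re := complex.Re.
Local Notation Im := complex.Im.
Implicit Types (z w v : C) (F f : C -> C) (N : nat).

Definition expi (a : R) : C := (cos a +i* sin a)%C.

Lemma expi0 : expi 0 = 1.
Proof. by rewrite /expi cos0 sin0. Qed.

Lemma expiD a b : expi (a + b) = expi a * expi b.
Proof. by rewrite /expi cosD sinD; simpc; rewrite [sin a * _ + _]addrC. Qed.

Lemma normc_expi a : normc (expi a) = 1.
Proof. by rewrite /expi /normc cos2Dsin2 sqrtr1. Qed.

Lemma expi_neq0 a : expi a != 0.
Proof. by rewrite -normc_gt0 normc_expi. Qed.

Lemma expiN a : expi (- a) = (expi a)^-1.
Proof.
by apply: (mulIf (expi_neq0 a)); rewrite mulVf ?expi_neq0// -expiD addNr expi0.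
Qed.

Lemma expiB a b : expi (a - b) = expi a / expi b.
Proof. by rewrite expiD expiN. Qed.

Lemma expiMn a n : expi (a *+ n) = expi a ^+ n.
Proof. by elim: n => [|n IH]; rewrite ?mulr0n ?expi0// mulrS expiD IH exprS. Qed.

Lemma expi_2pi : expi (2 * pi) = 1.
Proof. by rewrite mulr_natl /expi cos2pi sin2pi. Qed.

Lemma expi_neq1 a : 0 < a < 2 * pi -> expi a != 1.
Proof.
move=> /andP[a0 a2]; have s0 : 0 < sin (a / 2).
  by rewrite sin_gt0_pi// divr_gt0//= ltr_pdivrMr// mulrC.
apply/eqP => -[] /eqP + _.
rewrite [X in cos X](_ : a = (a / 2) *+ 2); last by rewrite -[RHS]mulr_natr divfK.
rewrite cos_mulr2n -[cos _ ^+ 2](addrK (sin (a / 2) ^+ 2)) cos2Dsin2.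
rewrite mulrnBl mulr2n -addrA addrAC -subr_eq0.
have s2 : 0 < sin (a / 2) ^+ 2 by rewrite exprn_gt0.
by move=> /eqP E; move: s2; rewrite -mulr_natr in E; lra.
Qed.

Lemma expi_polar z : normc z = 1 -> exists2 a, 0 <= a <= 2 * pi & z = expi a.
Proof.
case: z => x y z1; have := sqr_normc_def (x +i* y)%C; rewrite z1 /= expr1n => E.
have x1 : -1 <= x <= 1.
  by rewrite -ler_norml -(@ler_pXn2r _ 2)// ?nnegrE// expr1n real_normK ?num_real// E lerDl sqr_ge0.
have s : sin (acos x) = `|y|.
  by rewrite sin_acos// -sqrtr_sqr; congr Num.sqrt; rewrite E addrC addKr.
have pi0 := pi_ge0 R; have a0 := acos_ge0 x1; have api := acos_lepi x1.
have [y0|y0] := lerP 0 y.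
  by exists (acos x); [lra|rewrite /expi acosK// s ger0_norm].
exists (2 * pi - acos x); first by lra.
rewrite expiB expi_2pi mul1r -expiN /expi cosN acosK// sinN s ltr0_norm//.
by rewrite opprK.
Qed.

(** At 0, cos and sin have the derivatives 0 and 1. *)
Lemma expi_chord (e : R) : 0 < e -> exists2 d, 0 < d & forall a, `|a| < d ->
  `|normc (expi a - 1) - `|a| | <= e * `|a|.
Proof.
move=> e0; have e2 : 0 < e / 2 by rewrite divr_gt0.
have dd (f : R -> R) l : is_derive (0 : R) 1 f l -> exists2 d, 0 < d &
    forall a, `|a| < d -> `|f a - f 0 - a * l| <= e / 2 * `|a|.
  move=> [fd fl]; have : h^-1 *: (f (h *: 1 + 0) - f 0) @[h --> (0 : R)^'] --> l.
    by rewrite -fl; apply: fd.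
  move=> /cvgrPdistC_le /(_ _ e2) [d /= d0 dh]; exists d => // a ad.
  have [->|a0] := eqVneq a 0; first by rewrite subrr mul0r subr0 normr0 mulr0.
  have := dh a; rewrite /= sub0r normrN => /(_ ad a0).
  rewrite addr0 /GRing.scale /= mulr1 -(ler_pM2r (_ : 0 < `|a|)) ?normr_gt0//.
  by rewrite -normrM mulrBl mulrAC mulVf// mul1r [l * _]mulrC.
have [d1 d10 h1] := dd _ _ (is_derive_cos (0 : R)).
have [d2 d20 h2] := dd _ _ (is_derive_sin (0 : R)).
exists (Num.min d1 d2); first by rewrite lt_min d10.
move=> a; rewrite lt_min => /andP[/h1 + /h2].
rewrite cos0 sin0 oppr0 mulr0 !subr0 addr0 mulr1 => c1 s1.
have na : normc (a *i)%C = `|a| by rewrite /normc expr0n add0r sqrtr_sqr.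
apply: (@le_trans _ _ (normc (expi a - 1 - (a *i)%C))).
  by rewrite -{1}na ler_dist_normc.
apply: le_trans (normc_le_ReIm _) _; rewrite !ReB !ImB /= !subr0.
lra.
Qed.

Definition omega N : C := expi (2 * pi / N%:R).

Lemma omega_prim N : (0 < N)%N -> N.-primitive_root (omega N).
Proof.
move=> N0; have N0' : 0 < N%:R :> R by rewrite ltr0n.
apply/andP; split => //; apply/forallP => i; apply/eqP; rewrite unity_rootE.
rewrite -expiMn [X in expi X](_ : _ = 2 * pi * (i.+1%:R / N%:R)); last first.
  by rewrite -[LHS]mulr_natr; ring.
apply/idP/idP => [|/eqP ->]; last first.
  rewrite divff ?(gt_eqF N0')//.
  by rewrite mulr1 expi_2pi.
apply: contraTT => iN; apply: expi_neq1; have pi0 := pi_gt0 R.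
have iN' : (i.+1 < N)%N by rewrite ltn_neqAle iN /=; apply: ltn_ord.
have p2 : 0 < 2 * pi :> R by rewrite mulr_gt0.
apply/andP; split; first by rewrite mulr_gt0// divr_gt0.
by rewrite gtr_pMr// ltr_pdivrMr// mul1r ltr_nat.
Qed.

Lemma omega_small_step (d : R) : 0 < d ->
  exists N0, forall N, (N0 < N)%N -> 2 * pi / N%:R < d.
Proof.
move=> d0; have p0 : 0 <= 2 * pi / d :> R by rewrite divr_ge0 ?mulr_ge0 ?pi_ge0// ltW.
have := archi_boundP p0; move: (Num.bound _) => N0 h; exists N0 => N N0N.
have NN : N0%:R < N%:R :> R by rewrite ltr_nat.
have := lt_trans h NN; rewrite ltr_pdivrMr// => h'.
by rewrite ltr_pdivrMr ?ltr0n ?(leq_ltn_trans _ N0N)// [d * _]mulrC.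
Qed.

Lemma omega_near1 (d : R) : 0 < d ->
  exists N0, forall N, (N0 < N)%N -> normc (omega N - 1) < d.
Proof.
move=> d0; have [d1 d10 h] := expi_chord (@ltr01 R).
have [|N0 hN] := @omega_small_step (Num.min d1 (d / 2)).
  by rewrite lt_min d10 divr_gt0.
exists N0 => N /hN; rewrite lt_min => /andP[t1 t2].
have t0 : 0 <= 2 * pi / N%:R :> R by rewrite divr_ge0 ?mulr_ge0 ?pi_ge0.
have := h (2 * pi / N%:R); rewrite ger0_norm// => /(_ t1); rewrite -/(omega N) mul1r.
rewrite ler_norml; lra.
Qed.

Lemma normc_prim_root v N : N.-primitive_root v -> normc v = 1.
Proof.
move=> vN; have N0 := prim_order_gt0 vN.
apply/eqP; rewrite -(@pexpr_eq1 _ _ N)// ?normc_ge0//.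
by rewrite -normcX (prim_expr_order vN) normc1.
Qed.

Lemma prim_root_neq0 v N : N.-primitive_root v -> v != 0.
Proof. by move=> /normc_prim_root v1; rewrite -normc_gt0 v1. Qed.

Lemma prim_rootV v N : N.-primitive_root v -> N.-primitive_root v^-1.
Proof.
move=> vN; have N0 := prim_order_gt0 vN; apply/andP; split => //; apply/forallP => i.
have := vN => /andP[_ /forallP /(_ i)]; rewrite !unity_rootE exprVn => /eqP <-.
by apply/eqP; rewrite -[X in _ == X]invr1 (inj_eq invr_inj).
Qed.

Lemma sum_prim_root v N k : N.-primitive_root v -> ~~ (N %| k)%N ->
  \sum_(j < N) (v ^+ k) ^+ j = 0.
Proof.
move=> vN Nk; have vk : v ^+ k - 1 != 0 by rewrite subr_eq0 -(prim_order_dvd vN).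
apply: (mulfI vk); rewrite mulr0 -subrX1 -exprM mulnC exprM.
by rewrite (prim_expr_order vN) expr1n subrr.
Qed.

Lemma conjc_unit v : normc v = 1 -> (v^* )%C = v^-1.
Proof.
move=> v1; rewrite invc_norm norm_normc v1.
by rewrite rmorph1 expr1n invr1 mul1r.
Qed.

Lemma sqr_normcE z : ((normc z ^+ 2)%:C)%C = z * (z^* )%C.
Proof. by rewrite rmorphXn /= -norm_normc sqr_normc. Qed.

(** The vectors k |-> v ^ (j * k), for j < N, are pairwise orthogonal. *)
Lemma parseval_dft v N (x : nat -> C) : N.-primitive_root v ->
  \sum_(k < N) normc ((\sum_(j < N) x j * v ^+ (j * k)) / N%:R) ^+ 2 =
  (\sum_(j < N) normc (x j) ^+ 2) / N%:R.
Proof.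
move=> vN; have N0 := prim_order_gt0 vN; have v1 := normc_prim_root vN.
have v0 := prim_root_neq0 vN.
have NC : N%:R != 0 :> C by rewrite pnatr_eq0 -lt0n.
have NR : N%:R != 0 :> R by rewrite pnatr_eq0 -lt0n.
have nN : normc (N%:R : C) = N%:R by rewrite -(rmorph_nat (real_complex R)) normc_real normr_nat.
under eq_bigr do rewrite normcM normcV nN exprMn exprVn.
rewrite -mulr_suml; apply: (mulIf (expf_neq0 2 NR)); rewrite divfK ?expf_neq0//.
rewrite expr2 mulrA divfK//.
apply: (@complexI R); rewrite rmorph_sum rmorphM rmorph_sum rmorph_nat /=.
have E (k : 'I_N) : ((normc (\sum_(j < N) x j * v ^+ (j * k)) ^+ 2)%:C)%C =
    \sum_(j < N) \sum_(l < N) x j * (x l)^*%C * (v ^+ j / v ^+ l) ^+ k.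
  rewrite sqr_normcE rmorph_sum big_distrlr; apply: eq_bigr => j _.
  apply: eq_bigr => l _; rewrite rmorphM rmorphXn /= (conjc_unit v1).
  by rewrite mulrACA !exprM exprMn !exprVn.
rewrite (eq_bigr _ (fun k _ => E k)).
rewrite exchange_big mulr_suml; apply: eq_bigr => j _.
rewrite exchange_big (bigD1 j)//= [X in _ + X]big1 ?addr0 => [|l lj].
  rewrite -mulr_sumr; congr (_ * _); first by rewrite -sqr_normcE.
  under eq_bigr do rewrite divff ?expf_neq0// expr1n.
  by rewrite sumr_const card_ord.
rewrite -mulr_sumr; apply/eqP; rewrite mulf_eq0; apply/orP; right.
have -> : v ^+ j / v ^+ l = v ^+ (j + (N - l)).
  have lN := ltnW (ltn_ord l); rewrite exprD expfB_cond ?(negPf v0)//.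
  by rewrite (prim_expr_order vN) mul1r.
rewrite (sum_prim_root vN)//; apply: contra lj => E0; apply/eqP/val_inj => /=.
have : (j + (N - l) == l + (N - l) %[mod N])%N.
  by rewrite [in X in _ == X]subnKC ?modnn ?(ltnW (ltn_ord l)).
by rewrite eqn_modDr !modn_small// => /eqP ->.
Qed.

End RootsOfUnity.

Arguments expi : simpl never.

Section CircleMeans.
Variable R : realType.
Local Notation C := R[i].
Implicit Types (z w : C) (F G : C -> C) (N : nat).

(** The mean of F over the N-th roots of unity, turned and scaled by z. As N
    grows, it stands for the mean of F over the circle through z. *)
Definition mean N F z : C := (\sum_(j < N) F (z * omega R N ^+ j)) / N%:R.

Lemma normc_nat n : normc (n%:R : C) = n%:R.
Proof. by rewrite -(rmorph_nat (real_complex R)) normc_real normr_nat. Qed.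

Lemma normc_omega N j : normc (omega R N ^+ j) = 1.
Proof. by rewrite normcX normc_expi expr1n. Qed.

Lemma normc_node N z j : normc (z * omega R N ^+ j) = normc z.
Proof. by rewrite normcM normc_omega mulr1. Qed.

Lemma eq_mean N F G z : (forall j, F (z * omega R N ^+ j) = G (z * omega R N ^+ j)) ->
  mean N F z = mean N G z.
Proof. by move=> FG; rewrite /mean; congr (_ / _); apply: eq_bigr. Qed.

Lemma meanB N F G z : mean N (fun w => F w - G w) z = mean N F z - mean N G z.
Proof. by rewrite /mean sumrB mulrBl. Qed.

Lemma meanD N F G z : mean N (fun w => F w + G w) z = mean N F z + mean N G z.
Proof. by rewrite /mean big_split mulrDl. Qed.

Lemma meanZ N (a : C) F z : mean N (fun w => a * F w) z = a * mean N F z.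
Proof. by rewrite /mean -mulr_sumr mulrA. Qed.

Lemma mean_sum N (I : Type) (r : seq I) (F : I -> C -> C) z :
  mean N (fun w => \sum_(i <- r) F i w) z = \sum_(i <- r) mean N (F i) z.
Proof. by rewrite /mean exchange_big mulr_suml. Qed.

Lemma mean_le N F z (B : R) : 0 <= B ->
  (forall j, normc (F (z * omega R N ^+ j)) <= B) -> normc (mean N F z) <= B.
Proof.
move=> B0 FB; case: N FB => [|N] FB; first by rewrite /mean big_ord0 mul0r normc0.
rewrite normcM normcV normc_nat ler_pdivrMr ?ltr0n//.
apply: le_trans (ler_normc_sum _ _ _) _.
apply: (@le_trans _ _ (\sum_(j < N.+1) B)); first by apply: ler_sum => j _; apply: FB.
by rewrite sumr_const card_ord mulr_natr.
Qed.

Lemma mean_cst N (a : C) z : (0 < N)%N -> mean N (fun=> a) z = a.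
Proof.
move=> N0; rewrite /mean sumr_const card_ord -[a *+ N]mulr_natr mulfK//.
by rewrite pnatr_eq0 -lt0n.
Qed.

Lemma mean_exprz N z (p : int) : z != 0 -> (`|p| < N)%N ->
  mean N (fun w => w ^ p) z = (p == 0)%:R.
Proof.
move=> z0 pN; have N0 : (0 < N)%N by apply: leq_ltn_trans pN.
have [->|p0] := eqVneq p 0; first exact: mean_cst.
rewrite /mean; apply/eqP; rewrite mulf_eq0; apply/orP; left; apply/eqP.
have wN := omega_prim R N0.
have nd k : (0 < k)%N -> (k < N)%N -> ~~ (N %| k)%N.
  by move=> k0 kN; rewrite gtnNdvd.
case: p p0 pN => k p0 pN.
  under eq_bigr => j _ do rewrite -exprnP exprMn -exprM mulnC exprM.
  by rewrite -mulr_sumr (sum_prim_root wN) ?mulr0 ?nd// lt0n.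
under eq_bigr => j _ do rewrite NegzE -exprnN exprMn invfM -exprM mulnC exprM -!exprVn.
by rewrite -mulr_sumr (sum_prim_root (prim_rootV wN)) ?mulr0 ?nd.
Qed.

(** Chain the small-scale bound along equal steps shorter than d. *)
Lemma small_scale_lipschitz (g : R -> C) (a b c d : R) : a <= b -> 0 < d ->
  (forall x y, a <= x <= b -> a <= y <= b -> `|x - y| < d ->
    normc (g x - g y) <= c * `|x - y|) ->
  normc (g b - g a) <= c * (b - a).
Proof.
move=> ab d0 gc; have ba0 : 0 <= b - a by rewrite subr_ge0.
have := archi_boundP (divr_ge0 ba0 (ltW d0)); set N := Num.bound _ => Nd.
have N0 : 0 < N%:R :> R by apply: le_lt_trans Nd; rewrite divr_ge0// ltW.
pose x k := a + (b - a) * (k%:R / N%:R).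
have xab k : (k <= N)%N -> a <= x k <= b.
  move=> kN; rewrite /x lerDl mulr_ge0 ?divr_ge0//= -lerBrDl ler_piMr//.
  by rewrite ler_pdivrMr// mul1r ler_nat.
have xS k : x k.+1 - x k = (b - a) / N%:R by rewrite /x -natr1; ring.
have -> : g b - g a = \sum_(0 <= k < N) (g (x k.+1) - g (x k)).
  rewrite telescope_sumr// /x mul0r mulr0 addr0 divff ?gt_eqF// mulr1.
  by rewrite [a + _]addrC subrK.
rewrite big_mkord; apply: le_trans (ler_normc_sum _ _ _) _.
have step (k : 'I_N) : normc (g (x k.+1) - g (x k)) <= c * ((b - a) / N%:R).
  have h : `|x k.+1 - x k| = (b - a) / N%:R by rewrite xS ger0_norm// divr_ge0// ltW.
  rewrite -h; apply: gc; rewrite ?xab// 1?ltnW// h.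
  by rewrite ltr_pdivrMr// mulrC -ltr_pdivrMr.
apply: (@le_trans _ _ (\sum_(k < N) (c * ((b - a) / N%:R)))); first exact: ler_sum.
by rewrite sumr_const card_ord -[_ *+ N]mulr_natr mulrA divfK ?gt_eqF.
Qed.

Section Annulus.
Variables (F F' : C -> C) (r1 r2 : R).
Hypothesis r10 : 0 < r1.
Hypothesis Fderiv : forall z, r1 <= normc z <= r2 -> strict_deriv F z (F' z).

Lemma annulus_compact : compact [set z : C | r1 <= normc z <= r2].
Proof.
apply: (@compact_le_normc _ _ r2) => [|z /= /andP[]//].
rewrite (_ : [set z | _] = (@normc R : C -> R) @^-1` [set x | r1 <= x] `&`
  (@normc R : C -> R) @^-1` [set x | x <= r2]); last first.
  by apply/seteqP; split => z /= => [/andP[]|[-> ->]].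
apply: closedI; apply: preimage_closed; try (by move=> z _; apply: continuous_normc).
  exact: closed_ge.
exact: closed_le.
Qed.

(** Up to a small relative error, the increment of F between two consecutive
    nodes w is (omega - 1) w F'(w), and these increments telescope around the
    circle. *)
Lemma mean_deriv_eq0 (e : R) : 0 < e -> exists N0, forall N z, (N0 < N)%N ->
  r1 <= normc z <= r2 -> normc (mean N (fun w => F' w * w) z) <= e.
Proof.
move=> e0; have [r20|r20] := lerP r2 0.
  exists 0%N => N z _ /andP[h1 h2].
  by have := lt_le_trans r10 (le_trans h1 h2); rewrite ltNge r20.
have [d d0 h] := strict_deriv_uniform annulus_compact Fderiv (divr_gt0 e0 r20).
have [N0 hN] := omega_near1 (divr_gt0 d0 r20).
exists N0.+1 => N z NN zr; have w1 := hN _ (ltnW NN).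
set w := omega R N in w1 *; have wN : N.-primitive_root w.
  by apply: omega_prim; apply: leq_ltn_trans NN.
have N0' : 0 < N%:R :> R by rewrite ltr0n (leq_ltn_trans _ NN).
have w0 : 0 < normc (w - 1).
  rewrite normc_gt0 subr_eq0 -[w]expr1 -(prim_order_dvd wN) dvdn1 neq_ltn.
  by rewrite (leq_ltn_trans _ NN) ?orbT.
pose u j := F (z * w ^+ j).
have zw j : z * w ^+ j.+1 - z * w ^+ j = z * w ^+ j * (w - 1) by rewrite exprSr; ring.
have step (j : 'I_N) : normc (F' (z * w ^+ j) * (z * w ^+ j) * (w - 1) - (u j.+1 - u j))
    <= e * normc (w - 1).
  have zle : normc (z * w ^+ j * (w - 1)) <= r2 * normc (w - 1).
    by rewrite normcM normc_node ler_wpM2r ?normc_ge0//; case/andP: zr.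
  have := h (z * w ^+ j) (z * w ^+ j.+1) (z * w ^+ j); rewrite subrr normc0 zw /=.
  rewrite normc_node => /(_ zr _ d0); rewrite (le_lt_trans zle); last first.
    by rewrite mulrC -ltr_pdivlMr.
  move=> /(_ isT) h1; rewrite normcB mulrA in h1 *; apply: le_trans h1 _.
  rewrite [leRHS](_ : _ = e / r2 * (r2 * normc (w - 1))); last first.
    by rewrite mulrA divfK ?gt_eqF.
  by rewrite ler_wpM2l// divr_ge0// ltW.
rewrite /mean -/w normcM normcV normc_nat ler_pdivrMr// -(ler_pM2r w0) -normcM mulr_suml.
have tel : \sum_(j < N) (u j.+1 - u j) = 0.
  rewrite -(big_mkord xpredT (fun j => u j.+1 - u j)) telescope_sumr//.
  by rewrite /u (prim_expr_order wN) expr0 subrr.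
rewrite -[X in normc X]subr0 -[X in _ - X]tel -sumrB.
apply: le_trans (ler_normc_sum _ _ _) _.
apply: (@le_trans _ _ (\sum_(j < N) (e * normc (w - 1)))); first exact: ler_sum.
by rewrite sumr_const card_ord -[_ *+ N]mulr_natr mulrAC.
Qed.

(** Along a ray, the mean of F has as derivative the mean of w F'(w) divided by
    the radius, which mean_deriv_eq0 makes small. This replaces Cauchy's theorem
    on an annulus. *)
Lemma mean_radial (e : R) : 0 < e -> exists N0, forall N z a b, (N0 < N)%N ->
  normc z = 1 -> r1 <= a -> a <= b -> b <= r2 ->
  normc (mean N F (b%:C%C * z) - mean N F (a%:C%C * z)) <= e.
Proof.
move=> e0; have [r12|r21] := lerP r1 r2; last first.
  exists 0%N => N z a b _ _ ra ab br.
  by have := le_trans ra (le_trans ab br); rewrite leNgt r21.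
pose eta := e / (r2 - r1 + 1).
have r0 : 0 < r2 - r1 + 1 by lra.
have eta0 : 0 < eta by rewrite divr_gt0.
have e20 : 0 < eta / 2 by rewrite divr_gt0.
have [d d0 h] := strict_deriv_uniform annulus_compact Fderiv e20.
have [N0 hN] := mean_deriv_eq0 (mulr_gt0 e20 r10).
exists N0 => N z a b NN z1 ra ab br; have r1_gt0 : 0 < r1 := r10.
have N0' : (0 < N)%N by apply: leq_ltn_trans NN.
have -> : e = eta * (r2 - r1 + 1) by rewrite divfK// gt_eqF.
apply: (@le_trans _ _ (eta * (b - a))); last by rewrite ler_wpM2l ?ltW//; lra.
pose g x := mean N F (x%:C%C * z); apply: (@small_scale_lipschitz g _ _ _ d) => //.
move=> x y xab yab xy.
have y0 : 0 < y by case/andP: yab; lra.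
have nC x' : a <= x' <= b -> normc (x'%:C%C * z) = x'.
  by case/andP=> ? ?; rewrite normcM normc_real z1 mulr1 ger0_norm//; lra.
pose D w := F' w * (w / y%:C%C).
have -> : g x - g y = mean N (fun w => F (x%:C%C / y%:C%C * w) - F w - D w * (x%:C%C - y%:C%C)) (y%:C%C * z)
   + mean N (fun w => F' w * w) (y%:C%C * z) * ((x%:C%C - y%:C%C) / y%:C%C).
  have yC : y%:C%C != 0 :> C by rewrite -normc_gt0 normc_real normr_gt0 gt_eqF.
  rewrite [mean N (fun w => _ - _ * _) _]meanB meanB.
  have -> : mean N (fun w => D w * (x%:C%C - y%:C%C)) (y%:C%C * z) =
     mean N (fun w => ((x%:C%C - y%:C%C) / y%:C%C) * (F' w * w)) (y%:C%C * z).
    by apply: eq_mean => j; rewrite /D; ring.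
  rewrite meanZ [_ * (_ / _)]mulrC subrK; congr (_ - _).
  by rewrite /g /mean; congr (_ / _); apply: eq_bigr => j _; rewrite !mulrA divfK.
apply: le_trans (le_normcD _ _) _.
have -> : eta * `|x - y| = eta / 2 * `|x - y| + eta / 2 * `|x - y| by field.
apply: lerD.
  apply: mean_le => [|j]; first by rewrite mulr_ge0// ltW.
  set w := y%:C%C * z * _; have nw : normc w = y by rewrite /w normc_node nC.
  have yC : y%:C%C != 0 :> C by rewrite -normc_gt0 normc_real normr_gt0 gt_eqF.
  have Ew : x%:C%C / y%:C%C * w - w = w / y%:C%C * (x%:C%C - y%:C%C) by field.
  have Hn : normc (w / y%:C%C * (x%:C%C - y%:C%C)) = `|x - y|.
    by rewrite normcM -rmorphB normc_real normcM normcV nw normc_real gtr0_norm// divff ?mul1r ?gt_eqF.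
  have := h w (x%:C%C / y%:C%C * w) w; rewrite subrr normc0 Ew Hn /= nw => /(_ _ xy d0).
  rewrite /D -[in X in _ -> X](mulrA (F' w)).
  by apply; case/andP: yab => ? ?; apply/andP; split; lra.
have yE : normc ((x%:C%C - y%:C%C) / y%:C%C : C) = `|x - y| / y.
  by rewrite normcM normcV -rmorphB !normc_real (gtr0_norm y0).
rewrite (normcM (mean _ _ _)) yE.
apply: (@le_trans _ _ (eta / 2 * r1 * (`|x - y| / y))).
  rewrite ler_wpM2r ?divr_ge0 ?(ltW y0)//; apply: hN => //; rewrite nC//.
  by case/andP: yab => ? ?; apply/andP; split; lra.
rewrite -(mulrA (eta / 2)) ler_wpM2l ?(ltW e20)// mulrA ler_pdivrMr// mulrC.
by rewrite ler_wpM2l//; case/andP: yab; lra.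
Qed.

End Annulus.
End CircleMeans.

(** * Laurent expansion in the exterior of a disc *)

Section Laurent.
Variable R : realType.
Local Notation C := R[i].
Implicit Types (z w : C) (N K : nat).

Lemma bounded_on_compact (K : set C) (f : C -> C) : compact K ->
  (forall z, K z -> {for z, continuous f}) ->
  exists2 B : R, 0 < B & forall z, K z -> normc (f z) <= B.
Proof.
move=> cK fK; have [K0|K0] := pselect (K !=set0); last first.
  by exists 1 => // z Kz; case: K0; exists z.
have fc : {within K, continuous (@normc R \o f : C -> R)}.
  apply: continuous_in_subspaceT => z /set_mem Kz.
  by apply: continuous_comp; [apply: fK|apply: continuous_normc].
have [w _ wmax] := compact_EVT_max K0 cK fc.
exists (normc (f w) + 1); first by rewrite ltr_wpDl ?normc_ge0.
by move=> z Kz; rewrite (le_trans (wmax _ (mem_set Kz)))//= lerDl.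
Qed.

Lemma circle_compact (r : R) : compact [set z : C | normc z = r].
Proof.
apply: (@compact_le_normc _ _ r) => [|z /= ->//].
apply: (@preimage_closed _ _ (@normc R : C -> R) [set x | x = r]).
  by move=> z _; apply: continuous_normc.
exact: closed_eq.
Qed.

Lemma strict_deriv_exprz z (m : int) : z != 0 ->
  exists l, strict_deriv (fun w => w ^ m) z l.
Proof.
case: m => k z0.
  have -> : (fun w : C => w ^ k) = (fun w => w ^+ k) by apply/funext => w; rewrite -exprnP.
  by eexists; apply: strict_derivX; apply: strict_deriv_id.
have -> : (fun w : C => w ^ Negz k) = (fun w => (w ^+ k.+1)^-1).
  by apply/funext => w; rewrite NegzE -exprnN.
eexists; apply: strict_derivV; first by rewrite expf_neq0.
by apply: strict_derivX; apply: strict_deriv_id.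
Qed.

Lemma normc_exprz z (m : int) : normc (z ^ m) = normc z ^ m.
Proof.
by case: m => k; rewrite -?exprnP ?NegzE -?exprnN ?normcV normcX.
Qed.

Lemma geometric_tail (u : nat -> C) (a : C) (A q : R) K : 0 <= q -> q < 1 ->
  (forall k, normc (u k) <= A * q ^+ k) -> series u @ \oo --> a ->
  normc (a - \sum_(k < K) u k) <= A * q ^+ K / (1 - q).
Proof.
move=> q0 q1 uA ua; have A0 : 0 <= A.
  by have := le_trans (normc_ge0 _) (uA 0%N); rewrite expr0 mulr1.
have q1' : 0 < 1 - q by rewrite subr_gt0.
have part m : \sum_(0 <= k < m) A * q ^+ (K + k) <= A * q ^+ K / (1 - q).
  rewrite ler_pdivlMr//.
  have -> : (\sum_(0 <= k < m) A * q ^+ (K + k)) * (1 - q) = A * (q ^+ K - q ^+ (K + m)).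
    elim: m => [|m IH]; first by rewrite big_geq// mul0r addn0 subrr mulr0.
    rewrite big_nat_recr//= mulrDl IH addnS exprSr; ring.
  by rewrite ler_wpM2l// gerBl exprn_ge0.
apply/ler_addgt0Pr => e e0; have /cvg_normcP /(_ e e0) [n _ nh] := ua.
have := nh (K + n)%N (leq_addl _ _); rewrite /series /= => h.
have -> : a - \sum_(k < K) u k =
  (a - \sum_(0 <= k < K + n) u k) + \sum_(0 <= k < n) u (K + k)%N.
  have -> : \sum_(0 <= k < K + n) u k = \sum_(k < K) u k + \sum_(0 <= k < n) u (K + k)%N.
    elim: (n) => [|m IH]; first by rewrite addn0 big_mkord [X in _ + X]big_geq// addr0.
    by rewrite addnS !big_nat_recr//= IH addrA.
  by rewrite opprD addrA subrK.
apply: le_trans (le_normcD _ _) _; rewrite normcB addrC lerD//.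
apply: le_trans (ler_normc_sum _ _ _) _; apply: le_trans (part n).
by apply: ler_sum.
Qed.

Lemma geometric_small (A q e : R) : 0 <= q -> q < 1 -> 0 < e ->
  exists K0, forall K, (K0 <= K)%N -> A * q ^+ K <= e.
Proof.
move=> q0 q1 e0.
have : A * q ^+ n @[n --> \oo] --> A * 0.
  by apply: cvgMr; apply: cvg_expr; rewrite ger0_norm.
rewrite mulr0 => /cvgrPdistC_le /(_ e e0) [K0 _ h].
exists K0 => K KK; have := h K KK; rewrite /= subr0; exact: le_trans (ler_norm _).
Qed.

Lemma cvg_terms_bounded (u : nat -> C) (a : C) : series u @ \oo --> a ->
  exists2 A : R, 0 < A & forall k, normc (u k) <= A.
Proof.
move=> ua; have : u @ \oo --> (0 : C) by apply: cvg_series_cvg_0; apply/cvg_ex; exists a.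
move=> /cvg_normcP /(_ 1 ltr01) [n _ nh].
exists (1 + \sum_(k < n) normc (u k)).
  by rewrite ltr_pwDl// sumr_ge0// => *; apply: normc_ge0.
move=> k; have [kn|nk] := ltnP k n.
  rewrite (bigD1 (Ordinal kn))//= addrCA lerDl addr_ge0// sumr_ge0// => *.
  exact: normc_ge0.
have := nh k nk; rewrite /= subr0 => /le_trans; apply.
by rewrite lerDl sumr_ge0// => *; apply: normc_ge0.
Qed.

Variables (s : C -> C) (c : int -> C) (r0 : R).
Hypothesis r0_ge0 : 0 <= r0.
Hypothesis s_deriv : forall z, r0 < normc z -> exists l, strict_deriv s z l.
Hypothesis s_laurent : laurent_coefs_at_infty s c.

(** The two halves of the Laurent series converge geometrically: compare with
    a larger, respectively smaller, radius at which they converge. *)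
Lemma laurent_geometric : exists M : R, forall r, M < r -> exists A q : R,
  [/\ 0 <= q, q < 1 & forall z, normc z = r -> forall K,
    normc (s z - (\sum_(k < K) c k%:Z * z ^+ k +
                  \sum_(k < K) c (- k.+1%:Z) * z ^- k.+1)) <= A * q ^+ K].
Proof.
have [M0 hM] := s_laurent.
pose M := Num.max M0 0; exists M => r Mr.
have [Mr0 M0r] : M0 < r /\ 0 < r by move: Mr; rewrite gt_max => /andP[].
pose r1 := (M + r) / 2; pose r2 := r + 1.
have [Mr1 r1r] : M < r1 /\ r1 < r by rewrite /r1; split; lra.
have r10 : 0 < r1 by apply: le_lt_trans Mr1; rewrite le_max lexx orbT.
have M0r1 : M0 < r1 by apply: le_lt_trans Mr1; rewrite le_max lexx.
have r20 : 0 < r2 by rewrite /r2; lra.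
have nr x : 0 < x -> normc (x%:C%C : C) = x by move=> x0; rewrite normc_real gtr0_norm.
have [_ [b1 [_ sb1 _]]] : exists a b : C,
    [/\ series (fun k : nat => c k%:Z * r1%:C%C ^+ k) @ \oo --> a,
        series (fun k : nat => c (- k.+1%:Z) * r1%:C%C ^- k.+1) @ \oo --> b
      & s r1%:C%C = a + b] by apply: hM; rewrite nr.
have [a2 [_ [sa2 _ _]]] : exists a b : C,
    [/\ series (fun k : nat => c k%:Z * r2%:C%C ^+ k) @ \oo --> a,
        series (fun k : nat => c (- k.+1%:Z) * r2%:C%C ^- k.+1) @ \oo --> b
      & s r2%:C%C = a + b] by apply: hM; rewrite nr// /r2; lra.
have [A1 A10 hA1] := cvg_terms_bounded sb1.
have [A2 A20 hA2] := cvg_terms_bounded sa2.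
pose q1 := r1 / r; pose q2 := r / r2.
have q10 : 0 <= q1 by rewrite divr_ge0// ltW.
have q20 : 0 <= q2 by rewrite divr_ge0// ltW.
have q11 : q1 < 1 by rewrite ltr_pdivrMr// mul1r.
have q21 : q2 < 1 by rewrite ltr_pdivrMr// mul1r /r2; lra.
pose q := Num.max q1 q2.
have qq1 : q1 <= q by rewrite le_max lexx.
have qq2 : q2 <= q by rewrite le_max lexx orbT.
have q0 : 0 <= q by apply: le_trans qq1.
have qlt1 : q < 1 by rewrite gt_max q11.
exists ((A1 + A2) / (1 - q)), q; split => // z zr K.
have [a [b [sa sb ->]]] := hM z (eq_ind_r (fun x => M0 < x) Mr0 zr).
have ta := @geometric_tail _ a A2 q K q0 qlt1 _ sa.
have tb := @geometric_tail _ b A1 q K q0 qlt1 _ sb.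
have -> : a + b - (\sum_(k < K) c k%:Z * z ^+ k + \sum_(k < K) c (- k.+1%:Z) * z ^- k.+1)
  = (a - \sum_(k < K) c k%:Z * z ^+ k) + (b - \sum_(k < K) c (- k.+1%:Z) * z ^- k.+1) by ring.
apply: le_trans (le_normcD _ _) _.
have -> : (A1 + A2) / (1 - q) * q ^+ K = A2 * q ^+ K / (1 - q) + A1 * q ^+ K / (1 - q) by ring.
apply: lerD.
  apply: ta => k; apply: (@le_trans _ _ (A2 * q2 ^+ k)); last first.
    by rewrite ler_wpM2l ?(ltW A20)// lerXn2r ?nnegrE.
  have := hA2 k; rewrite !normcM !normcX nr// zr /q2 (expr_div_n r r2) => h.
  by rewrite mulrA ler_pdivlMr ?exprn_gt0// mulrAC ler_wpM2r ?exprn_ge0// ltW.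
apply: tb => k; apply: (@le_trans _ _ (A1 * q1 ^+ k.+1)); last first.
  rewrite ler_wpM2l ?(ltW A10)//; apply: (@le_trans _ _ (q ^+ k.+1)).
    by rewrite lerXn2r ?nnegrE.
  by rewrite exprS ler_piMl ?exprn_ge0// ltW.
have := hA1 k; rewrite !normcM !normcV !normcX nr// zr /q1 (expr_div_n r1 r) => h.
rewrite mulrA ler_wpM2r ?invr_ge0 ?exprn_ge0 ?(ltW M0r)//.
by rewrite -ler_pdivrMr ?exprn_gt0.
Qed.

(** On a Laurent polynomial, the mean with N nodes picks out the m-th
    coefficient exactly as soon as N exceeds all the exponents that occur. *)
Lemma mean_laurent_near_infty (m : int) : exists M : R, forall z, M < normc z ->
  mean N (fun w => s w * w ^ (- m)) z @[N --> \oo] --> c m.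
Proof.
have [M hM] := laurent_geometric; exists (Num.max M 0) => z.
rewrite gt_max => /andP[/hM [A [q [q0 q1 hA]]] z0].
have zn0 : z != 0 by rewrite -normc_gt0.
apply/cvg_normcP => e e0; set r := normc z.
have rm0 : 0 < r ^ (- m) by rewrite exprz_gt0.
have [K0 hK] := geometric_small A q0 q1 (divr_gt0 e0 rm0).
pose K := maxn K0 `|m|.+1; exists (K + `|m|).+1 => // N /= NK.
have KN : (K < N)%N by apply: leq_trans NK; rewrite ltnS leq_addr.
pose S w := \sum_(k < K) c k%:Z * w ^+ k + \sum_(k < K) c (- k.+1%:Z) * w ^- k.+1.
have SE : mean N (fun w => S w * w ^ (- m)) z = c m.
  transitivity (mean N (fun w => \sum_(k < K) c k%:Z * w ^ (k%:Z - m) +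
       \sum_(k < K) c (- k.+1%:Z) * w ^ (- k.+1%:Z - m)) z).
    apply: eq_mean => j; set w := z * _.
    have w0 : w != 0 by rewrite -normc_gt0 normc_node.
    rewrite /S mulrDl !mulr_suml; congr (_ + _); apply: eq_bigr => k _.
      by rewrite -mulrA expfzDr// -exprnP.
    by rewrite -mulrA expfzDr// -exprnN.
  rewrite meanD !mean_sum.
  have mean1 (a : C) (p : int) : (`|p| < N)%N ->
      mean N (fun w => a * w ^ p) z = a * (p == 0)%:R.
    by move=> pN; rewrite meanZ mean_exprz.
  have mK : (`|m| < K)%N by rewrite /K leq_max ltnSn orbT.
  have b1 (k : 'I_K) : (absz (k%:Z - m)%R < N)%N.
    by have := ltn_ord k; lia.
  have b2 (k : 'I_K) : (absz (- k.+1%:Z - m)%R < N)%N.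
    by have := ltn_ord k; lia.
  under eq_bigr do rewrite mean1//.
  under [X in _ + X]eq_bigr do rewrite mean1//.
  have [[p mp]|[p mp]] : (exists p : nat, m = p%:Z) \/ (exists p : nat, m = - p.+1%:Z).
  - by case: (m) => p; [left; exists p|right; exists p; rewrite NegzE].
  - have pK : (p < K)%N by move: mK; rewrite mp.
    rewrite mp [X in _ + X]big1 => [|k _]; last first.
      by rewrite (_ : _ == _ = false) ?mulr0//; lia.
    rewrite addr0 (bigD1 (Ordinal pK))//= subrr eqxx mulr1 big1 ?addr0// => k km.
    rewrite (_ : _ == _ = false) ?mulr0//; apply/negP => /eqP h.
    by move/eqP: km; apply; apply/val_inj => /=; lia.
  - have pK : (p < K)%N by lia.
    rewrite mp big1 => [|k _]; last first.
      by rewrite (_ : _ == _ = false) ?mulr0//; lia.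
    rewrite add0r (bigD1 (Ordinal pK))//= subrr eqxx mulr1 big1 ?addr0// => k km.
    rewrite (_ : _ == _ = false) ?mulr0//; apply/negP => /eqP h.
    by move/eqP: km; apply; apply/val_inj => /=; lia.
rewrite -SE -meanB; apply: mean_le => [|j]; first exact: ltW.
set w := z * _; have wr : normc w = r by rewrite /w normc_node.
rewrite -mulrBl normcM normc_exprz wr -ler_pdivlMr//.
by apply: le_trans (hA w wr K) (hK K _); rewrite leq_maxl.
Qed.

Lemma strict_deriv_derive f z : (exists l, strict_deriv f z l) ->
  strict_deriv f z ((f^`())%classic z).
Proof. by move=> [l fl]; rewrite (strict_deriv_derive1 fl). Qed.

Lemma polarE z : z != 0 -> exists2 u : C, normc u = 1 & z = (normc z)%:C%C * u.
Proof.
move=> z0; have n0 : (normc z)%:C%C != 0 :> C.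
  by rewrite -normc_gt0 normc_real gtr0_norm normc_gt0.
exists (z / (normc z)%:C%C); last by rewrite mulrC divfK.
rewrite normcM normcV normc_real ger0_norm ?normc_ge0// divff//.
by rewrite normc_eq0.
Qed.

(** By mean_radial, so that the limit may be computed on a large circle, where
    the Laurent series is known to converge. *)
Lemma cvg_mean_radial (F : C -> C) z (l : C) (b : R) : 0 < normc z -> normc z <= b ->
  (forall w, normc z <= normc w -> exists l, strict_deriv F w l) ->
  (forall w, normc w = b -> mean N F w @[N --> \oo] --> l) ->
  mean N F z @[N --> \oo] --> l.
Proof.
move=> z0 zb Fd Fb; have zn0 : z != 0 by rewrite -normc_gt0.
have [u u1 zu] := polarE zn0.
have Fd' w : normc z <= normc w <= b -> strict_deriv F w ((F^`())%classic w).
  by move=> /andP[zw _]; apply/strict_deriv_derive/Fd.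
apply/cvg_normcP => e e0; have e2 : 0 < e / 2 by rewrite divr_gt0.
have [N1 h1] := mean_radial z0 Fd' e2.
have nb : normc (b%:C%C * u) = b.
  by rewrite normcM u1 mulr1 normc_real ger0_norm// (le_trans (ltW z0)).
have /cvg_normcP/(_ _ e2)[N2 _ h2] := Fb _ nb.
exists (maxn N1.+1 N2) => // N /=; rewrite geq_max => /andP[n1 n2].
have := h1 N u (normc z) b n1 u1 (lexx _) zb (lexx _); rewrite -zu normcB => k1.
by rewrite [e]splitr (le_trans (le_normcB_trans _ (mean N F (b%:C%C * u)) _))// lerD// h2.
Qed.

Lemma mean_laurent (m : int) z : r0 < normc z ->
  mean N (fun w => s w * w ^ (- m)) z @[N --> \oo] --> c m.
Proof.
move=> zr; have z0 : 0 < normc z by apply: le_lt_trans zr.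
have [M hM] := mean_laurent_near_infty m.
pose b := Num.max (normc z) (M + 1).
apply: (@cvg_mean_radial _ z _ b) => //; first by rewrite le_max lexx.
- move=> w zw; have w0 : w != 0 by rewrite -normc_gt0 (lt_le_trans z0).
  have [l1 h1] := s_deriv (lt_le_trans zr zw).
  have [l2 h2] := @strict_deriv_exprz w (- m) w0.
  by eexists; apply: strict_derivM h1 h2.
- move=> w wb; apply: hM; rewrite wb /b lt_max; apply/orP; right.
  by rewrite ltrDl.
Qed.

(** Cauchy's estimate, read off the means. *)
Lemma laurent_coef_le (m : int) (r B : R) : r0 < r ->
  (forall w, normc w = r -> normc (s w) <= B) -> normc (c m) <= B * r ^ (- m).
Proof.
move=> r0r sB; have rgt0 : 0 < r by apply: le_lt_trans r0r.
have nr : normc (r%:C%C : C) = r by rewrite normc_real gtr0_norm.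
have B0 : 0 <= B by apply: le_trans (sB _ nr); apply: normc_ge0.
apply/ler_addgt0Pr => e e0.
have /cvg_normcP/(_ _ e0)[N _ h] : mean N (fun w => s w * w ^ (- m)) r%:C%C @[N --> \oo] --> c m.
  by apply: mean_laurent; rewrite nr.
have := h N (leqnn _); rewrite normcB /= => hN.
rewrite -[c m](subrK (mean N (fun w => s w * w ^ (- m)) r%:C%C)).
apply: le_trans (le_normcD _ _) _; rewrite addrC lerD//.
apply: mean_le => [|j]; first by rewrite mulr_ge0// exprz_ge0// ltW.
set w := r%:C%C * _; have wr : normc w = r by rewrite /w normc_node.
by rewrite normcM normc_exprz wr ler_wpM2r ?exprz_ge0 ?(ltW rgt0)// sB.
Qed.

Lemma s_circle_bounded (r : R) : r0 < r ->
  exists2 B : R, 0 < B & forall w, normc w = r -> normc (s w) <= B.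
Proof.
move=> r0r; apply: (bounded_on_compact (@circle_compact r)) => z /= zr.
have [|l h] := s_deriv (z := z); first by rewrite zr.
exact: strict_deriv_continuous h.
Qed.

Lemma laurent_coef_geometric (r : R) : r0 < r -> exists A q : R,
  [/\ 0 < A, 0 <= q, q < 1 & forall k : nat, normc (c (- k%:Z)) * r ^- k <= A * q ^+ k].
Proof.
move=> r0r; have rgt0 : 0 < r by apply: le_lt_trans r0r.
pose r1 := (r0 + r) / 2; have [r01 r1r] : r0 < r1 /\ r1 < r by rewrite /r1; split; lra.
have r10 : 0 < r1 by apply: le_lt_trans r01.
have [B B0 hB] := s_circle_bounded r01.
exists B, (r1 / r); split => // [||k]; first by rewrite divr_ge0 ?ltW.
  by rewrite ltr_pdivrMr// mul1r.
rewrite (expr_div_n r1) mulrA ler_wpM2r ?invr_ge0 ?exprn_ge0 ?(ltW rgt0)//.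
by have := laurent_coef_le (- k%:Z) r01 hB; rewrite opprK -exprnP.
Qed.

Hypothesis s_lim : s z @[z --> @cinfty R] --> (1 : C).

Lemma s_near1 (e : R) : 0 < e ->
  exists M : R, forall z, M < normc z -> normc (s z - 1) <= e.
Proof. by move=> e0; have /cvg_normcP/(_ e e0) := s_lim. Qed.

Lemma laurent_coef_pos (m : nat) : (0 < m)%N -> c m%:Z = 0.
Proof.
move=> m0; apply/eqP; rewrite -normc_eq0 eq_le normc_ge0 andbT.
apply/ler_addgt0Pr => e e0; rewrite add0r.
have [M hM] := s_near1 ltr01.
pose r := Num.max (Num.max M r0) (Num.max 1 (2 / e)) + 1.
have [Mr [r0r [r1 er]]] : M < r /\ r0 < r /\ 1 <= r /\ 2 / e <= r.
  have h1 : Num.max (Num.max M r0) (Num.max 1 (2 / e)) < r by rewrite ltrDl.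
  have : M < r by apply: le_lt_trans h1; rewrite !le_max lexx.
  have : r0 < r by apply: le_lt_trans h1; rewrite !le_max lexx !orbT.
  have : 1 <= r by apply: le_trans (ltW h1); rewrite !le_max lexx !orbT.
  have : 2 / e <= r by apply: le_trans (ltW h1); rewrite !le_max lexx !orbT.
  by [].
have rgt0 : 0 < r by apply: lt_le_trans r1.
have sB w : normc w = r -> normc (s w) <= 2.
  move=> wr; rewrite -[s w](subrK 1); apply: le_trans (le_normcD _ _) _.
  by rewrite normc1 (_ : 2 = 1 + 1)// lerD2r hM// wr.
apply: le_trans (laurent_coef_le m%:Z r0r sB) _.
rewrite -exprnN ler_pdivrMr ?exprn_gt0//.
apply: (@le_trans _ _ (e * r)); first by rewrite mulrC -ler_pdivrMr.
by rewrite ler_wpM2l ?(ltW e0)// -[leLHS]expr1 ler_weXn2l.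
Qed.

Lemma laurent_coef0 : c 0 = 1.
Proof.
apply/eqP; rewrite -subr_eq0 -normc_eq0 eq_le normc_ge0 andbT.
apply/ler_addgt0Pr => e e0; rewrite add0r.
have e2 : 0 < e / 2 by rewrite divr_gt0.
have [M hM] := s_near1 e2.
pose r := Num.max M r0 + 1.
have [Mr r0r] : M < r /\ r0 < r.
  have h1 : Num.max M r0 < r by rewrite ltrDl.
  by split; apply: le_lt_trans h1; rewrite !le_max lexx ?orbT.
have rgt0 : 0 < r by apply: le_lt_trans r0r.
have nr : normc (r%:C%C : C) = r by rewrite normc_real gtr0_norm.
have /cvg_normcP/(_ _ e2)[N _ h] : mean N (fun w => s w * w ^ (- 0)) r%:C%C @[N --> \oo] --> c 0.
  by apply: mean_laurent; rewrite nr.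
have := h N.+1 (leqnSn _); rewrite normcB /= => hN.
rewrite [e]splitr; apply: le_trans (le_normcB_trans _ _ _) (lerD hN _).
rewrite -(@mean_cst R N.+1 1 r%:C%C)// -meanB; apply: mean_le => [|j]; first exact: ltW.
by rewrite oppr0 expr0z mulr1; apply: hM; rewrite normc_node nr.
Qed.

End Laurent.

Lemma cvg_ord_sum (K : numFieldType) m (f : 'I_m -> nat -> K) (l : 'I_m -> K) :
  (forall i, f i @ \oo --> l i) ->
  (fun N => \sum_(i < m) f i N) @ \oo --> \sum_(i < m) l i.
Proof.
elim: m f l => [|m IH] f l fl.
  by rewrite big_ord0; under eq_fun do rewrite big_ord0; apply: cvg_cst.
rewrite big_ord_recr; under eq_fun do rewrite big_ord_recr.
exact: (cvgD (IH _ _ (fun i => fl (widen_ord (leqnSn m) i))) (fl ord_max)).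
Qed.

Lemma sum_le_double (K : realFieldType) m (f g h : nat -> K) (B : K) :
  (forall k, (k < m)%N -> f k <= 2 * g k + 2 * h k) ->
  \sum_(k < m) g k <= B -> \sum_(k < m) h k <= B -> \sum_(k < m) f k <= 4 * B.
Proof.
move=> fgh gB hB; apply: (@le_trans _ _ (\sum_(k < m) (2 * g k + 2 * h k))).
  by apply: ler_sum => k _; apply: fgh.
rewrite big_split -!mulr_sumr /=; lra.
Qed.

Section LaurentSum.
Variable R : realType.
Local Notation C := R[i].
Implicit Types (z w : C) (N K : nat).
Variables (s : C -> C) (c : int -> C) (r0 : R).
Hypothesis r0_ge0 : 0 <= r0.
Hypothesis s_deriv : forall z, r0 < normc z -> exists l, strict_deriv s z l.
Hypothesis s_laurent : laurent_coefs_at_infty s c.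
Hypothesis s_lim : s z @[z --> @cinfty R] --> (1 : C).

Lemma sqr_normcB_le z w : normc (z - w) ^+ 2 <= 2 * normc z ^+ 2 + 2 * normc w ^+ 2.
Proof.
apply: (@le_trans _ _ ((normc z + normc w) ^+ 2)).
  by rewrite lerXn2r ?nnegrE ?addr_ge0 ?normc_ge0// (le_trans (le_normcD _ _))// normcN.
have := sqr_ge0 (normc z - normc w); rewrite sqrrB sqrrD; lra.
Qed.

Lemma circle_lipschitz z : r0 < normc z -> exists2 L : R, 0 < L &
  forall w, normc w = normc z -> normc (s w - s z) <= L * normc (w - z).
Proof.
move=> zr; have [l /strict_derivP/(_ 1 ltr01)[d d0 dh]] := s_deriv zr.
have [B B0 hB] := s_circle_bounded s_deriv zr.
exists (1 + normc l + 2 * B / d).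
  by rewrite ltr_pwDl ?divr_ge0 ?mulr_ge0 ?ltW// ltr_wpDr ?normc_ge0.
move=> w wz; have Bd : 0 <= 2 * B / d by rewrite divr_ge0 ?mulr_ge0 ?ltW.
have [wd|dw] := ltP (normc (w - z)) d.
  have := dh w z wd; rewrite subrr normc0 => /(_ d0) h.
  rewrite -[s w - s z](subrK (l * (w - z))) (le_trans (le_normcD _ _))//.
  rewrite mulrDl (le_trans _ (_ : (1 + normc l) * normc (w - z) <= _))//.
    by rewrite mulrDl normcM lerD2r.
  by rewrite lerDl mulr_ge0 ?normc_ge0.
apply: (@le_trans _ _ (2 * B)).
  rewrite (le_trans (le_normcD _ _))// normcN (_ : 2 * B = B + B); last by ring.
  by rewrite lerD// hB.
apply: (@le_trans _ _ (2 * B / d * normc (w - z))).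
  by rewrite mulrAC ler_pdivlMr// ler_wpM2l// mulr_ge0// ltW.
by rewrite ler_wpM2r ?normc_ge0// lerDr addr_ge0 ?normc_ge0.
Qed.

(** Fourier coefficients of the difference quotient of s on the circle at z
    telescope to the partial sums of the Laurent series (Chernoff's proof of
    the convergence of Fourier series). By Bessel's inequality they are square
    summable. *)
Lemma laurent_remainder_l2 z : r0 < normc z -> exists B : R, forall m,
  \sum_(k < m) normc (\sum_(i < k.+1) c (- i%:Z) * z ^- i - s z) ^+ 2 <= B.
Proof.
move=> zr; have zpos : 0 < normc z by apply: le_lt_trans zr.
have z0 : z != 0 by rewrite -normc_gt0.
have [L L0 hL] := circle_lipschitz zr; pose B := (L * normc z) ^+ 2.
exists (4 * B) => m.
pose w N := omega R N.
(* H N j is 0 at the nodes equal to z, where the denominator is 0; this is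
   consistent with HE below. Its Fourier coefficients p satisfy
   A N i - s(z) [i = 0] = p N (i + 1) - p N i, and A N i tends to the term
   c_(-i) z ^ (-i) of the Laurent series. *)
pose H N j := (s (z * w N ^+ j) - s z) / (w N ^+ j - 1).
pose p N (k : int) := (\sum_(j < N) H N j * (w N ^+ j) ^ k) / N%:R.
pose A N (i : int) := mean N (fun v => s v * v ^ i) z * z ^ (- i).
have HE N j : H N j * (w N ^+ j - 1) = s (z * w N ^+ j) - s z.
  have [w1|w1] := eqVneq (w N ^+ j) 1; last by rewrite divfK// subr_eq0.
  by rewrite w1 mulr1 !subrr mulr0.
have Hle N j : normc (H N j) ^+ 2 <= B.
  rewrite lerXn2r ?nnegrE ?normc_ge0 ?mulr_ge0 ?normc_ge0 ?(ltW L0)//.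
  have [w1|w1] := eqVneq (w N ^+ j) 1.
    by rewrite /H w1 mulr1 subrr mul0r normc0 mulr_ge0 ?normc_ge0 ?ltW.
  rewrite normcM normcV ler_pdivrMr ?normc_gt0 ?subr_eq0//.
  have := hL (z * w N ^+ j); rewrite normc_node => /(_ erefl).
  have -> : z * w N ^+ j - z = z * (w N ^+ j - 1) by rewrite mulrBr mulr1.
  by rewrite normcM mulrA.
have step N (i : int) : (`|i| < N)%N -> A N i - s z * (i == 0)%:R = p N (i + 1) - p N i.
  move=> iN; have N0 : (0 < N)%N by apply: leq_ltn_trans iN.
  have -> : A N i = (\sum_(j < N) s (z * w N ^+ j) * (w N ^+ j) ^ i) / N%:R.
    rewrite /A /mean mulrAC mulr_suml; congr (_ / _); apply: eq_bigr => j _.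
    rewrite exprzMl ?unitfE ?expf_neq0 ?expi_neq0// mulrA mulrAC; congr (_ * _).
    by rewrite -mulrA -expfzDr// subrr expr0z mulr1.
  have <- : mean N (fun v => s z * v ^ i) 1 = s z * (i == 0)%:R.
    by rewrite meanZ mean_exprz// oner_eq0.
  rewrite /mean /p -!mulrBl -!sumrB; congr (_ / _); apply: eq_bigr => j _.
  have wj : w N ^+ j != 0 by rewrite expf_neq0// expi_neq0.
  rewrite mul1r -/(w N) -mulrBl -HE expfzDr// expr1z; ring.
have tele N k : (k.+1 < N)%N ->
  \sum_(i < k.+1) A N i%:Z + \sum_(i < k.+1) A N (- i.+1%:Z) - s z =
  p N k.+1%:Z - p N (- k.+1%:Z).
  elim: k => [|k IH] kN.
    have e0 := step N 0 (ltnW kN); have e1 := step N (- 1%:Z) kN.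
    rewrite mulr1 add0r in e0; rewrite addNr mulr0 subr0 in e1.
    by rewrite !big_ord1 /= addrAC e0 e1 addrA subrK.
  have e0 := step N k.+1%:Z (ltnW kN).
  have e1 : A N (- k.+2%:Z) - s z * (- k.+2%:Z == 0)%:R =
      p N (- k.+2%:Z + 1) - p N (- k.+2%:Z) by apply: step.
  rewrite mulr0 subr0 in e0; rewrite mulr0 subr0 in e1.
  rewrite (_ : k.+1%:Z + 1 = k.+2%:Z) in e0; last by lia.
  rewrite (_ : - k.+2%:Z + 1 = - k.+1%:Z) in e1; last by lia.
  rewrite big_ord_recr [X in _ + X - _]big_ord_recr /= e0 e1.
  have := IH (ltnW kN); set S1 := \sum_(i < k.+1) _; set S2 := \sum_(i < k.+1) _.
  move=> E; transitivity ((S1 + S2 - s z) + (p N k.+2%:Z - p N k.+1%:Z) +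
    (p N (- k.+1%:Z) - p N (- k.+2%:Z))); first by ring.
  by rewrite E; ring.
have bessel v N : (m < N)%N -> N.-primitive_root v ->
    \sum_(k < m) normc ((\sum_(j < N) H N j * v ^+ (j * k.+1)) / N%:R) ^+ 2 <= B.
  move=> mN vN; have N0 : (0 < N)%N by apply: leq_ltn_trans mN.
  pose f k := normc ((\sum_(j < N) H N j * v ^+ (j * k)) / N%:R) ^+ 2.
  have f0 k : 0 <= f k by apply: sqr_ge0.
  apply: (@le_trans _ _ (\sum_(k < N) f k)).
    rewrite -(big_mkord xpredT f) (big_cat_nat (n := m.+1))//= big_nat_recl//.
    rewrite -addrA addrCA big_mkord lerDl addr_ge0// sumr_ge0// => *; exact: f0.
  rewrite /f (parseval_dft _ vN) ler_pdivrMr ?ltr0n//.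
  apply: (@le_trans _ _ (\sum_(j < N) B)); first by apply: ler_sum => j _; apply: Hle.
  by rewrite sumr_const card_ord mulr_natr.
pose q N k := \sum_(i < k.+1) A N i%:Z + \sum_(i < k.+1) A N (- i.+1%:Z) - s z.
have qle N : (m < N)%N -> \sum_(k < m) normc (q N k) ^+ 2 <= 4 * B.
  move=> mN; have wN := omega_prim R (leq_ltn_trans (leq0n _) mN).
  pose f1 k := (\sum_(j < N) H N j * w N ^+ (j * k.+1)) / N%:R.
  pose f2 k := (\sum_(j < N) H N j * (w N)^-1 ^+ (j * k.+1)) / N%:R.
  apply: (@sum_le_double R m (fun k => normc (q N k) ^+ 2) (fun k => normc (f1 k) ^+ 2)
      (fun k => normc (f2 k) ^+ 2)) => [k km||].
    rewrite /q tele; last by apply: leq_ltn_trans mN.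
    have -> : p N k.+1%:Z = f1 k.
      by congr (_ / _); apply: eq_bigr => j _; rewrite -exprnP -exprM.
    have -> : p N (- k.+1%:Z) = f2 k.
      by congr (_ / _); apply: eq_bigr => j _; rewrite -exprnN exprVn exprM.
    exact: sqr_normcB_le.
  - exact: bessel.
  - by apply: bessel => //; apply: prim_rootV.
have Acvg (i : int) : A N i @[N --> \oo] --> c (- i) * z ^ (- i).
  have := mean_laurent r0_ge0 s_deriv s_laurent (m := - i) zr; rewrite opprK => h.
  exact: (cvgM h (cvg_cst _)).
have qcvg k : q N k @[N --> \oo] --> \sum_(i < k.+1) c (- i%:Z) * z ^- i - s z.
  have c1 : \sum_(i < k.+1) A N i%:Z @[N --> \oo] --> \sum_(i < k.+1) c (- i%:Z) * z ^- i.
    rewrite (eq_bigr (fun i : 'I_k.+1 => c (- i%:Z) * z ^ (- i%:Z))).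
      exact: (@cvg_ord_sum R[i] k.+1 (fun i N => A N i%:Z) _ (fun i => Acvg i%:Z)).
    by move=> i _; rewrite -exprnN.
  have c2 : \sum_(i < k.+1) A N (- i.+1%:Z) @[N --> \oo] --> (0 : C).
    have Z : \sum_(i < k.+1) c (- (- i.+1%:Z)) * z ^ (- (- i.+1%:Z)) = 0.
      rewrite big1// => i _; rewrite opprK.
      by rewrite (laurent_coef_pos r0_ge0 s_deriv s_laurent s_lim)// mul0r.
    rewrite -[X in _ --> X]Z.
    exact: (@cvg_ord_sum R[i] k.+1 (fun i N => A N (- i.+1%:Z)) _ (fun i => Acvg (- i.+1%:Z))).
  have c4 : (fun=> s z) x @[x --> \oo] --> s z by exact: cvg_cst.
  rewrite -[\sum_(i < k.+1) c (- i%:Z) * z ^- i]addr0.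
  exact: (cvgB (cvgD c1 c2) c4).
apply: (@cvgr_to_le _ \oo _ R (fun N => \sum_(k < m) normc (q N k) ^+ 2)); last first.
  by exists m.+1 => // N; apply: qle.
apply: cvg_ord_sum => k.
have nq : normc (q N k) @[N --> \oo] --> normc (\sum_(i < k.+1) c (- i%:Z) * z ^- i - s z).
  exact: (continuous_cvg _ (@continuous_normc R _) (qcvg k)).
exact: (cvgM nq nq).
Qed.

(** The Laurent series of s is given near infinity only. The square summable
    remainders tend to 0, so it represents s up to the critical radius. *)
Lemma laurent_series_cvg z : r0 < normc z ->
  series (fun i => c (- i%:Z) * z ^- i) @ \oo --> s z.
Proof.
move=> zr; have [B hB] := laurent_remainder_l2 zr.
pose t k := normc (\sum_(i < k.+1) c (- i%:Z) * z ^- i - s z) ^+ 2.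
have : cvgn (series t).
  apply: nondecreasing_is_cvgn.
    by apply: nondecreasing_series => n _ _; apply: sqr_ge0.
  by exists B => _ [m _ <-]; rewrite /series /= big_mkord; apply: hB.
move=> /cvg_series_cvg_0 t0; apply/cvg_normcP => e e0.
have e2 : 0 < e ^+ 2 by rewrite exprn_gt0.
have /cvgrPdistC_le /(_ _ e2) [n _ nh] := t0.
exists n.+1 => // -[//|k] /= nk; have := nh k nk; rewrite subr0 /t => h.
have := le_trans (ler_norm _) h.
by rewrite ler_pXn2r ?nnegrE ?normc_ge0 ?(ltW e0)// /series /= big_mkord.
Qed.

End LaurentSum.

Section LaurentMeans.
Variable R : realType.
Local Notation C := R[i].
Implicit Types (z w : C) (N K : nat).
Variables (s : C -> C) (c : int -> C) (r0 : R).
Hypothesis r0_ge0 : 0 <= r0.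
Hypothesis s_deriv : forall z, r0 < normc z -> exists l, strict_deriv s z l.
Hypothesis s_laurent : laurent_coefs_at_infty s c.
Hypothesis s_lim : s z @[z --> @cinfty R] --> (1 : C).

Lemma mean_trig_poly N K (b : nat -> C) : (K < N)%N ->
  (\sum_(j < N) normc (\sum_(i < K) b i * (omega R N ^+ j) ^- i) ^+ 2) / N%:R =
  \sum_(k < K) normc (b k) ^+ 2.
Proof.
move=> KN; have N0 : (0 < N)%N by apply: leq_ltn_trans KN.
rewrite -(parseval_dft (fun j => \sum_(i < K) b i * (omega R N ^+ j) ^- i) (omega_prim R N0)).
have dft k : (k < N)%N -> (\sum_(j < N) (\sum_(i < K) b i * (omega R N ^+ j) ^- i) * omega R N ^+ (j * k)) / N%:R
    = if (k < K)%N then b k else 0.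
  move=> kN; transitivity (mean N (fun w => \sum_(i < K) b i * w ^ (k%:Z - i%:Z)) 1).
    rewrite /mean; congr (_ / _); apply: eq_bigr => j _.
    rewrite mul1r mulr_suml; apply: eq_bigr => i _.
    have w0 : omega R N ^+ j != 0 by rewrite expf_neq0// expi_neq0.
    by rewrite -mulrA expfzDr// -exprnP -exprnN exprM [_ ^- i * _]mulrC.
  rewrite mean_sum.
  under eq_bigr => i _.
    rewrite meanZ mean_exprz ?oner_eq0//; last by have := ltn_ord i; lia.
    over.
  case: ifPn => [kK|]; last first.
    rewrite -leqNgt => Kk; rewrite big1// => i _.
    by rewrite (_ : _ == _ = false) ?mulr0//; have := ltn_ord i; lia.
  rewrite (bigD1 (Ordinal kK))//= subrr eqxx mulr1 big1 ?addr0// => i ik.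
  rewrite (_ : _ == _ = false) ?mulr0//; apply/negP => /eqP h.
  by move/eqP: ik; apply; apply/val_inj => /=; lia.
rewrite (eq_bigr (fun k : 'I_N => normc (if (k < K)%N then b k else 0) ^+ 2)); last first.
  by move=> k _; rewrite dft.
rewrite -(big_mkord xpredT (fun k => normc (if (k < K)%N then b k else 0) ^+ 2)).
rewrite (big_cat_nat (n := K))//=; last exact: ltnW.
rewrite [X in _ + X]big_nat_cond [X in _ + X]big1 ?addr0 => [|k]; last first.
  by case/andP => /andP[Kk _] _; rewrite ifN -?leqNgt// normc0 expr0n.
by rewrite big_mkord; apply: eq_bigr => k _; rewrite ltn_ord.
Qed.

(** On the circle, s is uniformly close to a partial sum with K terms of its
    Laurent series, for which Parseval's identity is exact as soon as N > K. *)
Lemma mean_sqr_normc z (e : R) : r0 < normc z -> 0 < e ->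
  exists K0, forall K, (K0 <= K)%N -> exists N0, forall N, (N0 < N)%N ->
  `|(\sum_(j < N) normc (s (z * omega R N ^+ j)) ^+ 2) / N%:R -
    \sum_(k < K) normc (c (- k%:Z)) ^+ 2 * normc z ^- (2 * k)| <= e.
Proof.
move=> zr e0; have zpos : 0 < normc z by apply: le_lt_trans zr.
have [A [q [A0 q0 q1 hA]]] := laurent_coef_geometric r0_ge0 s_deriv s_laurent zr.
have [B B0 hB] := s_circle_bounded s_deriv zr.
have q1' : 0 < 1 - q by rewrite subr_gt0.
have d0 : 0 < Num.min 1 (e / (2 * B + 1)) by rewrite lt_min ltr01 divr_gt0//; lra.
have [K0 hK0] := geometric_small (A / (1 - q)) q0 q1 d0.
exists K0 => K KK; exists K => N KN; have N0 : (0 < N)%N by apply: leq_ltn_trans KN.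
have [ek1 ek2] : A * q ^+ K / (1 - q) <= 1 /\ A * q ^+ K / (1 - q) <= e / (2 * B + 1).
  by have := hK0 K KK; rewrite le_min mulrAC => /andP[].
pose S w := \sum_(k < K) c (- k%:Z) * w ^- k.
have sS w : normc w = normc z -> normc (s w - S w) <= A * q ^+ K / (1 - q).
  move=> wz; have wr : r0 < normc w by rewrite wz.
  apply: (geometric_tail K q0 q1 _ (laurent_series_cvg r0_ge0 s_deriv s_laurent s_lim wr)) => k.
  by rewrite normcM normcV normcX wz.
have -> : \sum_(k < K) normc (c (- k%:Z)) ^+ 2 * normc z ^- (2 * k) =
    (\sum_(j < N) normc (S (z * omega R N ^+ j)) ^+ 2) / N%:R.
  rewrite (eq_bigr (fun k : 'I_K => normc (c (- k%:Z) * z ^- k) ^+ 2)); last first.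
    by move=> k _; rewrite normcM normcV normcX exprMn exprVn mulnC exprM.
  rewrite -(mean_trig_poly (fun k => c (- k%:Z) * z ^- k) KN).
  congr (_ / _); apply: eq_bigr => j _; congr (normc _ ^+ 2); apply: eq_bigr => k _.
  by rewrite exprMn invfM mulrA.
rewrite -mulrBl -sumrB normrM normfV normr_nat ler_pdivrMr ?ltr0n//.
apply: le_trans (ler_norm_sum _ _ _) _.
apply: (@le_trans _ _ (\sum_(j < N) e)); last by rewrite sumr_const card_ord mulr_natr.
apply: ler_sum => j _; set w := z * _; have wz : normc w = normc z by rewrite /w normc_node.
have h := sS w wz; have hs := hB w wz.
have hd := ler_dist_normc (s w) (S w).
have hS : normc (S w) <= B + 1.
  have := ler_sub_normc (S w) (s w); rewrite normcB; lra.
rewrite subr_sqr normrM (ger0_norm (addr_ge0 (normc_ge0 _) (normc_ge0 _))).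
apply: (@le_trans _ _ (e / (2 * B + 1) * (2 * B + 1))); last by rewrite divfK// gt_eqF//; lra.
apply: ler_pM => //; first by rewrite addr_ge0 ?normc_ge0.
  by apply: le_trans hd (le_trans h ek2).
lra.
Qed.

(** The coefficient of w ^- 1 in the derivative s ^ 2 of F is 2 c_0 c_(-1), and
    the means of w F'(w) tend to 0. *)
Lemma laurent_coef_m1 (F : C -> C) :
  (forall z, r0 < normc z -> strict_deriv F z (s z ^+ 2)) -> c (- 1%:Z) = 0.
Proof.
move=> Fd; have c0 := laurent_coef0 r0_ge0 s_deriv s_laurent s_lim.
pose r1 := r0 + 1; have r01 : r0 < r1 by rewrite /r1; lra.
have r10 : 0 < r1 by apply: le_lt_trans r01.
have [B B0 hB] := s_circle_bounded s_deriv r01.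
have cB (k : nat) : normc (c (- k%:Z)) <= B * r1 ^+ k.
  by have := laurent_coef_le r0_ge0 s_deriv s_laurent (- k%:Z) r01 hB; rewrite opprK -exprnP.
have tail K w : 2 * r1 <= normc w ->
    normc (s w - \sum_(k < K) c (- k%:Z) * w ^- k) <= 2 * B * (r1 / normc w) ^+ K.
  move=> w2; have w0 : 0 < normc w by apply: lt_le_trans w2; rewrite mulr_gt0.
  have wr : r0 < normc w by lra.
  have q12 : r1 / normc w <= 1 / 2 by rewrite ler_pdivrMr//; lra.
  have q0 : 0 <= r1 / normc w by rewrite divr_ge0 ?ltW.
  have q1 : r1 / normc w < 1 by lra.
  have := geometric_tail (A := B) K q0 q1 _ (laurent_series_cvg r0_ge0 s_deriv s_laurent s_lim wr).
  move=> h; apply: (le_trans (h _)) => [k|].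
    rewrite normcM normcV normcX (expr_div_n r1) mulrA ler_wpM2r//.
    by rewrite invr_ge0 exprn_ge0// ltW.
  rewrite ler_pdivrMr; last by lra.
  have -> : 2 * B * (r1 / normc w) ^+ K * (1 - r1 / normc w) =
      B * (r1 / normc w) ^+ K * (2 * (1 - r1 / normc w)) by ring.
  by rewrite ler_peMr ?mulr_ge0 ?exprn_ge0 ?(ltW B0)//; lra.
pose D := (2 * B * r1) ^+ 2 + 2 * (2 * B * r1 ^+ 2).
have arith (a b n : R) : 0 <= a -> 0 < n -> a <= 2 * B * (r1 / n) ->
    b <= 2 * B * (r1 / n) ^+ 2 -> a ^+ 2 * n + 2 * b * n <= D / n.
  move=> a0 n0 t1 t2; rewrite ler_pdivlMr// mulrDl; apply: lerD.
    have -> : a ^+ 2 * n * n = (a * n) ^+ 2 by ring.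
    rewrite lerXn2r ?nnegrE ?mulr_ge0 ?(ltW B0) ?(ltW r10) ?(ltW n0)//.
    by rewrite -ler_pdivlMr// -(mulrA (2 * B)).
  have -> : 2 * b * n * n = 2 * (b * n ^+ 2) by ring.
  rewrite ler_wpM2l// -ler_pdivlMr ?exprn_gt0//.
  by apply: le_trans t2 _; rewrite expr_div_n (mulrA (2 * B)).
have key w : 2 * r1 <= normc w ->
    normc (s w ^+ 2 * w - w - 2 * c (- 1%:Z)) <= D / normc w.
  move=> w2; have w0 : 0 < normc w by apply: lt_le_trans w2; rewrite mulr_gt0.
  have wn0 : w != 0 by rewrite -normc_gt0.
  have t1 := tail 1%N w w2; have t2 := tail 2%N w w2.
  rewrite big_ord1 oppr0 c0 expr0 invr1 mulr1 expr1 in t1.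
  rewrite big_ord_recl big_ord1 oppr0 c0 expr0 invr1 mulr1 /bump /= in t2.
  have -> : s w ^+ 2 * w - w - 2 * c (- 1%:Z) =
      (s w - 1) ^+ 2 * w + 2 * (s w - (1 + c (- 1%:Z) * w ^- 1)) * w.
    by rewrite expr1; field.
  apply: le_trans (le_normcD _ _) _.
  rewrite (normcM (_ ^+ 2) w) (normcM (2 * _) w) (normcM 2).
  have -> : normc (2 : C) = 2 by rewrite (normc_nat R 2).
  rewrite normcX; apply: arith => //; exact: normc_ge0.
apply/eqP; rewrite -normc_eq0 eq_le normc_ge0 andbT; apply/ler_addgt0Pr => e e0.
rewrite add0r.
have D0 : 0 <= D by rewrite /D addr_ge0 ?sqr_ge0// !mulr_ge0 ?exprn_ge0 ?ltW.
pose r := Num.max (2 * r1) (D / e).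
have rr1 : 2 * r1 <= r by rewrite le_max lexx.
have rD : D / e <= r by rewrite le_max lexx orbT.
have rpos : 0 < r by apply: lt_le_trans rr1; rewrite mulr_gt0.
pose z : C := r%:C%C; have nz : normc z = r by rewrite normc_real gtr0_norm.
have Fd' w : r <= normc w <= r -> strict_deriv F w (s w ^+ 2).
  by move=> /andP[rw _]; apply: Fd; rewrite (lt_le_trans _ rw)//; lra.
have [N0 hN] := mean_deriv_eq0 rpos Fd' e0.
pose N := N0.+2; have NN : (N0 < N)%N by rewrite /N.
have h1 : normc (mean N (fun w => s w ^+ 2 * w) z) <= e by apply: hN => //; rewrite nz lexx.
have h2 : normc (mean N (fun w => s w ^+ 2 * w - w - 2 * c (- 1%:Z)) z) <= e.
  apply: mean_le => [|j]; first exact: ltW.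
  apply: (le_trans (key _ _)); rewrite normc_node nz//.
  by rewrite ler_pdivrMr// mulrC -ler_pdivrMr.
have E : mean N (fun w => s w ^+ 2 * w - w - 2 * c (- 1%:Z)) z =
    mean N (fun w => s w ^+ 2 * w) z - 2 * c (- 1%:Z).
  rewrite !meanB mean_cst//; congr (_ - _).
  have -> : mean N (fun w => w) z = 0.
    rewrite -[RHS](_ : mean N (fun w => w ^ 1%:Z) z = 0).
      by apply: eq_mean => j; rewrite expr1z.
    by rewrite mean_exprz// -normc_gt0 nz.
  by rewrite subr0.
have : normc (2 * c (- 1%:Z)) <= e + e.
  rewrite -[2 * _](subrK (mean N (fun w => s w ^+ 2 * w) z)) addrC.
  apply: le_trans (le_normcD _ _) _; rewrite lerD// normcB -E//.
rewrite normcM (normc_nat R 2); lra.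
Qed.

End LaurentMeans.

(** * The conformal map of the exterior of a level set *)

Section Uniformization.
Variable R : realType.
Local Notation C := R[i].
Implicit Types (z w : C).

(** Connectedness of the segment: the indicator function of A has Lipschitz
    constant 0 at a small scale. *)
Lemma locally_constant_segment (A : R -> Prop) (a b : R) : a <= b ->
  (forall t, a <= t <= b -> exists2 d : R, 0 < d &
     forall s, a <= s <= b -> `|s - t| < d -> (A s <-> A t)) ->
  A a -> A b.
Proof.
move=> ab loc Aa.
have [d d0 h] : exists2 d : R, 0 < d & forall s t, a <= s <= b -> a <= t <= b ->
    `|s - t| < d -> (A s <-> A t).
  pose Q (d t : R) := forall s, a <= s <= b -> a <= t <= b -> `|s - t| < d -> (A s <-> A t).
  have /compact_near_coveringP cov := @segment_compact R a b.
  have : \forall d \near (0 : R)^'+, `[a, b]%classic `<=` Q d.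
    apply: cov => t /=; rewrite in_itv /= => /loc[d d0 dh].
    exists ([set t' | `|t' - t| < d / 2], [set e | e < d / 2]).
      split; last by apply: nbhs_right_lt; rewrite divr_gt0.
      apply/nbhs_ballP; exists (d / 2); first by rewrite /= divr_gt0.
      by move=> t'; rewrite -ball_normE /= distrC.
    move=> [t' e] /= [t't ed] s sab t'ab st'.
    have h1 : A s <-> A t.
      apply: dh => //; rewrite -(subrK t' s) -addrA (le_lt_trans (ler_normD _ _))//.
      rewrite [d]splitr ltrD//; exact: lt_trans ed.
    have h2 : A t' <-> A t by apply: dh => //; rewrite (lt_trans t't)//; lra.
    by rewrite h1 h2.
  move=> H; have : \forall e \near (0 : R)^'+, 0 < e /\ `[a, b]%classic `<=` Q e.
    by apply: filterI => //; exact: nbhs_right_gt.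
  move=> /filter_ex[e [e0 eK]]; exists e => // s t sab tab.
  by apply: eK => //; rewrite /= in_itv.
pose g t : C := if `[< A t >] then 0 else 1.
have : normc (g b - g a) <= 0 * (b - a).
  apply: small_scale_lipschitz ab d0 _ => x y xab yab xy.
  rewrite mul0r /g (propext (h x y xab yab xy)) subrr normc0//.
rewrite mul0r {2}/g asboolT// subr0 /g; case: asboolP => // _.
by rewrite normc1 ler10.
Qed.

Variables (n : nat) (P : {poly C}) (phi : C -> C) (r0 : R).
Hypothesis n_gt0 : (0 < n)%N.
Hypothesis P_size : size P = n.+1.
Hypothesis r0_ge0 : 0 <= r0.
Hypothesis P_crit : forall x, root P^`() x -> normc P.[x] <= r0 ^+ n.
Hypothesis phi_cont : forall z, r0 < normc z -> {for z, continuous phi}.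
Hypothesis phi_eq : forall z, r0 < normc z -> P.[phi z] = z ^+ n.
Hypothesis phi_lim : phi z / z @[z --> @cinfty R] --> (1 : C).

Lemma phi_not_critical z : r0 < normc z -> P^`().[phi z] != 0.
Proof.
move=> zr; apply/negP => /eqP h; have := P_crit (introT eqP h).
by rewrite phi_eq// normcX ler_pXn2r ?nnegrE ?normc_ge0// leNgt zr.
Qed.

Lemma exterior_nbhs z : r0 < normc z -> \forall w \near z, r0 < normc w.
Proof.
move=> zr; apply/nbhs_normcP; exists (normc z - r0); first by rewrite subr_gt0.
by move=> w wz; have := ler_sub_normc z w; rewrite normcB; lra.
Qed.

Lemma phi_strict_deriv z : r0 < normc z ->
  strict_deriv phi z ((z ^+ n.-1 *+ n) / P^`().[phi z]).
Proof.
move=> zr; apply: (@strict_deriv_implicit _ P phi (fun z => z ^+ n)).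
- exact: phi_cont.
- by apply: filterS (exterior_nbhs zr) => w; apply: phi_eq.
- exact: phi_not_critical.
- by have := @strict_derivX R id z 1 n (@strict_deriv_id _ z); rewrite mulr1.
Qed.

Lemma poly_locally_injective w : P^`().[w] != 0 ->
  exists2 d : R, 0 < d & forall x y, normc (x - w) < d -> normc (y - w) < d ->
    P.[x] = P.[y] -> x = y.
Proof.
move=> P'w; have p0 : 0 < normc P^`().[w] by rewrite normc_gt0.
have e0 : 0 < normc P^`().[w] / 2 by rewrite divr_gt0.
have /strict_derivP /(_ _ e0) [d d0 h] := @strict_deriv_horner R P w.
exists d => // x y xd yd xy; have := h x y xd yd; rewrite xy subrr sub0r normcN normcM.
move=> hh; apply/eqP; rewrite -subr_eq0 -normc_eq0 eq_le normc_ge0 andbT.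
by rewrite -(ler_pM2l e0) mulr0; lra.
Qed.

(** If phi takes the same value at z and u z, with u ^ n = 1, it does so along
    the whole ray from z to infinity, because P is locally injective at the
    values of phi. At infinity this forces u = 1. *)
Lemma phi_rotation z u : r0 < normc z -> u ^+ n = 1 -> phi z = phi (u * z) -> u = 1.
Proof.
move=> zr un phiu; have z0 : 0 < normc z by apply: le_lt_trans zr.
have u1 : normc u = 1.
  by apply/eqP; rewrite -(@pexpr_eq1 _ _ n)// ?normc_ge0// -normcX un normc1.
have tn (t : R) : 1 <= t -> normc (t%:C%C * z) = t * normc z /\
    normc (u * (t%:C%C * z)) = t * normc z.
  by move=> t1; rewrite !normcM u1 mul1r normc_real ger0_norm//; lra.
have tr (t : R) : 1 <= t -> r0 < t * normc z.
  by move=> t1; rewrite (lt_le_trans zr)// ler_peMl ?normc_ge0.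
have cont (f : C -> C) (t e : R) : {for f (t%:C%C * z), continuous phi} ->
    (forall x y, f x - f y = f (x - y)) -> (forall x, normc (f x) = normc x) -> 0 < e ->
    exists2 d : R, 0 < d & forall t' : R, `|t' - t| < d ->
      normc (phi (f (t'%:C%C * z)) - phi (f (t%:C%C * z))) < e.
  move=> /continuous_normcP fc fl fn e0; have e2 : 0 < e / 2 by rewrite divr_gt0.
  have [d d0 dh] := fc _ e2; exists (d / normc z); first by rewrite divr_gt0.
  move=> t' t't; apply: le_lt_trans (dh _ _) _; last by lra.
  by rewrite fl fn -mulrBl -rmorphB normcM normc_real -ltr_pdivlMr.
have all (t : R) : 1 <= t -> phi (t%:C%C * z) = phi (u * (t%:C%C * z)).
  move=> t1; apply: (@locally_constant_segment (fun t => phi (t%:C%C * z) = phi (u * (t%:C%C * z))) 1 t) => //.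
    move=> s /andP[s1 _]; have [ns nus] := tn s s1; have sr := tr s s1.
    have c1 : {for s%:C%C * z, continuous phi} by apply: phi_cont; rewrite ns.
    have c2 : {for u * (s%:C%C * z), continuous phi} by apply: phi_cont; rewrite nus.
    have f1 := cont id s; have f2 := cont (fun x => u * x) s.
    have fl2 x y : u * x - u * y = u * (x - y) by rewrite mulrBr.
    have fn2 x : normc (u * x) = normc x by rewrite normcM u1 mul1r.
    have [E|E] := eqVneq (phi (s%:C%C * z)) (phi (u * (s%:C%C * z))).
      have [|d d0 dh] := @poly_locally_injective (phi (s%:C%C * z)).
        by apply: phi_not_critical; rewrite ns.
      have [d1 d10 h1] := f1 d c1 (fun _ _ => erefl) (fun _ => erefl) d0.
      have [d2 d20 h2] := f2 d c2 fl2 fn2 d0.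
      exists (Num.min d1 d2); first by rewrite lt_min d10.
      move=> t' /andP[t'1 _]; rewrite lt_min => /andP[/h1 k1 /h2 k2]; split => // _.
      have [nt' nut'] := tn t' t'1; have t'r := tr t' t'1.
      apply: dh => //; first by rewrite E.
      by rewrite !phi_eq ?nt' ?nut'// (exprMn _ u) un mul1r.
    pose d := normc (phi (s%:C%C * z) - phi (u * (s%:C%C * z))) / 2.
    have d0 : 0 < d by rewrite divr_gt0// normc_gt0 subr_eq0.
    have [d1 d10 h1] := f1 d c1 (fun _ _ => erefl) (fun _ => erefl) d0.
    have [d2 d20 h2] := f2 d c2 fl2 fn2 d0.
    exists (Num.min d1 d2); first by rewrite lt_min d10.
    move=> t' _; rewrite lt_min => /andP[/h1 k1 /h2 k2]; split => [E'|]; last first.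
      by move/eqP: E.
    exfalso; rewrite -E' in k2.
    have := le_normcB_trans (phi (s%:C%C * z)) (phi (t'%:C%C * z)) (phi (u * (s%:C%C * z))).
    by rewrite normcB /= in k1; rewrite leNgt; move/negP; apply; rewrite /d in k1 k2; lra.
  by rewrite rmorph1 !mul1r.
apply/eqP; rewrite -subr_eq0 -normc_eq0 eq_le normc_ge0 andbT.
apply/ler_addgt0Pr => e e0; rewrite add0r; have e2 : 0 < e / 2 by rewrite divr_gt0.
have [M hM] : exists M : R, forall z, M < normc z -> normc (phi z / z - 1) <= e / 2.
  by have /cvg_normcP /(_ _ e2) := phi_lim.
pose t := Num.max 1 (M / normc z + 1).
have t1 : 1 <= t by rewrite le_max lexx.
have tM : M < t * normc z.
  by rewrite -ltr_pdivrMr// /t lt_max ltrDl ltr01 orbT.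
have [nt nut] := tn t t1.
have tz0 : t%:C%C * z != 0 by rewrite -normc_gt0 nt mulr_gt0//; lra.
have un0 : u != 0 by rewrite -normc_gt0 u1.
have k1 : normc (phi (t%:C%C * z) / (t%:C%C * z) - 1) <= e / 2 by apply: hM; rewrite nt.
have k2 : normc (phi (u * (t%:C%C * z)) / (u * (t%:C%C * z)) - 1) <= e / 2.
  by apply: hM; rewrite nut.
rewrite -all// in k2; set b := t%:C%C * z in tz0 k1 k2 *; set a := phi b in k1 k2 *.
rename tz0 into b0; clear nt nut; clearbody a b.
have E : a / b - u = u * (a / (u * b) - 1) by field; rewrite b0 un0.
have k3 : normc (a / b - u) <= e / 2 by rewrite E normcM u1 mul1r.
have -> : u - 1 = (a / b - 1) - (a / b - u) by ring.
by rewrite [e]splitr (le_trans (le_normcD _ _))// normcN lerD.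
Qed.

Lemma phi_inj z w : r0 < normc z -> r0 < normc w -> phi z = phi w -> z = w.
Proof.
move=> zr wr zw; have z0 : z != 0 by rewrite -normc_gt0 (le_lt_trans r0_ge0).
have E : z ^+ n = w ^+ n by rewrite -!phi_eq// zw.
have h := @phi_rotation z (w / z) zr.
by rewrite -[w](divfK z0) h ?mul1r ?divfK// expr_div_n -E divff// expf_neq0.
Qed.

(** By injectivity, the values of phi at the n-th roots z of P(w) are n distinct
    roots of P - P(w), that is all of them. *)
Lemma phi_surj w r : r0 < r -> normc P.[w] = r ^+ n ->
  exists2 z, normc z = r & phi z = w.
Proof.
move=> r0r wr; have r_gt0 : 0 < r by apply: le_lt_trans r0r.
pose v := P.[w]; pose z := n.-root v.
have zn : z ^+ n = v by rewrite /z rootCK.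
have nz : normc z = r.
  by apply/eqP; rewrite -(@eqrXn2 _ n)// ?normc_ge0 ?(ltW r_gt0)// -normcX zn wr.
have wN := omega_prim R n_gt0.
pose rs := [seq phi (z * omega R n ^+ j) | j <- iota 0 n].
have zj j : r0 < normc (z * omega R n ^+ j) by rewrite normc_node nz.
have zn0 : z != 0 by rewrite -normc_gt0 nz.
have urs : uniq rs.
  rewrite map_inj_in_uniq ?iota_uniq// => i j; rewrite !mem_iota /= !add0n => ilt jlt.
  move=> /(phi_inj (zj i) (zj j)) /(mulfI zn0) /eqP.
  by rewrite (eq_prim_root_expr wN) !modn_small// => /eqP.
pose p := P - v%:P.
have sp : size p = n.+1.
  by rewrite /p size_polyDl ?P_size// size_polyN (leq_ltn_trans (size_polyC_leq1 _)).
have p0 : p != 0 by rewrite -size_poly_eq0 sp.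
have rp x : P.[x] = v -> root p x by move=> xv; rewrite /root /p !hornerE xv subrr.
have [wrs|wrs] := boolP (w \in rs).
  have /mapP[j _ ->] := wrs; exists (z * omega R n ^+ j) => //.
  by rewrite normc_node.
have : (size (w :: rs) < size p)%N.
  apply: max_poly_roots => //=; last by rewrite wrs.
  rewrite rp//=; apply/allP => _ /mapP[j _ ->]; apply: rp.
  by rewrite phi_eq// exprMn zn -exprM mulnC exprM (prim_expr_order wN) expr1n mulr1.
by rewrite sp /= size_map size_iota ltnn.
Qed.

End Uniformization.

(** * Length of the image of a circle *)

Section CircleImage.
Variable R : realType.
Local Notation C := R[i].
Local Notation H1 := (@hausdorff1 R).
Implicit Types (z w : C).

Lemma H1_lipschitz_image (g : R -> C) (a b L : R) : a <= b -> 0 < L ->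
  (forall t u, a <= t <= b -> a <= u <= b -> normc (g t - g u) <= L * `|t - u|) ->
  (H1 (g @` `[a, b]) <= (L * (b - a))%:E)%E.
Proof.
move=> ab L0 gL.
pose S x := [set t | a <= t <= b /\ g t = x]; pose f x : C := (get (S x))%:C%C.
have fS x : (g @` `[a, b]) x -> S x (get (S x)).
  by move=> [t tab <-]; apply: (getPex (P := S (g t))); exists t; split => //; move: tab; rewrite /= in_itv.
pose B := [set z : C | exists2 x, x \in `[a, b] & z = x%:C%C].
rewrite EFinM; apply: (@le_trans _ _ (L%:E * H1 B)%E); last first.
  rewrite lee_pmul2l//; apply: (@H1_real_segment_le _ a); first by rewrite subr_ge0.
  by move=> z; rewrite addrC subrK.
apply: (@H1_expand _ f _ _ _ 1) => // [x /fS[xab _]|x y /fS[xab xE] /fS[yab yE] _].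
  by exists (get (S x)) => //; rewrite in_itv.
rewrite /f -rmorphB normc_real; move: (gL _ _ xab yab).
by rewrite xE yE.
Qed.

Lemma H1_expanding_image (g : R -> C) (a b c : R) : a <= b -> 0 < c ->
  (forall t u, a <= t <= b -> a <= u <= b -> c * `|t - u| <= normc (g t - g u)) ->
  ((c * (b - a))%:E <= H1 (g @` `[a, b]))%E.
Proof.
move=> ab c0 gc; rewrite EFinM -lee_pdivlMl//.
apply: le_trans (H1_real_segment_ge ab) _.
apply: (@H1_expand _ (fun z => g (complex.Re z)) _ _ _ 1) => //; first by rewrite invr_gt0.
  by move=> _ [t tab <-]; exists t.
move=> _ _ [t tab <-] [u uab <-] _; rewrite -rmorphB normc_real /=.
rewrite ler_pdivlMl//; apply: gc.
  by move: tab; rewrite /= in_itv.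
by move: uab; rewrite /= in_itv.
Qed.

Lemma EFin_sum_le (N : nat) (f : 'I_N -> R) (g : 'I_N -> \bar R) :
  (forall i, (f i)%:E <= g i)%E -> ((\sum_i f i)%:E <= \sum_i g i)%E.
Proof. by move=> fg; rewrite -sumEFin; apply: lee_sum. Qed.

Lemma normc_expiB (a b : R) : normc (expi a - expi b) = normc (expi (a - b) - 1).
Proof.
by rewrite -[RHS]mul1r -(normc_expi b) -normcM mulrBr mulr1 -expiD [b + _]addrC subrK.
Qed.

Section Image.
Variables (f f' : C -> C) (r : R).
Hypothesis r_gt0 : 0 < r.
Hypothesis f_deriv : forall z, normc z = r -> strict_deriv f z (f' z).
Hypothesis f_inj : forall z w, normc z = r -> normc w = r -> f z = f w -> z = w.

Let g (t : R) : C := f (r%:C%C * expi t).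

Lemma normc_circle t : normc (r%:C%C * expi t) = r.
Proof. by rewrite normcM normc_expi mulr1 normc_real gtr0_norm. Qed.

Lemma continuous_expi_scale : continuous (fun t : R => r%:C%C * expi t : C).
Proof.
move=> t; apply/cvg_normcP => e e0.
have e2 : 0 < e / r by rewrite divr_gt0.
have [d d0 h] := expi_chord (@ltr01 R).
have key u : `|u - t| < Num.min d (e / r / 2) -> normc (r%:C%C * expi u - r%:C%C * expi t) <= e.
  rewrite lt_min => /andP[ud ue].
  rewrite -mulrBr normcM normc_real gtr0_norm// mulrC -ler_pdivlMr// normc_expiB.
  have := h _ ud; rewrite ler_norml; lra.
apply/nbhs_ballP; exists (Num.min d (e / r / 2)) => [|u].
  by rewrite /= lt_min d0 divr_gt0.
by move=> ut; apply: key; rewrite distrC.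
Qed.

Lemma continuous_circle_param : continuous g.
Proof.
move=> t; apply: (@continuous_comp R C C); first exact: continuous_expi_scale.
by apply: strict_deriv_continuous (f_deriv _); apply: normc_circle.
Qed.

(** A positive continuous function on a compact set of pairs of parameters: on
    it, the angles differ modulo 2 pi. *)
Lemma circle_param_separated (eta : R) : 0 < eta ->
  exists2 d0 : R, 0 < d0 & forall t u, 0 <= t <= 2 * pi -> 0 <= u <= 2 * pi ->
    eta <= `|t - u| <= 2 * pi - eta -> d0 <= normc (g t - g u).
Proof.
move=> eta0; pose I : set R := `[0, 2 * pi]%classic.
pose dist (p : R * R) := `|p.1 - p.2|.
have distc : continuous dist.
  move=> p; apply: (@continuous_comp (R * R)%type R R (fun p => p.1 - p.2) Num.norm).
    by apply: cvgB; [exact: cvg_fst|exact: cvg_snd].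
  exact: norm_continuous.
pose K : set (R * R) := (I `*` I) `&` (dist @^-1` [set x | eta <= x] `&`
  dist @^-1` [set x | x <= 2 * pi - eta]).
have cK : compact K.
  apply: (@subclosed_compact _ _ (I `*` I)); last by move=> p [].
    apply: closedI; last first.
      by apply: closedI; apply: preimage_closed.
    apply: compact_closed; first exact: norm_hausdorff.
    by apply: compact_setX; apply: segment_compact.
  by apply: compact_setX; apply: segment_compact.
pose G (p : R * R) := normc (g p.1 - g p.2).
have Gc : {within K, continuous G}.
  apply: continuous_subspaceT => p.
  apply: (@continuous_comp (R * R)%type C R (fun p => g p.1 - g p.2) (@normc R)).
    apply: (@cvgB C C).
      by apply: (cvg_comp _ _ cvg_fst); apply: continuous_circle_param.
    by apply: (cvg_comp _ _ cvg_snd); apply: continuous_circle_param.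
  exact: continuous_normc.
have [K0|K0] := pselect (K !=set0); last first.
  exists 1 => // t u ti ui /andP[h1 h2]; case: K0; exists (t, u).
  by split; split => //=; rewrite in_itv.
have [[t u] /set_mem[[/= ti ui] [/= h1 h2]] tumin] := compact_EVT_min K0 cK Gc.
exists (G (t, u)) => [|t' u' ti' ui' /andP[h1' h2']]; last first.
  by apply: (tumin (t', u')); apply/mem_set; split; split => //=; rewrite in_itv.
rewrite /G /= normc_gt0 subr_eq0; apply/eqP => gtu.
have /eqP := f_inj (normc_circle t) (normc_circle u) gtu.
have r0 : r%:C%C != 0 :> C by rewrite -normc_gt0 normc_real normr_gt0 gt_eqF.
rewrite (inj_eq (mulfI r0)) -subr_eq0 -normc_eq0.
have [tu|ut] := lerP u t.
  rewrite normc_expiB normc_eq0 subr_eq0 => /eqP h.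
  have hh := @expi_neq1 R (t - u).
  move: h1 h2; rewrite /dist /= ger0_norm ?subr_ge0// => h1 h2.
  have /hh : 0 < t - u < 2 * pi by apply/andP; split; lra.
  by rewrite h eqxx.
rewrite normcB normc_expiB normc_eq0 subr_eq0 => /eqP h.
have hh := @expi_neq1 R (u - t).
move: h1 h2; rewrite /dist /= distrC ger0_norm ?subr_ge0 ?(ltW ut)// => h1 h2.
have /hh : 0 < u - t < 2 * pi by apply/andP; split; lra.
by rewrite h eqxx.
Qed.

(** On an arc between consecutive nodes, f is close to an affine map, and the
    circle is close to its chord. *)
Lemma circle_param_arc (e : R) : 0 < e -> e < 1 -> exists N0, forall N j t u, (N0 < N)%N ->
  let h := 2 * pi / N%:R in
  j%:R * h <= t <= j%:R * h + h -> j%:R * h <= u <= j%:R * h + h ->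
  (normc (f' (r%:C%C * omega R N ^+ j)) - e) * (r * (1 - e)) * `|t - u| <= normc (g t - g u) /\
  normc (g t - g u) <= (normc (f' (r%:C%C * omega R N ^+ j)) + e) * (r * (1 + e)) * `|t - u|.
Proof.
move=> e0 e1.
have [d d0 hd] := strict_deriv_uniform (@circle_compact R r) f_deriv e0.
have [d1 d10 hd1] := expi_chord e0.
have dr : 0 < Num.min d1 (d / r / 2) by rewrite lt_min d10 !divr_gt0.
have [N0 hN] := omega_small_step dr.
exists N0 => N j t u NN h; have := hN N NN; rewrite -/h lt_min => /andP[hd1' hdr].
have N0' : N%:R != 0 :> R by rewrite pnatr_eq0 -lt0n (leq_ltn_trans _ NN).
move=> tj uj; pose z := r%:C%C * omega R N ^+ j.
have zE : z = r%:C%C * expi (j%:R * h).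
  by rewrite /z /omega -/h mulr_natl expiMn.
have nz : normc z = r by rewrite zE normc_circle.
have chord x y : `|x - y| <= h -> r * (1 - e) * `|x - y| <=
    normc (r%:C%C * expi x - r%:C%C * expi y : C) <= r * (1 + e) * `|x - y|.
  move=> xy; rewrite -mulrBr normcM normc_real (gtr0_norm r_gt0) normc_expiB -!(mulrA r).
  rewrite !(ler_pM2l r_gt0).
  have := hd1 (x - y) (le_lt_trans xy hd1'); rewrite ler_norml; lra.
have near x : j%:R * h <= x <= j%:R * h + h -> normc (r%:C%C * expi x - z) < d.
  move=> xj; have xjh : `|x - j%:R * h| <= h by rewrite ler_norml; lra.
  rewrite zE; have /andP[_ le] := chord _ _ xjh; apply: (le_lt_trans le).
  apply: (@le_lt_trans _ _ (r * 2 * h)).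
    by apply: ler_pM => //; rewrite ?mulr_ge0 ?ler_pM2l// ?(ltW r_gt0)//; lra.
  have -> : r * 2 * h = h * 2 * r by ring.
  by rewrite -(ltr_pdivlMr _ _ r_gt0) -ltr_pdivlMr.
have tuh : `|t - u| <= h by rewrite ler_norml; lra.
have /andP[c1 c2] := chord t u tuh.
have := hd z (r%:C%C * expi t) (r%:C%C * expi u) nz (near t tj) (near u uj).
rewrite -/(g t) -/(g u) -/z; set D := _ - r%:C%C * expi u in c1 c2 * => hh.
have a0 : 0 <= normc (f' z) by exact: normc_ge0.
have n1 : normc (f' z * D) <= normc (g t - g u) + e * normc D.
  rewrite -[f' z * D](subrK (g t - g u)) addrC.
  by rewrite (le_trans (le_normcD _ _))// lerD2l normcB.
have n2 : normc (g t - g u) <= normc (f' z * D) + e * normc D.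
  rewrite -[g t - g u](subrK (f' z * D)) addrC.
  by rewrite (le_trans (le_normcD _ _))// lerD2l.
rewrite normcM in n1 n2; rewrite -!(mulrA (_ + e)) -!(mulrA (_ - e)).
have D0 := normc_ge0 D; split; last first.
  apply: (le_trans n2); rewrite -mulrDl; apply: ler_wpM2l => //; lra.
have [neg|pos] := lerP (normc (f' z) - e) 0.
  apply: (le_trans _ (normc_ge0 _)); rewrite mulr_le0_ge0// !mulr_ge0 ?(ltW r_gt0)//; lra.
apply: (@le_trans _ _ ((normc (f' z) - e) * normc D)); last by rewrite mulrBl; lra.
by apply: ler_wpM2l => //; apply: ltW.
Qed.

Lemma grid_cell N (h x : R) : (0 < N)%N -> 0 <= x <= N%:R * h ->
  exists2 j, (j < N)%N & j%:R * h <= x <= j%:R * h + h.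
Proof.
elim: N => // -[|N] IH _ /andP[x0 xN].
  by exists 0%N => //; rewrite mul0r add0r x0/=; rewrite mul1r in xN.
have [le|lt] := lerP x (N.+1%:R * h).
  by have [|j jN xj] := IH isT; [rewrite x0|exists j => //; apply: ltnW].
exists N.+1 => //; rewrite ltW//=; apply: (le_trans xN).
by rewrite -[N.+2%:R]natr1 mulrDl mul1r.
Qed.

(** The images of the N arcs between consecutive nodes cover the curve. If the
    arcs are shortened by the fraction ep, their images are separated and their
    lengths add up. *)
Lemma H1_circle_image (e B : R) : 0 < e -> 0 < B ->
  (forall z, normc z = r -> normc (f' z) <= B) ->
  exists N0, forall N S, (N0 < N)%N ->
  S = 2 * pi * r * ((\sum_(j < N) normc (f' (r%:C%C * omega R N ^+ j))) / N%:R) ->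
  ((S - e)%:E <= H1 (f @` [set z | normc z = r]) <= (S + e)%:E)%E.
Proof.
move=> e0 B0 hB.
(* The errors in both bounds are at most ep * D. *)
pose D := 2 * pi * r * (2 * B + 2).
have pi0 := pi_gt0 R.
have p2 : 0 < 2 * pi * r by rewrite !mulr_gt0.
have D0 : 0 < D by rewrite mulr_gt0//; lra.
pose ep := Num.min (1 / 2) (e / D).
have ep0 : 0 < ep by rewrite lt_min !divr_gt0.
have ep12 : ep <= 1 / 2 by rewrite ge_min lexx.
have epD : ep * D <= e by rewrite -ler_pdivlMr// ge_min lexx orbT.
have ep1 : ep < 1 by lra.
have [N0 hN] := circle_param_arc ep0 ep1.
exists N0 => N S NN SE0; have N0' : (0 < N)%N by apply: leq_ltn_trans NN.
have NR : 0 < N%:R :> R by rewrite ltr0n.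
pose h : R := 2 * pi / N%:R; have h0 : 0 < h by rewrite divr_gt0// mulr_gt0.
have hNE : N%:R * h = 2 * pi by rewrite mulrC divfK// gt_eqF.
pose a j := normc (f' (r%:C%C * omega R N ^+ j)).
have a0 j : 0 <= a j by exact: normc_ge0.
have aB j : a j <= B by apply: hB; rewrite normc_node normc_real gtr0_norm.
have arc j t u := hN N j t u NN; rewrite -/h in arc.
have SE : S = \sum_(j < N) a j * (r * h).
  by rewrite -mulr_suml SE0 /h /a; field; rewrite gt_eqF.
have sumC (x : R) : \sum_(j < N) x * (r * h) = x * (2 * pi * r).
  by rewrite sumr_const card_ord -[_ *+ N]mulr_natr -hNE; ring.
have SB : S <= B * (2 * pi * r).
  rewrite SE -sumC; apply: ler_sum => j _; rewrite ler_wpM2r//.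
  by rewrite mulr_ge0 ?ltW.
have S0 : 0 <= S.
  rewrite SE; apply: sumr_ge0 => j _; apply: mulr_ge0 => //.
  by apply: mulr_ge0; apply: ltW.
pose E := f @` [set z | normc z = r].
have p2B : 0 <= B * (2 * pi * r) by rewrite mulr_ge0 ?ltW.
clear SE0; apply/andP; split.
- pose A j := g @` `[j%:R * h, j%:R * h + (1 - ep) * h].
  have eph : 0 < ep * h by rewrite mulr_gt0.
  have [d0 d00 hd] := circle_param_separated eph.
  have sub x j : (j < N)%N -> j%:R * h <= x <= j%:R * h + (1 - ep) * h ->
      [/\ 0 <= x, x <= 2 * pi - ep * h & j%:R * h <= x <= j%:R * h + h].
    move=> jN /andP[x1 x2]; have j0 : 0 <= j%:R * h by rewrite mulr_ge0 ?(ltW h0).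
    have jN' : j%:R * h + h <= 2 * pi.
      by rewrite -hNE -{2}[h]mul1r -mulrDl natr1 ler_pM2r// ler_nat.
    rewrite mulrBl mul1r in x2; split; [lra|lra|apply/andP; split; lra].
  have order i j x y : (i < j)%N -> (j < N)%N -> j%:R * h <= y ->
      x <= i%:R * h + (1 - ep) * h -> ep * h <= y - x.
    move=> ij jN y1 x2; have : i%:R * h + h <= j%:R * h.
      by rewrite -{2}[h]mul1r -mulrDl natr1 ler_pM2r// ler_nat.
    rewrite mulrBl mul1r in x2; lra.
  have sep i j x y : (i < N)%N -> (j < N)%N -> i != j -> A i x -> A j y ->
      d0 <= normc (x - y).
    move=> iN jN ij [t + <-] [u + <-]; rewrite /= !in_itv /= => ti uj.
    have [t0 t2 _] := sub _ _ iN ti; have [u0 u2 _] := sub _ _ jN uj.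
    apply: hd; [apply/andP; split; lra|apply/andP; split; lra|].
    move: ij; rewrite neq_ltn => /orP[ij|ji].
      have := order i j t u ij jN; case/andP: ti => _ ti2; case/andP: uj => uj1 _.
      move=> /(_ uj1 ti2) tu; rewrite distrC ger0_norm; last by lra.
      by apply/andP; split; lra.
    have := order j i u t ji iN; case/andP: ti => ti1 _; case/andP: uj => _ uj2.
    move=> /(_ ti1 uj2) tu; rewrite ger0_norm; last by lra.
    by apply/andP; split; lra.
  have AE : \bigcup_(j in [set j | (j < N)%N]) A j `<=` E.
    by move=> _ [j /= _ [t _ <-]]; exists (r%:C%C * expi t) => //; apply: normc_circle.
  apply: le_trans (H1_mono AE); apply: le_trans (H1_bigU_separated d00 sep).
  apply: (@le_trans _ _ (\sum_(j < N) ((a j - ep) * (r * (1 - ep)) * ((1 - ep) * h)))%:E).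
    rewrite lee_fin (eq_bigr (fun j : 'I_N => (1 - ep) ^+ 2 * (a j * (r * h)) - (1 - ep) ^+ 2 * (ep * (r * h)))); last first.
      by move=> j _; ring.
    rewrite sumrB -2!mulr_sumr -SE sumC.
    have q1 : (1 - ep) ^+ 2 <= 1 by rewrite exprn_ile1//; lra.
    have q2 : (1 - ep) ^+ 2 = 1 - 2 * ep + ep ^+ 2 by ring.
    have q3 : (1 - ep) ^+ 2 * (ep * (2 * pi * r)) <= ep * (2 * pi * r).
      by rewrite ler_piMl// mulr_ge0 ?(ltW ep0) ?(ltW p2).
    have q4 : 0 <= ep ^+ 2 * S by rewrite mulr_ge0 ?sqr_ge0.
    have q5 : ep * S <= ep * (B * (2 * pi * r)) by rewrite ler_wpM2l ?(ltW ep0).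
    have q6 : 0 <= ep * (2 * pi * r) by rewrite mulr_ge0 ?(ltW ep0) ?(ltW p2).
    rewrite q2 mulrDl mulrBl mul1r -q2; rewrite /D in epD; lra.
  apply: EFin_sum_le => j; have jN := ltn_ord j.
  have [neg|pos] := lerP (a j - ep) 0.
    apply: le_trans (H1_ge0 _); rewrite lee_fin -mulrA mulr_le0_ge0//.
    by rewrite !mulr_ge0 ?(ltW r_gt0) ?(ltW h0)//; lra.
  have -> : (1 - ep) * h = j%:R * h + (1 - ep) * h - j%:R * h by ring.
  apply: H1_expanding_image.
  - by rewrite lerDl mulr_ge0 ?(ltW h0)//; lra.
  - by rewrite !mulr_gt0//; lra.
  - move=> t u /(sub _ _ jN)[_ _ tj] /(sub _ _ jN)[_ _ uj].
    by have [] := arc j t u tj uj.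
- pose A j := g @` `[j%:R * h, j%:R * h + h].
  have EA : E `<=` [set x | exists2 j, j \in iota 0 N & A j x].
    move=> _ [z /= zr <-]; have zr0 : z != 0 by rewrite -normc_gt0 zr.
    have [u u1 zu] := polarE zr0; have [t t2 ut] := expi_polar u1.
    have [|j jN tj] := @grid_cell N h t N0'; first by rewrite hNE.
    exists j; first by rewrite mem_iota.
    by exists t; [rewrite /= in_itv|rewrite /g zu zr ut].
  apply: le_trans (H1_mono EA) _; apply: le_trans (H1_bigU _ _) _.
  apply: (@le_trans _ _ (\sum_(j <- iota 0 N) ((a j + ep) * (r * (1 + ep)) * h))%:E).
    rewrite -sumEFin; apply: lee_sum => j _.
    have -> : h = j%:R * h + h - j%:R * h by ring.
    apply: H1_lipschitz_image.
    - by rewrite lerDl ltW.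
    - by rewrite !mulr_gt0// ltr_wpDl.
    - by move=> t u tj uj; have [] := arc j t u tj uj.
  rewrite lee_fin.
  have -> : iota 0 N = index_iota 0 N by rewrite /index_iota subn0.
  rewrite big_mkord (eq_bigr (fun j : 'I_N => (1 + ep) * (a j * (r * h)) + (1 + ep) * (ep * (r * h)))); last first.
    by move=> j _; ring.
  rewrite big_split -2!mulr_sumr -SE sumC /=.
  have q3 : (1 + ep) * (ep * (2 * pi * r)) <= 2 * (ep * (2 * pi * r)).
    by apply: ler_wpM2r; [apply: mulr_ge0; apply: ltW|clear - ep12; lra].
  have q5 : ep * S <= ep * (B * (2 * pi * r)) by rewrite ler_wpM2l ?(ltW ep0).
  have q6 : 0 <= ep * (B * (2 * pi * r)) by rewrite mulr_ge0 ?(ltW ep0).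
  have epD' : ep * (B * (2 * pi * r)) + ep * (B * (2 * pi * r)) + 2 * (ep * (2 * pi * r)) <= e.
    by apply: le_trans epD; rewrite /D le_eqVlt; apply/orP; left; apply/eqP; ring.
  have -> : (1 + ep) * S = S + ep * S by ring.
  by clear - epD' q3 q5 q6; lra.
Qed.

End Image.
End CircleImage.

(** * Level sets near a critical level *)

Section LevelSets.
Variable R : realType.
Local Notation C := R[i].
Local Notation H1 := (@hausdorff1 R).
Implicit Types (x y z : C) (rs : seq C).

Lemma continuous_normcB z0 : continuous (fun z => normc (z - z0)).
Proof.
move=> z; apply: (iffRL (@cvgrPdistC_le _ _ _ (nbhs z) _ (fun z => normc (z - z0)) _)) => e e0.
apply/nbhs_normcP; exists e => // x xz; apply: le_trans (ler_dist_normc _ _) _.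
by rewrite opprB addrA subrK ltW.
Qed.

(** Chain the local estimate given by the derivative along the segment from y
    to x, which stays in the disc. *)
Lemma mean_value_disc (f f' : C -> C) z0 (r c : R) :
  (forall z, normc (z - z0) <= r -> strict_deriv f z (f' z)) ->
  (forall z, normc (z - z0) <= r -> normc (f' z) <= c) ->
  forall x y, normc (x - z0) <= r -> normc (y - z0) <= r ->
  normc (f x - f y) <= c * normc (x - y).
Proof.
move=> fd f'c x y xr yr; have [->|xy] := eqVneq x y.
  by rewrite !subrr normc0 mulr0.
have xy0 : 0 < normc (x - y) by rewrite normc_gt0 subr_eq0.
pose K := [set z : C | normc (z - z0) <= r].
have cK : compact K.
  apply: (@compact_le_normc _ _ (normc z0 + r)) => [|z zr].
    apply: (@preimage_closed _ _ (fun z => normc (z - z0)) [set t | t <= r]); last exact: closed_le.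
    by move=> z _; apply: continuous_normcB.
  by have := ler_sub_normc z z0; rewrite /K /= in zr; lra.
apply/ler_addgt0Pr => e e0; have e1 : 0 < e / normc (x - y) by rewrite divr_gt0.
have [d d0 h] := strict_deriv_uniform cK fd e1.
pose g (t : R) := f (y + t%:C%C * (x - y)).
have gE : f x - f y = g 1 - g 0.
  by rewrite /g rmorph1 rmorph0 mul1r mul0r addr0 [y + _]addrC subrK.
have inK t : 0 <= t <= 1 -> K (y + t%:C%C * (x - y)).
  move=> /andP[t0 t1]; rewrite /K /=.
  have -> : y + t%:C%C * (x - y) - z0 = t%:C%C * (x - z0) + (1 - t)%:C%C * (y - z0).
    by rewrite rmorphB rmorph1; ring.
  apply: le_trans (le_normcD _ _) _; rewrite !normcM !normc_real !ger0_norm ?subr_ge0//.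
  have := ler_wpM2l t0 xr; have := ler_wpM2l (_ : 0 <= 1 - t) yr.
  by rewrite subr_ge0 => /(_ t1); lra.
have -> : c * normc (x - y) + e = (c + e / normc (x - y)) * normc (x - y) * (1 - 0).
  by rewrite subr0 mulr1 mulrDl divfK ?gt_eqF.
rewrite gE; apply: (@small_scale_lipschitz R g 0 1 _ (d / normc (x - y))) => //.
  by rewrite divr_gt0.
move=> s t s01 t01 st; pose zt := y + t%:C%C * (x - y).
have E : y + s%:C%C * (x - y) - zt = (s - t)%:C%C * (x - y).
  by rewrite rmorphB /zt; ring.
have nE : normc (y + s%:C%C * (x - y) - zt) = `|s - t| * normc (x - y).
  by rewrite E normcM normc_real.
have := h zt (y + s%:C%C * (x - y)) zt (inK t t01); rewrite subrr normc0 nE.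
rewrite -ltr_pdivlMr// => /(_ st d0) hh; rewrite /g -/zt.
rewrite -[f _ - f zt](subrK (f' zt * (y + s%:C%C * (x - y) - zt))).
apply: le_trans (le_normcD _ _) _.
have -> : (c + e / normc (x - y)) * normc (x - y) * `|s - t| =
   e / normc (x - y) * (`|s - t| * normc (x - y)) + c * (`|s - t| * normc (x - y)) by ring.
apply: lerD => //; rewrite normcM nE ler_wpM2r ?mulr_ge0 ?normc_ge0//.
exact/f'c/inK.
Qed.

Lemma normc_prod (rs : seq C) (f : C -> C) :
  normc (\prod_(a <- rs) f a) = \prod_(a <- rs) normc (f a).
Proof.
elim: rs => [|a rs IH]; first by rewrite !big_nil normc1.
by rewrite !big_cons normcM IH.
Qed.

(** Each factor x - a changes by a relative amount of at most k, and
    (1 + k) ^ m - 1 <= (2 ^ m - 1) k. *)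
Lemma prod_perturbation rs x y (k : R) : 0 <= k <= 1 ->
  (forall a, a \in rs -> normc (y - x) <= k * normc (x - a)) ->
  normc (\prod_(a <- rs) (y - a) - \prod_(a <- rs) (x - a)) <=
  (2 ^+ size rs - 1) * k * normc (\prod_(a <- rs) (x - a)).
Proof.
move=> /andP[k0 k1]; elim: rs => [|a rs IH] h.
  by rewrite !big_nil subrr normc0 expr0 subrr !mul0r.
have {}IH := IH (fun b bs => h b (mem_behead (s := a :: rs) bs)).
have ha := h a (mem_head _ _); rewrite !big_cons.
move: IH; set A' := \prod_(b <- rs) (y - b); set A := \prod_(b <- rs) (x - b) => IH.
have -> : (y - a) * A' - (x - a) * A = (y - x) * A' + (x - a) * (A' - A) by ring.
have p1 : 1 <= 2 ^+ size rs :> R by rewrite exprn_ege1// ler1n.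
have A'le : normc A' <= 2 ^+ size rs * normc A.
  have -> : A' = A + (A' - A) by ring.
  apply: le_trans (le_normcD _ _) _.
  have : (2 ^+ size rs - 1) * k * normc A <= (2 ^+ size rs - 1) * normc A.
    by rewrite ler_wpM2r ?normc_ge0// ler_piMr// subr_ge0.
  move: IH; rewrite !mulrBl mul1r; lra.
apply: le_trans (le_normcD _ _) _; rewrite !normcM.
have e1 : normc (y - x) * normc A' <= k * normc (x - a) * (2 ^+ size rs * normc A).
  by apply: ler_pM => //; exact: normc_ge0.
have e2 : normc (x - a) * normc (A' - A) <=
    normc (x - a) * ((2 ^+ size rs - 1) * k * normc A).
  by rewrite ler_wpM2l ?normc_ge0.
apply: (le_trans (lerD e1 e2)); rewrite /= exprS le_eqVlt; apply/orP; left; apply/eqP; ring.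
Qed.

Variables (n : nat) (P : {poly C}).
Hypothesis n_gt1 : (1 < n)%N.
Hypothesis P_monic : P \is monic.
Hypothesis P_size : size P = n.+1.

Lemma deriv_factor : exists2 rs, size rs = n.-1 &
  (forall x, root P^`() x = (x \in rs)) /\
  forall x, P^`().[x] = n%:R * \prod_(a <- rs) (x - a).
Proof.
have [rs rsE] := closed_field_poly_normal P^`().
have P0 : P != 0 by rewrite monic_neq0.
have n0 : (0 < n)%N by apply: ltnW.
have nC : n%:R != 0 :> C by rewrite pnatr_eq0 -lt0n.
have top : P^`()`_n.-1 = n%:R.
  rewrite coef_deriv prednK//.
  by move/monicP: P_monic; rewrite lead_coefE P_size /= => ->.
have sP' : size P^`() = n.
  apply/eqP; rewrite eqn_leq; apply/andP; split.
    by have := lt_size_deriv P0; rewrite P_size ltnS.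
  rewrite leqNgt; apply/negP => lt; move: nC; rewrite -top nth_default ?eqxx//.
  by rewrite -ltnS prednK.
have lc : lead_coef P^`() = n%:R by rewrite lead_coefE sP'.
have P'E x : P^`().[x] = n%:R * \prod_(a <- rs) (x - a).
  rewrite rsE lc hornerZ horner_prod; congr (_ * _); apply: eq_bigr => a _.
  by rewrite !hornerE.
exists rs; last split => // x.
  move: sP'; rewrite rsE lc size_scale// size_prod_XsubC => <-.
  by [].
by rewrite rsE lc rootZ// root_prod_XsubC.
Qed.

Lemma monic_factor : exists2 rs, size rs = n & forall x, P.[x] = \prod_(a <- rs) (x - a).
Proof.
have [rs rsE] := closed_field_poly_normal P.
move: rsE; rewrite (monicP P_monic) scale1r => rsE.
exists rs => [|x]; first by move: P_size; rewrite rsE size_prod_XsubC => -[].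
by rewrite rsE horner_prod; apply: eq_bigr => a _; rewrite !hornerE.
Qed.

(** ** Length near the critical points *)

(** Away from the critical points, at distance comparable to the distance to
    them, P is a small perturbation of an affine map. *)
Lemma poly_almost_affine rs x0 (rho : R) : size rs = n.-1 ->
  (forall x, P^`().[x] = n%:R * \prod_(a <- rs) (x - a)) ->
  0 < rho -> (forall a, a \in rs -> rho <= normc (x0 - a)) ->
  forall x y, normc (x - x0) <= rho / 2 ^+ n -> normc (y - x0) <= rho / 2 ^+ n ->
  normc (P.[x] - P.[y] - P^`().[x0] * (x - y)) <= normc P^`().[x0] / 2 * normc (x - y).
Proof.
move=> rs_size P'E rho0 rs_far.
pose k : R := (2 ^+ n)^-1.
have p2 : 0 < 2 ^+ n :> R by rewrite exprn_gt0.
have k01 : 0 <= k <= 1 by rewrite /k invr_ge0 exprn_ge0//= invf_le1// exprn_ege1// ler1n.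
have dP' z : normc (z - x0) <= rho * k ->
    normc (P^`().[z] - P^`().[x0]) <= normc P^`().[x0] / 2.
  move=> zx; rewrite !P'E -mulrBr !normcM -mulrA ler_wpM2l ?normc_ge0//.
  apply: (le_trans (prod_perturbation k01 _)) => [a ars|].
    apply: (le_trans zx); rewrite mulrC ler_wpM2l ?rs_far//.
    by case/andP: k01.
  rewrite mulrC ler_wpM2l ?normc_ge0// rs_size /k.
  have n2 : 2 ^+ n = 2 * 2 ^+ n.-1 :> R by rewrite -exprS prednK// ltnW.
  rewrite ler_pdivrMr// n2 mulKf//.
  by rewrite gerBl.
move=> x y xr yr.
pose G z := P.[z] - P^`().[x0] * z.
have -> : P.[x] - P.[y] - P^`().[x0] * (x - y) = G x - G y by rewrite /G; ring.
apply: (@mean_value_disc G (fun z => P^`().[z] - P^`().[x0]) x0 (rho / 2 ^+ n)) => // z zr.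
have := strict_derivB (@strict_deriv_horner R P z)
  (strict_derivM (@strict_deriv_cst R P^`().[x0] z) (@strict_deriv_id R z)).
by rewrite mul0r add0r mulr1.
Qed.

(** P expands distances in this ball by at least |P'(x0)| / 2, and it maps the
    level set into the part of a circle in a ball of radius 3/2 |P'(x0)| rho / 2 ^ n.
    The factor |P'(x0)| cancels, so the bound is uniform. *)
Lemma H1_level_ball rs x0 (l rho : R) : size rs = n.-1 ->
  (forall x, P^`().[x] = n%:R * \prod_(a <- rs) (x - a)) ->
  0 < rho -> (forall a, a \in rs -> rho <= normc (x0 - a)) ->
  (H1 [set x | normc P.[x] = l /\ (normc (x - x0) <= rho / 2 ^+ n)%R] <=
    (48 * (rho / 2 ^+ n))%:E)%E.
Proof.
move=> rs_size P'E rho0 rs_far; have aff := poly_almost_affine rs_size P'E rho0 rs_far.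
set r := rho / 2 ^+ n in aff *; set p := normc P^`().[x0] in aff *.
have r0 : 0 < r by rewrite divr_gt0 ?exprn_gt0.
have p0 : 0 < p.
  rewrite /p P'E normcM (normc_nat R) mulr_gt0 ?ltr0n ?(ltnW n_gt1)//.
  rewrite normc_prod big_seq prodr_gt0// => a ars.
  by apply: lt_le_trans (rs_far a ars).
pose B := [set v : C | normc v = l /\ (normc (v - P.[x0]) <= 3 / 2 * p * r)].
apply: (@le_trans _ _ ((2 / p)%:E * H1 B)%E).
  apply: (@H1_expand _ (horner P) _ _ _ 1) => //; first by rewrite divr_gt0.
    move=> x [xl xr]; split => //.
    have x0r : normc (x0 - x0) <= r by rewrite subrr normc0 ltW.
    have h := aff x x0 xr x0r.
    rewrite -[P.[x] - P.[x0]](subrK (P^`().[x0] * (x - x0))).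
    apply: (le_trans (le_normcD _ _)); rewrite normcM -/p.
    have h2 := ler_wpM2l (ltW p0) xr; move: h h2; set q := normc (x - x0).
    move=> h h2; apply: (le_trans (lerD h (lexx _))); lra.
  move=> x y [_ xr] [_ yr] _; have h := aff x y xr yr.
  rewrite -[2 / p]invf_div ler_pdivlMl ?divr_gt0//.
  have : normc (P^`().[x0] * (x - y)) <= normc (P.[x] - P.[y]) + p / 2 * normc (x - y).
    have -> : P^`().[x0] * (x - y) =
      (P.[x] - P.[y]) - (P.[x] - P.[y] - P^`().[x0] * (x - y)) by ring.
    by apply: le_trans (le_normcD _ _) _; rewrite normcN lerD2l.
  rewrite normcM -/p; lra.
have -> : (48 * r)%:E = ((2 / p)%:E * (16 * (3 / 2 * p * r))%:E)%E.
  by rewrite -EFinM; congr EFin; field; rewrite gt_eqF.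
rewrite lee_pmul2l ?lte_fin ?divr_gt0//; apply: H1_circle_ball.
by apply: mulr_ge0; [apply: mulr_ge0; [lra|exact: ltW]|exact: ltW].
Qed.

End LevelSets.

Section CriticalLevel.
Variable R : realType.
Local Notation C := R[i].
Local Notation H1 := (@hausdorff1 R).
Local Notation pre := (@hausdorff1_pre R).
Local Notation Re := complex.Re.
Local Notation Im := complex.Im.
Implicit Types (x y z : C) (rs : seq C).
Variables (n : nat) (P : {poly C}) (rs : seq C).
Hypothesis n_gt1 : (1 < n)%N.
Hypothesis P_monic : P \is monic.
Hypothesis P_size : size P = n.+1.
Hypothesis rs_size : size rs = n.-1.
Hypothesis P'E : forall x, P^`().[x] = n%:R * \prod_(a <- rs) (x - a).

Definition near_critical (l rho : R) : set C :=
  [set x | normc P.[x] = l /\ exists2 a, a \in rs & normc (x - a) <= rho].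

(** The disc of radius t around each critical point is cut into squares, whose
    number depends on n only; a square that meets the shell lies in a ball to
    which H1_level_ball applies. *)
Lemma H1_shell : exists2 K : R, 0 <= K & forall l t, 0 < t ->
  (H1 [set x | near_critical l t x /\ forall a, a \in rs -> (t / 2 <= normc (x - a))%R]
    <= (K * t)%:E)%E.
Proof.
pose M := (2 ^ (n + 3))%N.
pose I := [seq (a, pq) | a <- rs, pq <- [seq (p, q) | p <- iota 0 M, q <- iota 0 M]].
exists ((size I)%:R * (48 / 2 / 2 ^+ n)) => [|l t t0].
  by rewrite mulr_ge0// !divr_ge0// exprn_ge0.
(* M squares of side h span the length 2 t, and points of one square are at
   distance at most 2 h, the radius in H1_level_ball at distance t / 2. *)
pose h := t / 2 ^+ n / 4; have p2 : 0 < 2 ^+ n :> R by rewrite exprn_gt0.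
have h0 : 0 < h by rewrite !divr_gt0.
have Mh : M%:R * h = 2 * t.
  rewrite /M /h natrX exprD; field; by rewrite gt_eqF.
have M0 : (0 < M)%N by rewrite expn_gt0.
set L := [set x | _].
pose A (i : C * (nat * nat)) := [set x | [/\ L x,
  i.2.1%:R * h <= Re (x - i.1) + t <= i.2.1%:R * h + h &
  i.2.2%:R * h <= Im (x - i.1) + t <= i.2.2%:R * h + h]].
have -> : (size I)%:R * (48 / 2 / 2 ^+ n) * t = (size I)%:R * (48 * (t / 2 / 2 ^+ n)).
  by field; rewrite gt_eqF.
apply: (H1_cover (A := A)) => [x Lx|[a [p q]] _].
  have [[_ [a ars xa]] _] := Lx.
  have [|p pM px] := @grid_cell R M h (Re (x - a) + t) M0.
    rewrite Mh; have := le_trans (Re_le_normc _) xa; rewrite ler_norml; lra.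
  have [|q qM qx] := @grid_cell R M h (Im (x - a) + t) M0.
    rewrite Mh; have := le_trans (Im_le_normc _) xa; rewrite ler_norml; lra.
  exists (a, (p, q)) => //; apply/allpairsP; exists (a, (p, q)); split => //=.
  by apply/allpairsP; exists (p, q); split; rewrite //= mem_iota.
have K0 : 0 <= 48 * (t / 2 / 2 ^+ n) by rewrite mulr_ge0// !divr_ge0// ltW.
have [[x0 [Lx0 re0 im0]]|nA] := pselect (A (a, (p, q)) !=set0); last first.
  rewrite (_ : A _ = set0) ?H1_set0 ?lee_fin//.
  by apply/seteqP; split => // x Ax; case: nA; exists x.
have t2 : 0 < t / 2 by rewrite divr_gt0.
apply: le_trans (H1_mono _) (H1_level_ball n_gt1 l rs_size P'E t2 (Lx0.2)).
move=> x [[[xl _] _] /= rex imx]; split => //.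
have E : x - x0 = (x - a) - (x0 - a) by ring.
apply: le_trans (normc_le_ReIm _) _; rewrite E ReB ImB.
have -> : t / 2 / 2 ^+ n = h + h by rewrite /h; field; rewrite gt_eqF.
by apply: lerD; move: rex imx re0 im0 => /= /andP[? ?] /andP[? ?] /andP[? ?] /andP[? ?]; rewrite ler_norml; apply/andP; split; lra.
Qed.

(** Sum over dyadic shells: the lengths decrease geometrically. At a given scale
    of covers only finitely many shells are needed, the rest being covered by
    one small disc for each critical point. *)
Lemma H1_near_critical : exists2 K : R, 0 <= K & forall l rho, 0 < rho ->
  (H1 (near_critical l rho) <= (K * rho)%:E)%E.
Proof.
have [K K0 hK] := H1_shell.
exists (2 * K + (size rs)%:R * 2) => [|l rho rho0]; first by rewrite addr_ge0 ?mulr_ge0.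
apply: H1_le => d d0.
have step k : (pre d (near_critical l rho) <=
    (2 * K * rho * (1 - (2 ^+ k)^-1))%:E + pre d (near_critical l (rho / 2 ^+ k)))%E.
  elim: k => [|k IH].
    by rewrite expr0 invr1 subrr mulr0 add0e mulr1.
  apply: (le_trans IH); have rk : 0 < rho / 2 ^+ k by rewrite divr_gt0 ?exprn_gt0.
  pose S := [set x | near_critical l (rho / 2 ^+ k) x /\
    forall a, a \in rs -> rho / 2 ^+ k / 2 <= normc (x - a)].
  have sub : near_critical l (rho / 2 ^+ k) `<=` S `|` near_critical l (rho / 2 ^+ k.+1).
    move=> x xk; have [far|] := pselect (forall a, a \in rs -> rho / 2 ^+ k / 2 <= normc (x - a)).
      by left.
    move=> /existsNP[a /not_implyP[ars /negP]]; rewrite -ltNge => xa; right.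
    split; first by case: xk.
    by exists a => //; rewrite exprSr invfM mulrA ltW.
  have -> : (2 * K * rho * (1 - (2 ^+ k.+1)^-1))%:E =
     ((2 * K * rho * (1 - (2 ^+ k)^-1))%:E + (K * (rho / 2 ^+ k))%:E)%E.
    by rewrite -EFinD; congr EFin; rewrite exprS; field; rewrite expf_neq0.
  rewrite -addeA leeD2l//; apply: le_trans (pre_mono sub (lexx d)) _.
  apply: (le_trans (pre_setU _ _ _)); rewrite leeD2r//.
  exact: le_trans (pre_le_H1 _ d0) (hK _ _ rk).
have [k kd] : exists k, 2 * (rho / 2 ^+ k) <= d.
  have q1 : (1 / 2 : R) < 1 by lra.
  have q0 : 0 <= (1 / 2 : R) by lra.
  have [k hk] := geometric_small (2 * rho) q0 q1 d0; exists k.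
  have := hk k (leqnn _); rewrite expr_div_n expr1n; lra.
have rk : 0 < rho / 2 ^+ k by rewrite divr_gt0 ?exprn_gt0.
have p1 : 0 <= (2 ^+ k : R)^-1 <= 1.
  have p2 : 1 <= 2 ^+ k :> R by rewrite exprn_ege1// ler1n.
  apply/andP; split; first by apply: ltW; rewrite invr_gt0 (lt_le_trans ltr01).
  by rewrite invf_le1// (lt_le_trans ltr01).
apply: (le_trans (step k)).
apply: (@le_trans _ _ ((2 * K * rho)%:E + ((size rs)%:R * (2 * (rho / 2 ^+ k)))%:E)%E).
  apply: leeD.
    rewrite lee_fin; apply: ler_piMr.
      by rewrite !mulr_ge0// ltW.
    by rewrite gerBl; case/andP: p1.
  have pc (B : seq C) : (pre d [set x | exists2 a, a \in B & (normc (x - a) <= rho / 2 ^+ k)%R] <=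
      ((size B)%:R * (2 * (rho / 2 ^+ k)))%:E)%E.
    elim: B => [|a B IH].
      rewrite mul0r (_ : [set x | _] = set0) ?pre0 ?(ltW d0)//.
      by apply/seteqP; split => // x [].
    have -> : (size (a :: B))%:R * (2 * (rho / 2 ^+ k)) =
      2 * (rho / 2 ^+ k) + (size B)%:R * (2 * (rho / 2 ^+ k)) by rewrite /= -natr1; ring.
    rewrite EFinD.
    apply: (@le_trans _ _ (pre d ([set x | normc (x - a) <= rho / 2 ^+ k] `|`
       [set x | exists2 a, a \in B & (normc (x - a) <= rho / 2 ^+ k)%R]))).
      apply: pre_mono => // x [b]; rewrite inE => /predU1P[->|bB] xb; first by left.
      by right; exists b.
    apply: (le_trans (pre_setU _ _ _)); apply: leeD => //.
    apply: pre_small; first by rewrite kd mulr_ge0// ltW.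
    move=> x y xa ya; apply: le_trans (le_normcB_trans _ a _) _.
    by rewrite mulr_natl mulr2n lerD// normcB.
  apply: le_trans (pc rs); apply: pre_mono => // x [_ [a ars xa]]; by exists a.
rewrite -EFinD lee_fin.
have -> : (2 * K + (size rs)%:R * 2) * rho = 2 * K * rho + (size rs)%:R * (2 * rho) by ring.
rewrite lerD2l ler_wpM2l// ler_wpM2l//.
by rewrite ler_piMr ?(ltW rho0)//; case/andP: p1.
Qed.

Lemma level_set_bounded (L : R) : exists2 B : R, 0 < B &
  forall x, normc P.[x] <= L -> normc x <= B.
Proof.
have [zs zs_size PE] := monic_factor P_monic P_size.
pose L' := `|L| + 1; have L'1 : 1 <= L' by rewrite lerDr.
pose B := \sum_(a <- zs) normc a + L'.
have S0 : 0 <= \sum_(a <- zs) normc a by rewrite sumr_ge0// => *; apply: normc_ge0.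
have B0 : 0 < B by rewrite /B; lra.
exists B => // x; rewrite leNgt => Px; rewrite leNgt; apply: contra Px => Bx.
have far a : a \in zs -> L' <= normc (x - a).
  move=> azs; have : normc a <= \sum_(b <- zs) normc b.
    by rewrite (big_rem a)//= lerDl sumr_ge0// => *; apply: normc_ge0.
  by have := ler_sub_normc x a; rewrite /B in Bx; lra.
have Ln : L < L' by rewrite (le_lt_trans (ler_norm L))// ltrDl.
apply: (lt_le_trans Ln); rewrite PE normc_prod.
move: zs_size far; case: (zs) => [|a s] /= => [n0|_ far]; first by move: n_gt1; rewrite -n0.
rewrite big_cons; apply: (le_trans (far a (mem_head _ _))).
rewrite ler_peMr ?normc_ge0//.
have : forall b, b \in s -> L' <= normc (x - b) by move=> b bs; apply: far; rewrite inE bs orbT.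
elim: s {far} => [|b s IH] h; first by rewrite big_nil.
rewrite big_cons mulr_ege1//; first by apply: le_trans L'1 (h b (mem_head _ _)).
by apply: IH => c cs; apply: h; rewrite inE cs orbT.
Qed.

(** For Q = P - v, the logarithmic derivative Q'(x) / Q(x) is the sum of the
    1 / (x - a) over the roots a of Q, so the root a nearest to x satisfies
    |Q'(x)| |x - a| <= n |Q(x)|. *)
Lemma root_near x v : P^`().[x] != 0 ->
  exists2 y, P.[y] = v & normc (y - x) * normc P^`().[x] <= n%:R * normc (P.[x] - v).
Proof.
move=> P'x; pose Q := P - v%:P.
have Q_size : size Q = n.+1.
  rewrite /Q size_polyDl ?P_size// size_polyN.
  by apply: leq_ltn_trans (size_polyC_leq1 _) _; rewrite ltnS ltnW.
have Q_monic : Q \is monic.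
  move/monicP: P_monic; rewrite /Q monicE !lead_coefE Q_size P_size /= => P1.
  by rewrite coefB P1 coefC (gtn_eqF (ltnW n_gt1)) subr0 eqxx.
have [zs QE] := closed_field_poly_normal Q.
rewrite (monicP Q_monic) scale1r in QE.
have zs_size : size zs = n by move: Q_size; rewrite QE size_prod_XsubC => -[].
have zs0 : zs != [::] by rewrite -size_eq0 zs_size -lt0n ltnW.
have [a azs amin] := seq_max_ex (fun b => (- normc (x - b))%:E : \bar R) zs0.
have near b : b \in zs -> normc (x - a) <= normc (x - b).
  by move=> /amin; rewrite lee_fin lerN2.
have Qx z : Q.[z] = P.[z] - v by rewrite /Q !hornerE.
exists a.
  have : root Q a by rewrite QE root_prod_XsubC.
  by rewrite /root Qx subr_eq0 => /eqP.
have -> : P^`() = Q^`() by rewrite /Q derivB derivC subr0.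
rewrite -Qx normcB mulrC QE -zs_size; move: (zs) (normc (x - a)) (normc_ge0 (x - a)) near.
elim=> [|b s IH] m m0 near; first by rewrite !big_nil derivC horner0 normc0 !mul0r.
rewrite big_cons derivM derivXsubC mul1r hornerD !hornerM hornerXsubC normcM.
have h1 := near b (mem_head _ _).
have h2 := IH m m0 (fun c cs => near c (mem_behead (s := b :: s) cs)).
apply: (@le_trans _ _ ((normc (\prod_(j <- s) ('X - j%:P)).[x] +
    normc (x - b) * normc (\prod_(j <- s) ('X - j%:P))^`().[x]) * m)).
  by rewrite ler_wpM2r// -normcM le_normcD.
move: h2; set g' := normc (_).[x]; set g := normc (_).[x] => h2.
have e1 : g * m <= g * normc (x - b) by rewrite ler_wpM2l ?normc_ge0.
have e2 : normc (x - b) * (g' * m) <= normc (x - b) * ((size s)%:R * g).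
  by rewrite ler_wpM2l ?normc_ge0.
have -> : (g + normc (x - b) * g') * m = g * m + normc (x - b) * (g' * m) by ring.
apply: (le_trans (lerD e1 e2)); rewrite le_eqVlt; apply/orP; left; apply/eqP.
by rewrite [size _]/= -natr1; ring.
Qed.

End CriticalLevel.

Section LevelTransfer.
Variable R : realType.
Local Notation C := R[i].
Local Notation H1 := (@hausdorff1 R).
Implicit Types (x y z : C).
Variables (n : nat) (P : {poly C}) (rs : seq C).
Hypothesis n_gt1 : (1 < n)%N.
Hypothesis P_monic : P \is monic.
Hypothesis P_size : size P = n.+1.
Hypothesis rs_size : size rs = n.-1.
Hypothesis P'E : forall x, P^`().[x] = n%:R * \prod_(a <- rs) (x - a).

Lemma continuous_horner_normc (Q : {poly C}) : continuous (fun z => normc Q.[z]).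
Proof.
move=> z; apply: (@continuous_comp C C R (horner Q) (@normc R)).
  exact: strict_deriv_continuous (@strict_deriv_horner R Q z).
exact: continuous_normc.
Qed.

Lemma deriv_far_ge (rho : R) x : 0 < rho -> (forall a, a \in rs -> rho <= normc (x - a)) ->
  n%:R * rho ^+ n.-1 <= normc P^`().[x].
Proof.
move=> rho0 far; rewrite P'E normcM (normc_nat R) ler_wpM2l// normc_prod -rs_size.
elim: (rs) far => [|a s IH] far; first by rewrite big_nil expr0.
rewrite big_cons exprS; apply: ler_pM; rewrite ?exprn_ge0 ?(ltW rho0)//.
  exact: far (mem_head _ _).
by apply: IH => b bs; apply: far; rewrite inE bs orbT.
Qed.

(** Away from the critical points, moving a point x to the nearby solution y of
    P(y) = (l2 / l1) P(x) distorts small distances by a factor close to 1. *)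
Lemma level_transfer (l0 rho e : R) : 0 < l0 -> 0 < rho -> 0 < e ->
  exists2 eta : R, 0 < eta & forall l1 l2, l0 <= l1 <= l0 + eta -> l0 <= l2 <= l0 + eta ->
  (H1 [set x | normc P.[x] = l1 /\ forall a, a \in rs -> (rho <= normc (x - a))%R] <=
   (1 + e)%:E * H1 [set x | normc P.[x] = l2])%E.
Proof.
move=> l00 rho0 e0.
pose m := n%:R * rho ^+ n.-1.
have n0 : 0 < n%:R :> R by rewrite ltr0n ltnW.
have m0 : 0 < m by rewrite mulr_gt0 ?exprn_gt0.
pose K := [set x : C | normc P.[x] <= l0 + 1] `&` [set x : C | m <= normc P^`().[x]].
have cK : compact K.
  have [B B0 hB] := level_set_bounded n_gt1 P_monic P_size (l0 + 1).
  apply: (@compact_le_normc _ _ B) => [|z [zl _]]; last exact: hB.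
  apply: closedI.
    apply: (@preimage_closed _ _ (fun z => normc P.[z]) [set t | t <= l0 + 1]); last exact: closed_le.
    by move=> z _; apply: continuous_horner_normc.
  apply: (@preimage_closed _ _ (fun z => normc P^`().[z]) [set t | m <= t]); last exact: closed_ge.
  by move=> z _; apply: continuous_horner_normc.
(* Small enough for (1 + k) ^ 2 <= (1 + e) (1 - k). *)
pose k := Num.min e 1 / 10.
have [k0 [ke k1]] : 0 < k /\ k <= e / 10 /\ k <= 1 / 10.
  have : 0 < Num.min e 1 by rewrite lt_min e0 ltr01.
  have : Num.min e 1 <= e by rewrite ge_min lexx.
  have : Num.min e 1 <= 1 by rewrite ge_min lexx orbT.
  by rewrite /k => ? ? ?; split; [|split]; lra.
have mk0 : 0 < m * k by rewrite mulr_gt0.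
have [d d0 hd] := strict_deriv_uniform cK (fun z _ => @strict_deriv_horner R P z) mk0.
(* A level change of at most eta moves the solution by at most d / 4, and it
   makes l1 / l2 at most 1 + k. *)
pose eta := Num.min (Num.min 1 (k * l0)) (m * (d / 4) / n%:R).
have eta0 : 0 < eta by rewrite !lt_min ltr01 mulr_gt0//= divr_gt0// mulr_gt0// divr_gt0.
have [eta1 [etak etad]] : eta <= 1 /\ eta <= k * l0 /\ eta * n%:R <= m * (d / 4).
  by split; [|split]; rewrite -?ler_pdivlMr// /eta !ge_min lexx ?orbT.
exists eta => // l1 l2 l1e l2e.
have [l10 l20] : 0 < l1 /\ 0 < l2 by split; lra.
pose lam := l2 / l1.
set A := [set x | _].
pose S x := [set y | P.[y] = lam%:C%C * P.[x] /\ normc (y - x) <= d / 4].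
pose f x := get (S x).
have inK x : A x -> K x /\ m <= normc P^`().[x].
  by move=> [xl far]; have := deriv_far_ge rho0 far; split => //; split => //=; rewrite xl; lra.
have fS x : A x -> S x (f x).
  move=> Ax; have [_ xm] := inK x Ax.
  apply: (getPex (P := S x)).
  have P'0 : P^`().[x] != 0 by rewrite -normc_gt0 (lt_le_trans m0).
  have [y yv yx] := root_near n_gt1 P_monic P_size (lam%:C%C * P.[x]) P'0.
  exists y; split => //.
  have h1 : normc (P.[x] - lam%:C%C * P.[x]) <= eta.
    have -> : P.[x] - lam%:C%C * P.[x] = (1 - lam)%:C%C * P.[x].
      by rewrite rmorphB rmorph1; ring.
    rewrite normcM normc_real; case: Ax => -> _.
    rewrite -[X in _ * X](gtr0_norm l10) -normrM mulrBl mul1r /lam divfK ?gt_eqF//.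
    by rewrite ler_norml; lra.
  have h2 : normc (y - x) * m <= eta * n%:R.
    apply: (@le_trans _ _ (normc (y - x) * normc P^`().[x])).
      by rewrite ler_wpM2l ?normc_ge0.
    by rewrite (le_trans yx)// mulrC ler_wpM2r// ltW.
  by rewrite -(ler_pM2r m0) [leRHS]mulrC (le_trans h2).
have d4 : 0 < d / 4 by rewrite divr_gt0.
apply: (@H1_expand _ f _ _ _ (d / 4)) => //; first by lra.
  move=> x Ax; have [E _] := fS x Ax; rewrite /= E normcM normc_real.
  case: Ax => -> _; rewrite ger0_norm ?divr_ge0 ?ltW// /lam divfK// gt_eqF//.
move=> x x' Ax Ax' ff; have [Kx xm] := inK x Ax.
have [E xf] := fS x Ax; have [E' xf'] := fS x' Ax'.
set p := normc P^`().[x] in xm.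
have xx' : normc (x' - x) < d.
  have := le_normcB_trans x' (f x') x; have := le_normcB_trans (f x') (f x) x.
  rewrite (normcB x' (f x')) (normcB (f x') (f x)); lra.
have fx : normc (f x - x) < d by lra.
have fx' : normc (f x' - x) < d.
  have := le_normcB_trans (f x') (f x) x; rewrite (normcB (f x') (f x)); lra.
have xx : normc (x - x) < d by rewrite subrr normc0.
have c1 := hd x x x' Kx xx xx'; have c2 := hd x (f x) (f x') Kx fx fx'.
have mkp : m * k <= p * k by rewrite ler_wpM2r// ltW.
have p0 : 0 < p by apply: lt_le_trans xm.
have q1 : p * normc (x - x') <= normc (P.[x] - P.[x']) + m * k * normc (x - x').
  rewrite /p -normcM.
  have -> : P^`().[x] * (x - x') = (P.[x] - P.[x']) - (P.[x] - P.[x'] - P^`().[x] * (x - x')) by ring.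
  by apply: le_trans (le_normcD _ _) _; rewrite normcN lerD2l.
have q2 : normc (P.[f x] - P.[f x']) <= p * normc (f x - f x') + m * k * normc (f x - f x').
  rewrite /p -normcM.
  have -> : P.[f x] - P.[f x'] = P^`().[x] * (f x - f x') +
     (P.[f x] - P.[f x'] - P^`().[x] * (f x - f x')) by ring.
  by apply: le_trans (le_normcD _ _) _; rewrite lerD2l.
have q3 : normc (P.[f x] - P.[f x']) = lam * normc (P.[x] - P.[x']).
  by rewrite E E' -mulrBr normcM normc_real ger0_norm// divr_ge0// ltW.
have lam_ge : 1 <= (1 + k) * lam.
  rewrite /lam mulrA ler_pdivlMr// mul1r mulrDl mul1r.
  have : k * l0 <= k * l2 by rewrite ler_wpM2l ?(ltW k0)//; case/andP: l2e.
  by case/andP: l1e; case/andP: l2e; lra.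
clear - q1 q2 q3 lam_ge mkp p0 k0 ke k1 e0.
move: q1 q2 q3; move: (normc_ge0 (x - x')) (normc_ge0 (f x - f x')).
move: (normc (x - x')) (normc (f x - f x')) (normc (P.[x] - P.[x'])) (normc (P.[f x] - _)).
move=> u v w w' u0 v0 q1 q2 q3.
have a1 : p * ((1 - k) * u) <= w.
  have : m * k * u <= p * k * u by rewrite ler_wpM2r.
  have -> : p * ((1 - k) * u) = p * u - p * k * u by ring.
  lra.
have a2 : w' <= p * ((1 + k) * v).
  have : m * k * v <= p * k * v by rewrite ler_wpM2r.
  have -> : p * ((1 + k) * v) = p * v + p * k * v by ring.
  lra.
have a3 : w <= (1 + k) * w'.
  rewrite q3 mulrA; apply: (@le_trans _ _ (1 * w)); first by rewrite mul1r.
  by rewrite ler_wpM2r//; apply: le_trans a1; rewrite !mulr_ge0 ?(ltW p0)//; lra.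
have a4 : p * ((1 - k) * u) <= p * ((1 + k) * (1 + k) * v).
  apply: (le_trans a1); apply: (le_trans a3).
  have -> : p * ((1 + k) * (1 + k) * v) = (1 + k) * (p * ((1 + k) * v)) by ring.
  by rewrite ler_wpM2l//; lra.
rewrite (ler_pM2l p0) in a4.
have k2 : (1 + k) * (1 + k) <= (1 + e) * (1 - k).
  have e10 : (1 + 10 * k) * (1 - k) <= (1 + e) * (1 - k) by rewrite ler_wpM2r; lra.
  apply: le_trans e10.
  have : k * k <= k * (1 / 10) by rewrite ler_wpM2l// ltW.
  have -> : (1 + k) * (1 + k) = 1 + 2 * k + k * k by ring.
  have -> : (1 + 10 * k) * (1 - k) = 1 + 9 * k - 10 * (k * k) by ring.
  lra.
have k3 : 0 < 1 - k by lra.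
rewrite -(ler_pM2l k3); apply: (le_trans a4).
have -> : (1 - k) * ((1 + e) * v) = (1 + e) * (1 - k) * v by ring.
by rewrite ler_wpM2r.
Qed.

End LevelTransfer.

(** * The length formula *)

Section LengthFormula.
Variable R : realType.
Local Notation C := R[i].
Local Notation H1 := (@hausdorff1 R).
Implicit Types (x y z w : C).

Lemma nneseries_scaled_le (u : nat -> R) (D : R) (h : \bar R) : 0 <= D ->
  (forall k, 0 <= u k) -> (forall K, ((D * \sum_(k < K) u k)%:E <= h)%E) ->
  (D%:E * \sum_(0 <= k <oo) (u k)%:E <= h)%E.
Proof.
move=> D0 u0 h0; rewrite -nneseriesZl => [|i _]; last by rewrite lee_fin.
apply: lime_le.
  by apply: is_cvg_nneseries => i _ _; rewrite mule_ge0 ?lee_fin.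
apply: nearW => K; apply: le_trans (h0 K).
by rewrite -(big_mkord xpredT u) mulr_sumr -sumEFin; apply: lee_sum => i _; rewrite EFinM.
Qed.

Lemma nneseries_scaled_ge (u : nat -> R) (D : R) K : 0 <= D -> (forall k, 0 <= u k) ->
  ((D * \sum_(k < K) u k)%:E <= D%:E * \sum_(0 <= k <oo) (u k)%:E)%E.
Proof.
move=> D0 u0; rewrite EFinM; apply: lee_wpmul2l; first by rewrite lee_fin.
rewrite -(big_mkord xpredT u) -sumEFin.
by apply: (@nneseries_lim_ge R (fun k => (u k)%:E)) => i _ _; rewrite lee_fin.
Qed.

Lemma nneseries_scaled_eq (u : nat -> R) (D : R) (h : \bar R) : 0 <= D ->
  (forall k, 0 <= u k) ->
  (forall e : R, 0 < e -> exists K0, forall K, (K0 <= K)%N ->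
    ((D * \sum_(k < K) u k - e)%:E <= h <= (D * \sum_(k < K) u k + e)%:E)%E) ->
  h = (D%:E * \sum_(0 <= k <oo) (u k)%:E)%E.
Proof.
move=> D0 u0 hK; apply/eqP; rewrite eq_le; apply/andP; split.
  apply/lee_addgt0Pr => e e0; have [K0 /(_ K0 (leqnn _))/andP[_ h1]] := hK e e0.
  by apply: (le_trans h1); rewrite EFinD leeD2r//; apply: nneseries_scaled_ge.
apply: nneseries_scaled_le => // K; apply/lee_addgt0Pr => e e0.
have [K0 /(_ (maxn K K0) (leq_maxr _ _))/andP[h1 _]] := hK e e0.
rewrite -leeBlDr// -EFinB; apply: le_trans h1; rewrite lee_fin lerB// ler_wpM2l//.
rewrite -!(big_mkord xpredT u) [leRHS](big_cat_nat (n := K)) ?leq_maxl//= lerDl.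
by rewrite sumr_ge0.
Qed.

Lemma squeeze_le (X : \bar R) (f : R) : 0 <= f ->
  (forall e : R, 0 < e -> e <= 1 -> (X <= ((1 + e) * (e + (1 + e) * f))%:E)%E) ->
  (X <= f%:E)%E.
Proof.
move=> f0 h; apply/lee_addgt0Pr => e e0.
have d0 : 0 < 2 + 3 * f by rewrite ltr_wpDr ?mulr_ge0.
pose e' := Num.min 1 (e / (2 + 3 * f)).
have e'0 : 0 < e' by rewrite lt_min ltr01 divr_gt0.
have e'1 : e' <= 1 by rewrite ge_min lexx.
have e'e : e' * (2 + 3 * f) <= e by rewrite -ler_pdivlMr// ge_min lexx orbT.
apply: (le_trans (h e' e'0 e'1)); rewrite -EFinD lee_fin.
have ee : e' * e' <= e' by rewrite ler_piMr// ltW.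
have eef : e' * e' * f <= e' * f by rewrite ler_wpM2r.
clear - e'e ee eef; rewrite (_ : (1 + e') * (e' + (1 + e') * f) =
  f + e' + e' * e' + 2 * (e' * f) + e' * e' * f); last by ring.
lra.
Qed.

Lemma ler_1DX (d : R) m : 0 <= d <= 1 -> (1 + d) ^+ m <= 1 + 2 ^+ m * d.
Proof.
move=> /andP[d0 d1]; suff : (1 + d) ^+ m <= 1 + (2 ^+ m - 1) * d by move/le_trans; apply; lra.
elim: m => [|m IH]; first by rewrite !expr0 subrr mul0r addr0.
have p1 : 0 <= 2 ^+ m - 1 :> R by rewrite subr_ge0 exprn_ege1// ler1n.
rewrite [leLHS]exprS mulrC; apply: (@le_trans _ _ ((1 + (2 ^+ m - 1) * d) * (1 + d))).
  by rewrite ler_wpM2r// addr_ge0.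
have : (2 ^+ m - 1) * d * d <= (2 ^+ m - 1) * d by rewrite ler_piMr// mulr_ge0.
by rewrite exprS; lra.
Qed.

Variables (n : nat) (P : {poly C}) (phi s : C -> C) (c : int -> C) (r0 : R).
Hypothesis n_gt1 : (1 < n)%N.
Hypothesis P_monic : P \is monic.
Hypothesis P_size : size P = n.+1.
Hypothesis r0_ge0 : 0 <= r0.
Hypothesis P_crit : forall x, root P^`() x -> normc P.[x] <= r0 ^+ n.
Hypothesis phi_cont : forall z, r0 < normc z -> {for z, continuous phi}.
Hypothesis phi_eq : forall z, r0 < normc z -> P.[phi z] = z ^+ n.
Hypothesis phi_lim : phi z / z @[z --> @cinfty R] --> (1 : C).
Hypothesis s_cont : forall z, r0 < normc z -> {for z, continuous s}.
Hypothesis s_sqr : forall z, r0 < normc z -> s z ^+ 2 = (phi^`())%classic z.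
Hypothesis s_lim : s z @[z --> @cinfty R] --> (1 : C).
Hypothesis s_laurent : laurent_coefs_at_infty s c.

Let phi' z := (z ^+ n.-1 *+ n) / P^`().[phi z].

Lemma phi_deriv z : r0 < normc z -> strict_deriv phi z (phi' z).
Proof. by move=> zr; apply: (phi_strict_deriv (ltnW n_gt1) r0_ge0 P_crit phi_cont phi_eq zr). Qed.

Lemma s_sqrE z : r0 < normc z -> s z ^+ 2 = phi' z.
Proof. by move=> zr; rewrite s_sqr// (strict_deriv_derive1 (phi_deriv zr)). Qed.

(** s is a continuous solution of s ^ 2 = phi', where phi' does not vanish. *)
Lemma s_deriv z : r0 < normc z -> exists l, strict_deriv s z l.
Proof.
move=> zr; have z0 : z != 0 by rewrite -normc_gt0 (le_lt_trans r0_ge0).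
have P'0 := phi_not_critical (ltnW n_gt1) r0_ge0 P_crit phi_eq zr.
have phi'0 : phi' z != 0.
  rewrite mulf_neq0 ?invr_eq0//.
  by rewrite mulrn_eq0 negb_or expf_neq0// andbT -lt0n ltnW.
have s0 : s z != 0.
  by apply: contraNneq phi'0 => s0; rewrite -s_sqrE// s0 expr0n.
have num := @strict_derivX R id z 1 n.-1 (@strict_deriv_id R z).
have den := @strict_derivV R (fun w => P^`().[phi w]) z _ P'0
  (@strict_deriv_poly_comp R P^`() phi z _ (phi_deriv zr)).
have dphi' := @strict_derivM R (fun w => n%:R * w ^+ n.-1) (fun w => (P^`().[phi w])^-1) z _ _
  (@strict_derivM R (fun=> n%:R) (fun w => w ^+ n.-1) z _ _ (@strict_deriv_cst R n%:R z) num) den.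
eexists; apply: (@strict_deriv_implicit R 'X^2 s (fun w => n%:R * w ^+ n.-1 / P^`().[phi w]) z _
  (s_cont zr) _ _ dphi').
  apply: filterS (exterior_nbhs zr) => w wr; rewrite hornerXn s_sqrE//.
  by rewrite /phi' mulr_natl.
by rewrite derivXn hornerMn hornerXn mulrn_eq0.
Qed.

Let a (k : nat) : R := normc (c (- k%:Z)) ^+ 2.
Let E (r : R) : set C := [set x | normc P.[x] = r ^+ n].
Let V (K : nat) (r : R) : R := \sum_(k < K) a k * r ^- (2 * k).

Lemma level_image r : r0 < r -> E r = phi @` [set z | normc z = r].
Proof.
move=> rr; apply/seteqP; split => [x Ex|_ [z /= zr <-]].
  have [z zr zx] := phi_surj (ltnW n_gt1) P_size r0_ge0 P_crit phi_cont phi_eq phi_lim rr Ex.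
  by exists z.
by rewrite /E /= phi_eq ?zr// normcX zr.
Qed.

(** H1_circle_image and mean_sqr_normc approximate the length and the sum
    over k < K by the same mean of |phi'| = |s| ^ 2 over N nodes. *)
Lemma length_partial_sums r e : r0 < r -> 0 < e -> exists K0, forall K, (K0 <= K)%N ->
  ((2 * pi * r * V K r - e)%:E <= H1 (E r) <= (2 * pi * r * V K r + e)%:E)%E.
Proof.
move=> rr e0; have r_gt0 : 0 < r by apply: le_lt_trans rr.
have D0 : 0 < 2 * pi * r by rewrite !mulr_gt0 ?pi_gt0.
have e2 : 0 < e / 2 by rewrite divr_gt0.
have eD : 0 < e / 2 / (2 * pi * r) by rewrite divr_gt0.
have nr : normc (r%:C%C : C) = r by rewrite normc_real gtr0_norm.
have rr' : r0 < normc (r%:C%C : C) by rewrite nr.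
have [K0 hK] := mean_sqr_normc r0_ge0 s_deriv s_laurent s_lim rr' eD.
have [B B0 hB] := s_circle_bounded s_deriv rr.
have phi'B z : normc z = r -> normc (phi' z) <= B ^+ 2.
  move=> zr; rewrite -s_sqrE ?zr// normcX lerXn2r ?nnegrE ?normc_ge0 ?(ltW B0)//.
  exact: hB.
have phid z : normc z = r -> strict_deriv phi z (phi' z).
  by move=> zr; apply: phi_deriv; rewrite zr.
have phii z w : normc z = r -> normc w = r -> phi z = phi w -> z = w.
  by move=> zr wr; apply: (phi_inj (ltnW n_gt1) r0_ge0 P_crit phi_cont phi_eq phi_lim); rewrite ?zr ?wr.
have B20 : 0 < B ^+ 2 by rewrite exprn_gt0.
have [N1 hN1] := H1_circle_image r_gt0 phid phii e2 B20 phi'B.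
exists K0 => K KK; have [N2 hN2] := hK K KK.
pose N := (maxn N1 N2).+1.
have := hN1 N _ (leq_maxl _ _) erefl; rewrite -level_image//.
have := hN2 N (leq_maxr _ _); rewrite nr -/(V K r).
rewrite (eq_bigr (fun j : 'I_N => normc (phi' (r%:C%C * omega R N ^+ j)))); last first.
  by move=> j _; rewrite -s_sqrE ?normcX// normc_node nr.
set m := (\sum_(j < N) _) / _ => mV /andP[h1 h2].
have : 2 * pi * r * `|m - V K r| <= e / 2.
  by rewrite mulrC -ler_pdivlMr.
rewrite -[X in X * _](gtr0_norm D0) -normrM mulrBr ler_norml => /andP[k1 k2].
apply/andP; split.
  by apply: le_trans h1; rewrite lee_fin; move: k1 k2; lra.
by apply: (le_trans h2); rewrite lee_fin; move: k1 k2; lra.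
Qed.

Lemma term_ge0 (r : R) k : 0 < r -> 0 <= a k * r ^- (2 * k).
Proof. by move=> rp; rewrite mulr_ge0 ?sqr_ge0// invr_ge0 exprn_ge0// ltW. Qed.

Lemma length_exterior r : r0 < r ->
  H1 (E r) = ((2 * pi * r)%:E * \sum_(0 <= k <oo) (a k * r ^- (2 * k))%:E)%E.
Proof.
move=> rr; have r_gt0 : 0 < r by apply: le_lt_trans rr.
apply: (@nneseries_scaled_eq (fun k => a k * r ^- (2 * k))) => [|k|e e0].
- by rewrite !mulr_ge0 ?pi_ge0 ?(ltW r_gt0).
- exact: term_ge0.
- exact: length_partial_sums.
Qed.

(** The level sets of height at most L lie in one disc, all of which is near a
    critical point if near is taken at the size of the disc. *)
Lemma length_bounded (L : R) : exists2 B : R, 0 <= B &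
  forall r, 0 <= r -> r ^+ n <= L -> (H1 (E r) <= B%:E)%E.
Proof.
have [rs rs_size [rsE P'E]] := deriv_factor n_gt1 P_monic P_size.
have [K K0 hK] := H1_near_critical n_gt1 rs_size P'E.
have [B B0 hB] := level_set_bounded n_gt1 P_monic P_size L.
have [b brs] : exists b, b \in rs.
  by case: (rs) rs_size => [|b ?] h; [move: n_gt1 h; case: n => [|[]]|exists b; rewrite mem_head].
pose rho := B + normc b; have rho0 : 0 < rho by rewrite ltr_wpDr ?normc_ge0.
exists (K * rho) => [|r rp rL]; first by rewrite mulr_ge0 ?(ltW rho0).
apply: le_trans (H1_mono _) (hK (r ^+ n) rho rho0) => x Ex; split => //.
exists b => //; rewrite (le_trans (le_normcD _ _))// normcN lerD2r hB//.
by rewrite Ex.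
Qed.

(** Split off the part of E r near the critical points, which is short, and move
    the rest to E r' by level_transfer. The roles of r and r' may be exchanged,
    so that the critical level can be compared in both directions. *)
Lemma length_nearby (e : R) : 0 < r0 -> 0 < e -> exists2 eta : R, 0 < eta &
  forall r r', r0 <= r -> r0 <= r' -> r ^+ n <= r0 ^+ n + eta -> r' ^+ n <= r0 ^+ n + eta ->
  (H1 (E r) <= e%:E + (1 + e)%:E * H1 (E r'))%E.
Proof.
move=> r0p e0; have [rs rs_size [rsE P'E]] := deriv_factor n_gt1 P_monic P_size.
have [K K0 hK] := H1_near_critical n_gt1 rs_size P'E.
pose rho := e / (K + 1); have K1 : 0 < K + 1 by rewrite ltr_wpDl.
have rho0 : 0 < rho by rewrite divr_gt0.
have Krho : K * rho <= e.
  by rewrite /rho mulrA ler_pdivrMr// mulrC ler_wpM2l ?(ltW e0)// lerDl.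
have l0 : 0 < r0 ^+ n by rewrite exprn_gt0.
have [eta eta0 h] := level_transfer n_gt1 P_monic P_size rs_size P'E l0 rho0 e0.
exists eta => // r r' rr rr' re re'.
have ge0n q : r0 <= q -> r0 ^+ n <= q ^+ n.
  by move=> rq; rewrite lerXn2r ?nnegrE// (le_trans r0_ge0).
have sub : E r `<=` near_critical P rs (r ^+ n) rho `|`
   [set x | normc P.[x] = r ^+ n /\ forall a, a \in rs -> rho <= normc (x - a)].
  move=> x Ex; have [far|] := pselect (forall b, b \in rs -> rho <= normc (x - b)).
    by right.
  move=> /existsNP[b /not_implyP[brs /negP]]; rewrite -ltNge => xb; left.
  by split => //; exists b => //; apply: ltW.
apply: (le_trans (H1_mono sub)); apply: (le_trans (H1_setU _ _)); apply: leeD.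
  by apply: (le_trans (hK _ _ rho0)); rewrite lee_fin.
by apply: h; rewrite ge0n.
Qed.

Lemma radius_close (e eta : R) m : 0 < r0 -> 0 < e -> 0 < eta -> exists2 r, r0 < r &
  r ^+ n <= r0 ^+ n + eta /\ (r / r0) ^+ m <= 1 + e.
Proof.
move=> r0p e0 eta0; pose d := Num.min 1 (Num.min (e / 2 ^+ m) (eta / (2 ^+ n * r0 ^+ n))).
have p k : 0 < 2 ^+ k :> R by rewrite exprn_gt0.
have rn : 0 < r0 ^+ n by rewrite exprn_gt0.
have d0 : 0 < d by rewrite !lt_min ltr01 !divr_gt0// mulr_gt0.
have d1 : d <= 1 by rewrite ge_min lexx.
have de : 2 ^+ m * d <= e by rewrite mulrC -ler_pdivlMr// /d !ge_min lexx !orbT.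
have deta : r0 ^+ n * (2 ^+ n * d) <= eta.
  by rewrite mulrA mulrC [_ * 2 ^+ n]mulrC -ler_pdivlMr ?mulr_gt0// /d !ge_min lexx !orbT.
have d01 : 0 <= d <= 1 by rewrite ltW.
exists (r0 * (1 + d)); first by rewrite ltr_pMr// ltrDl.
split.
  rewrite exprMn; apply: (@le_trans _ _ (r0 ^+ n * (1 + 2 ^+ n * d))).
    by rewrite ler_wpM2l ?(ltW rn)// ler_1DX.
  by rewrite mulrDr mulr1 lerD2l.
rewrite mulrC mulKf ?gt_eqF//; apply: (le_trans (ler_1DX m d01)).
by rewrite lerD2l.
Qed.

(** Let r decrease to r0 and use length_nearby in both directions. For the upper
    bound the whole series is compared, its terms being larger at r0 than at r;
    for the lower bound a partial sum suffices, whose terms vary by a factor of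
    at most (r / r0) ^ (2 * K). *)
Lemma length_critical : 0 < r0 ->
  H1 (E r0) = ((2 * pi * r0)%:E * \sum_(0 <= k <oo) (a k * r0 ^- (2 * k))%:E)%E.
Proof.
move=> r0p; have D0 : 0 <= 2 * pi * r0 by rewrite !mulr_ge0 ?pi_ge0.
pose u k := a k * r0 ^- (2 * k).
have u0 k : 0 <= u k by apply: term_ge0.
pose F := ((2 * pi * r0)%:E * \sum_(0 <= k <oo) (u k)%:E)%E.
have F0 : (0 <= F)%E.
  by rewrite mule_ge0 ?lee_fin//; apply: nneseries_ge0 => k _ _; rewrite lee_fin.
have term_le r k : r0 <= r -> a k * r ^- (2 * k) <= u k.
  move=> rr; rewrite /u ler_wpM2l ?sqr_ge0// lef_pV2 ?posrE ?exprn_gt0//; last exact: lt_le_trans rr.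
  by rewrite lerXn2r ?nnegrE ?(ltW r0p)// (le_trans (ltW r0p)).
apply/eqP; rewrite eq_le; apply/andP; split.
  have [Foo|Foo] := eqVneq F +oo%E; first by rewrite -[leRHS]/F Foo leey.
  have Ffin : F \is a fin_num by rewrite ge0_fin_numE// ltey.
  rewrite -[leRHS]/F -(fineK Ffin); apply: squeeze_le => [|e e0 e1]; first exact: fine_ge0.
  have [eta eta0 h] := length_nearby r0p e0.
  have [r rr [rn re]] := radius_close 1 r0p e0 eta0; rewrite expr1 in re.
  have r_gt0 : 0 < r by apply: lt_trans rr.
  have := h r0 r (lexx _) (ltW rr) _ rn; rewrite lerDl => /(_ (ltW eta0)) h0.
  apply: (le_trans h0).
  have Er : (H1 (E r) <= ((1 + e) * fine F)%:E)%E.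
    rewrite length_exterior// [leRHS]EFinM fineK//.
    have -> : 2 * pi * r = r / r0 * (2 * pi * r0) by field; rewrite gt_eqF.
    rewrite EFinM -muleA; apply: (@le_trans _ _ ((r / r0)%:E * F)%E).
      apply: lee_wpmul2l; first by rewrite lee_fin divr_ge0// ltW.
      apply: lee_wpmul2l; first by rewrite lee_fin.
      apply: lee_nneseries => [k _ _|k _]; rewrite lee_fin; first exact: term_ge0.
      by apply: term_le; apply: ltW.
    by apply: lee_wpmul2r => //; rewrite lee_fin.
  apply: (@le_trans _ _ (e%:E + (1 + e)%:E * ((1 + e) * fine F)%:E)%E).
    by apply: leeD => //; apply: lee_wpmul2l => //; rewrite lee_fin addr_ge0 ?(ltW e0).
  rewrite -EFinM -EFinD lee_fin [leRHS]mulrDr lerD2r.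
  by rewrite mulrDl mul1r lerDl mulr_ge0 ?(ltW e0).
apply: nneseries_scaled_le => // K.
have [B B0 hB] := length_bounded (r0 ^+ n).
have Hfin : H1 (E r0) \is a fin_num.
  by rewrite ge0_fin_numE ?H1_ge0// (le_lt_trans (hB r0 r0_ge0 (lexx _))) ?ltry.
rewrite -(fineK Hfin); apply: squeeze_le => [|e e0 e1]; first exact/fine_ge0/H1_ge0.
have [eta eta0 h] := length_nearby r0p e0.
have [r rr [rn re]] := radius_close (2 * K) r0p e0 eta0.
have r_gt0 : 0 < r by apply: lt_trans rr.
have := h r r0 (ltW rr) (lexx _) rn; rewrite lerDl => /(_ (ltW eta0)).
rewrite -{1}(fineK Hfin) -EFinM -EFinD => h0.
have q1 : 1 <= r / r0 by rewrite ler_pdivlMr// mul1r ltW.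
have qle k : (k <= K)%N -> u k <= (r / r0) ^+ (2 * K) * (a k * r ^- (2 * k)).
  move=> kK; apply: (@le_trans _ _ ((r / r0) ^+ (2 * k) * (a k * r ^- (2 * k)))).
    rewrite expr_div_n /u [leRHS](_ : _ = a k * r0 ^- (2 * k))//.
    by field; rewrite !expf_neq0// gt_eqF.
  by rewrite ler_wpM2r ?term_ge0// ler_weXn2l// leq_mul2l.
have V0 : 0 <= V K r by apply: sumr_ge0 => k _; apply: term_ge0.
have VK : 2 * pi * r0 * \sum_(k < K) u k <= (1 + e) * (2 * pi * r * V K r).
  apply: (@le_trans _ _ (2 * pi * r0 * ((r / r0) ^+ (2 * K) * V K r))).
    rewrite ler_wpM2l// /V mulr_sumr; apply: ler_sum => k _; apply: qle.
    exact/ltnW.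
  apply: (@le_trans _ _ (2 * pi * r0 * ((1 + e) * V K r))).
    by rewrite ler_wpM2l// ler_wpM2r.
  rewrite mulrCA ler_wpM2l ?addr_ge0 ?(ltW e0)// ler_wpM2r// ler_wpM2l ?(ltW rr)//.
  by rewrite mulr_ge0 ?pi_ge0.
rewrite lee_fin; apply: (le_trans VK); rewrite ler_wpM2l ?addr_ge0 ?(ltW e0)//.
rewrite -lee_fin; apply: le_trans h0.
rewrite length_exterior//; apply: nneseries_scaled_ge => [|k].
  by rewrite !mulr_ge0 ?pi_ge0 ?(ltW r_gt0).
exact: term_ge0.
Qed.

Lemma length_formula r : 0 < r -> r0 <= r ->
  H1 (E r) = ((2 * pi * r)%:E * \sum_(0 <= k <oo) (a k * r ^- (2 * k))%:E)%E.
Proof.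
move=> rp; rewrite le_eqVlt => /predU1P[rr|]; last exact: length_exterior.
by rewrite -rr; apply: length_critical; rewrite rr.
Qed.

(** The length formula makes 2 pi r |c_(-k)| ^ 2 r ^- (2 k) at most the length
    of the level set, which stays bounded as r tends to 0 = r0. *)
Lemma coef_eq0 k : r0 = 0 -> (0 < k)%N -> c (- k%:Z) = 0.
Proof.
move=> r00 k0; have [B B0 hB] := length_bounded 1.
suff : a k <= 0.
  move=> ak; apply/eqP; rewrite -normc_eq0 -sqrf_eq0 eq_le ak; exact: sqr_ge0.
apply/ler_addgt0Pr => e e0; rewrite add0r.
pose r := Num.min 1 (e / (B + 1)); have B1 : 0 < B + 1 by rewrite ltr_wpDl.
have rp : 0 < r by rewrite lt_min ltr01 divr_gt0.
have r1 : r <= 1 by rewrite ge_min lexx.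
have rB : r * B <= e.
  apply: (@le_trans _ _ (r * (B + 1))); first by rewrite ler_wpM2l ?(ltW rp)// lerDl.
  by rewrite -ler_pdivlMr// ge_min lexx orbT.
have rr : r0 < r by rewrite r00.
have D1 : 1 <= 2 * pi :> R by have := pi_ge2 R; lra.
have D0 : 0 <= 2 * pi * r :> R by rewrite mulr_ge0 ?(ltW rp)//; lra.
have := hB r (ltW rp) (exprn_ile1 _ (ltW rp) r1); rewrite length_exterior// => hr.
have tg0 i : 0 <= a i * r ^- (2 * i) by apply: term_ge0.
have := le_trans (nneseries_scaled_ge k.+1 D0 tg0) hr; rewrite lee_fin => hk.
have : 2 * pi * r * (a k * r ^- (2 * k)) <= B.
  apply: le_trans hk; rewrite ler_wpM2l// big_ord_recr /= lerDr sumr_ge0//.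
move=> h; apply: le_trans rB.
have r2k : 0 < r ^+ (2 * k) by rewrite exprn_gt0.
have h' : r * a k * r ^- (2 * k) <= B.
  apply: le_trans h; rewrite -[r * a k * _]mulrA -[2 * pi * r * _]mulrA.
  by apply: ler_peMl => //; rewrite mulr_ge0 ?(ltW rp).
rewrite ler_pdivrMr// in h'.
rewrite -(ler_pM2l rp); apply: (le_trans h').
have -> : r * (r * B) = B * r ^+ 2 by ring.
by rewrite ler_wpM2l// ler_wiXn2l// ?(ltW rp)// leq_pmulr.
Qed.

Lemma length_formula_tail r : 0 < r -> r0 <= r ->
  H1 (E r) = ((2 * pi * r)%:E * (1 + \sum_(2 <= k <oo) (a k * r ^- (2 * k))%:E))%E.
Proof.
move=> rp rr; rewrite length_formula// (nneseries_split 0 2); last first.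
  by move=> k _; rewrite lee_fin term_ge0.
have phid z : r0 < normc z -> strict_deriv phi z (s z ^+ 2).
  by move=> zr; have := phi_deriv zr; rewrite -(s_sqrE zr).
have c0 := laurent_coef0 r0_ge0 s_deriv s_laurent s_lim.
have c1 := laurent_coef_m1 r0_ge0 s_deriv s_laurent s_lim phid.
congr (_ * (_ + _))%E; rewrite add0n big_nat_recr//= big_nat1 /a oppr0 c0 c1.
by rewrite normc1 normc0 expr0n muln0 expr0 mul0r expr1n invr1 mulr1 adde0.
Qed.

End LengthFormula.

(** * Levels and radii *)

Lemma holomorphic_continuous (R : realType) (D : set R[i]) (f : R[i] -> R[i]) z :
  holomorphic_on D f -> D z -> {for z, continuous f}.
Proof. by move=> fD /fD; move=> /derivable1_diffP /differentiable_continuous. Qed.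

Section LevelRadius.
Variable R : realType.
Local Notation C := R[i].
Implicit Types (P : {poly C}) (t : R) (n : nat).

Lemma level_set_radius P t n : (0 < n)%N ->
  level_set P t = [set x | normc P.[x] = expR (t / n%:R) ^+ n].
Proof.
move=> n0; rewrite -expRM_natl mulrC divfK ?pnatr_eq0 -?lt0n//.
apply/seteqP; split => x /=; rewrite /level_set /lnabs /=.
  have [//|xp [<-]] := leP (normc P.[x]) 0.
  by rewrite lnK.
by move=> ->; rewrite leNgt expR_gt0 /= expRK.
Qed.

Lemma critical_value_radius P n x : (0 < n)%N -> max_singular P != +oo%E ->
  root P^`() x -> normc P.[x] <= fine (expeR (n%:R^-1%:E * max_singular P)) ^+ n.
Proof.
move=> n0 Toox Px; have : (lnabs P x <= max_singular P)%E.
  by apply: ereal_sup_ubound; exists x.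
rewrite -lee_expeR /lnabs lneK; last by rewrite in_itv/= leey lee_fin normc_ge0.
case: (max_singular P) Toox => [tau|//|] _ /=; rewrite lee_fin.
  by rewrite -expRM_natl mulrA divff ?pnatr_eq0 -?lt0n// mul1r.
by rewrite gt0_muleNy ?lte_fin ?invr_gt0 ?ltr0n//= expr0n gtn_eqF.
Qed.

End LevelRadius.

(* The summands of the last series are products in \bar R, where 0 * +oo = 0:
   if T = -oo, then expeR (- (q * T)) = +oo for q > 0, and the terms with
   c (- k) = 0 are 0. *)
Theorem theorem4 (R : realType) (n : nat) (P : {poly R[i]})
    (phi s : R[i] -> R[i]) (c : int -> R[i]) :
  (2 <= n)%N -> P \is monic -> size P = n.+1 ->
  let T := max_singular P in
  let D := exterior n T in
  holomorphic_on D phi ->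
  (forall z, D z -> P.[phi z] = z ^+ n) ->
  phi z / z @[z --> @cinfty R] --> (1 : R[i]) ->
  holomorphic_on D s ->
  (forall z, D z -> s z ^+ 2 = (phi^`())%classic z) ->
  s z @[z --> @cinfty R] --> (1 : R[i]) ->
  laurent_coefs_at_infty s c ->
  (forall t : R, (T <= t%:E)%E ->
     hausdorff1 (level_set P t) =
     ((2 * pi * expR (t / n%:R))%:E *
      (1 + \sum_(2 <= k <oo)
             (normc (c (- k%:Z)) ^+ 2 * expR (- (2 * k%:R * t / n%:R)))%:E))%E)
  /\
  (\sum_(2 <= k <oo)
      (normc (c (- k%:Z)) ^+ 2)%:E * expeR (- ((2 * k%:R / n%:R)%:E * T))
    < +oo)%E.
Proof.
move=> n_gt1 P_monic P_size T D phi_hol phi_eq phi_lim s_hol s_sqr s_lim s_laurent.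
have n0 : (0 < n)%N by apply: ltnW.
have Toox : T != +oo%E.
  have [|z _ TE] := @max_singularP R P; first by rewrite P_size.
  by rewrite /T TE /lnabs /=; case: ifP.
pose r0 := fine (expeR (n%:R^-1%:E * T)).
have r0E : expeR (n%:R^-1%:E * T) = r0%:E.
  rewrite fineK// ge0_fin_numE ?expeR_ge0// ltey expeR_eqy.
  by case: (T) Toox => [?|//|] _ //; rewrite gt0_muleNy ?lte_fin ?invr_gt0 ?ltr0n.
have r0_ge0 : 0 <= r0 by rewrite -lee_fin -r0E expeR_ge0.
have Dr z : r0 < normc z -> D z by move=> zr; rewrite /D /exterior /= r0E lte_fin.
have crit x : root P^`() x -> normc P.[x] <= r0 ^+ n by apply: critical_value_radius.
have phi_c z (zr : r0 < normc z) := holomorphic_continuous phi_hol (Dr z zr).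
have s_c z (zr : r0 < normc z) := holomorphic_continuous s_hol (Dr z zr).
have phi_e z (zr : r0 < normc z) := phi_eq z (Dr z zr).
have s_s z (zr : r0 < normc z) := s_sqr z (Dr z zr).
have formula t : (T <= t%:E)%E -> hausdorff1 (level_set P t) =
    ((2 * pi * expR (t / n%:R))%:E * (1 + \sum_(2 <= k <oo)
      (normc (c (- k%:Z)) ^+ 2 * expR (- (2 * k%:R * t / n%:R)))%:E))%E.
  move=> Tt; rewrite (level_set_radius _ _ n0).
  have r0t : r0 <= expR (t / n%:R).
    rewrite -lee_fin -r0E -[(expR _)%:E]/(expeR (t / n%:R)%:E) lee_expeR.
    by rewrite [in leRHS]mulrC EFinM lee_wpmul2l// lee_fin invr_ge0.
  rewrite (length_formula_tail n_gt1 P_monic P_size r0_ge0 crit phi_c phi_e phi_lim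
    s_c s_s s_lim s_laurent (expR_gt0 _) r0t).
  congr (_ * (_ + _))%E; apply: eq_eseriesr => k _; congr (_ * _)%:E.
  rewrite -expRM_natl -expRN; congr (expR (- _)).
  by rewrite natrM !mulrA.
split => //.
case TE : T => [tau| |]; last first.
- rewrite eseries0 ?ltry// => k k2 _.
  have r00 : r0 = 0.
    by rewrite /r0 TE gt0_muleNy ?lte_fin ?invr_gt0 ?ltr0n.
  rewrite (coef_eq0 n_gt1 P_monic P_size r0_ge0 crit phi_c phi_e phi_lim
    s_c s_s s_lim s_laurent r00 (ltnW k2)).
  by rewrite normc0 expr0n mul0e.
- by rewrite TE eqxx in Toox.
have := formula tau; rewrite TE lexx => /(_ isT) fE.
have [B B0 hB] := length_bounded n_gt1 P_monic P_size (expR (tau / n%:R) ^+ n).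
have := hB _ (ltW (expR_gt0 (tau / n%:R))) (lexx _).
rewrite -level_set_radius// fE => SB.
rewrite (eq_eseriesr (g := fun k =>
  (normc (c (- k%:Z)) ^+ 2 * expR (- (2 * k%:R * tau / n%:R)))%:E)); last first.
  by move=> k _; rewrite [RHS]EFinM /= [2 * _ / _ * _]mulrAC.
rewrite ltey; apply: contraTneq SB => ->.
by rewrite addey// gt0_muley ?leye_eq// lte_fin !mulr_gt0 ?pi_gt0 ?expR_gt0.
Qed.
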